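(* Let $C$ be a narrowly closed convex subset of $M_1(E)$ such that $H(C\mid\alpha)<+\infty$, and let $\alpha^*$ be the $I$-projection of $\alpha$ on $C$. Assume that there exist a sequence $(K_n)_n$ of compact subsets of $E$ and a sequence $(\eta_n)_n$ of positive real numbers going to $0$ such that $$n\eta_n^2+8(\log\eta_n)\,N_E(K_n,d,\eta_n/8)\to+\infty$$ as $n\to\infty$. Let $\varepsilon_n=\eta_n+2\alpha^*(K_n^c)$ and $C_n=\{\nu\in M_1(E):\bar d(C,\nu)\le\varepsilon_n\}$, where $\bar d$ is either $d_P$ or $d_{FM}$. Assume that one of the following holds: - $\lim_{n\to\infty}(\alpha^*(K_n))^n=1$; - $\log\frac{d\alpha^*}{d\alpha}$ is continuous and bounded, and $\lim_{n\to\infty}\alpha^*(K_n)=1$. Then, for every integer $k\ge1$, $\alpha^n_{C_n,k}\to(\alpha^* )^{\otimes k}$ in total variation distance as $n\to\infty$.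
   Context: $(E,d)$ is a Polish space, $M_1(E)$ is the set of Borel probability measures on $E$ with the narrow topology (convergence in law), $\alpha\in M_1(E)$. For $x\in E^n$, $L_n=L_n^x=\frac1n\sum_{i=1}^n\delta_{x_i}$; for $A\subseteq M_1(E)$ with $\alpha^{\otimes n}(L_n\in A)>0$ and $k\le n$, $\alpha^n_{A,k}(D)=\alpha^{\otimes n}((x_1,\dots,x_k)\in D\mid L_n^x\in A)$. $H(\beta\mid\gamma)=\int\log\frac{d\beta}{d\gamma}\,d\beta$ if $\beta\ll\gamma$ and this is finite, $+\infty$ otherwise; $H(C\mid\alpha)=\inf_{\nu\in C}H(\nu\mid\alpha)$; the $I$-projection of $\alpha$ on $C$ is the unique $\alpha^*\in C$ with $H(\alpha^*\mid\alpha)=H(C\mid\alpha)$ (it exists here). Prohorov metric: $d_P(\nu_1,\nu_2)=\inf\{r>0:\sup_A(\nu_1(A)-\nu_2(A^r))\le r\}$, where $A$ ranges over Borel sets and $A^r=\{x:d(x,A)\le r\}$. Fortet–Mourier metric: $d_{FM}(\nu_1,\nu_2)=\sup\{\int f\,(d\nu_1-d\nu_2):f\text{ bounded Lipschitz},\ \|f\|_\infty+\|f\|_{Lip}\le1\}$. For a totally bounded $A\subseteq E$, $N_E(A,d,\varepsilon)$ is the minimal number of open $d$-balls of $E$ of radius $\varepsilon$ needed to cover $A$. $K^c$ denotes the complement of $K$. *)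

(* Defs.v *)
From HB Require Import structures.
From mathcomp Require Import all_boot all_order all_algebra.
From mathcomp Require Import all_classical all_reals all_analysis.

Set Implicit Arguments.
Unset Strict Implicit.
Unset Printing Implicit Defensive.

Import Order.TTheory GRing.Theory Num.Theory.
Import numFieldNormedType.Exports.

Local Open Scope classical_set_scope.
Local Open Scope ring_scope.

(* [Complete] brings a distinguished point with it; this only excludes the
   empty space, which carries no probability measure. *)
#[short(type="completeMetricType")]
HB.structure Definition CompleteMetric (R : numDomainType) :=
  {T of Complete T & Metric R T}.

Definition separable (T : topologicalType) :=
  exists2 S : set T, countable S & dense S.

Notation borel E := (g_sigma_algebraType (@open E)).

(* M_1(E).  Two elements may differ as functions on non-Borel sets while being
   the same Borel measure; every notion below depends only on the values on
   Borel sets, and narrowly closed sets do not separate such elements. *)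
Notation M1 E R := (probability (borel E) R).

Section product_power.
Context {R : realType}.

Section product.
Context d1 d2 (T1 : measurableType d1) (T2 : measurableType d2).
Variables (P : probability T1 R) (Q : probability T2 R).

Definition prodm : set (T1 * T2) -> \bar R := (P \x Q)%E.

HB.instance Definition _ := Measure.on prodm.

Let prodm_setT : prodm setT = 1%E.
Proof.
rewrite -setXTT /prodm product_measure1E//.
exact: etrans (f_equal2 mule (probability_setT P) (probability_setT Q))
  (mule1 _).
Qed.

HB.instance Definition _ :=
  Measure_isProbability.Build _ _ _ prodm prodm_setT.
End product.

Context d (T : measurableType d).

Definition tcons n (x : T * n.-tuple T) : n.+1.-tuple T :=
  [the n.+1.-tuple T of x.1 :: x.2].

Let measurable_tcons n : measurable_fun setT (@tcons n).
Proof. exact: measurable_cons. Qed.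

HB.instance Definition _ n :=
  isMeasurableFun.Build _ _ _ _ (@tcons n) (@measurable_tcons n).

(* [powerm P n] is the n-fold product measure of P. *)
Fixpoint powerm (P : probability T R) (n : nat) : probability (n.-tuple T) R :=
  match n with
  | 0 => \d_([tuple] : 0.-tuple T)
  | m.+1 => distribution (prodm P (powerm P m)) (@tcons m)
  end.

Lemma powermE (P : probability T R) n (A : 'I_n -> set T) :
  (forall i, measurable (A i)) ->
  powerm P n [set x | forall i, A i (tnth x i)] = (\prod_(i < n) P (A i))%E.
Proof.
elim: n A => [|n IH] A mA.
  by rewrite big_ord0 /= diracE mem_set// => -[].
rewrite big_ord_recl -IH//= /distribution /pushforward.
transitivity (prodm P (powerm P n)
  (A ord0 `*` [set x | forall i, A (lift ord0 i) (tnth x i)])).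
  congr (prodm _ _ _); apply/seteqP; split => -[a x] /= Ax.
    split; first exact: (Ax ord0).
    by move=> i; have := Ax (lift ord0 i); rewrite tnthS.
  case: Ax => Aa Ax i; case: (unliftP ord0 i) => [j|] ->; rewrite ?tnthS//.
rewrite /prodm product_measure1E//.
rewrite [X in measurable X](_ : _ = \bigcap_(i in [set: 'I_n])
  ((@tnth n T ^~ i) @^-1` A (lift ord0 i))); last first.
  by apply/seteqP; split => x /= H i; [move=> _|]; exact: H.
apply: fin_bigcap_measurable => // i _.
by rewrite -[X in measurable X]setTI; exact: measurable_tnth.
Qed.

End product_power.

Section tv.
Context d (T : measurableType d) (R : realType).

Definition tv_dist (mu nu : set T -> \bar R) : \bar R :=
  ereal_sup [set (`|mu D - nu D|)%E | D in measurable].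

End tv.

Section empirical.
Context {R : realType} d (T : measurableType d).

(* The sum of the n Dirac masses has total mass n, so that normalising it
   divides by n (see [empiricalE]); the Dirac mass at [point] is the value of
   [mnormalize] in the irrelevant case n = 0. *)
Definition empirical n (x : n.-tuple T) : probability T R :=
  mnormalize (msum (fun i => \d_(nth point x i)) n) (\d_point : probability T R).

Lemma empiricalE n (x : n.-tuple T) A : (0 < n)%N ->
  empirical x A = ((n%:R^-1)%:E * \sum_(i < n) \d_(tnth x i) A)%E.
Proof.
move=> n0; rewrite /empirical /= /mnormalize /=.
have -> : msum (fun i => \d_(nth point x i)) n setT = n%:R%:E :> \bar R.
  rewrite /msum (eq_bigr (fun=> 1%E)) => [|i _]; last first.
    exact: (@diracT _ _ R).
  by rewrite sumEFin big_const_ord iter_addr addr0.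
rewrite eqe pnatr_eq0 gtn_eqF//= muleC; congr *%E.
by rewrite /msum; apply: eq_bigr => i _ /=; rewrite (tnth_nth point).
Qed.

End empirical.

Section conditioning.
Context d (T : measurableType d) (R : realType).

(* The first k coordinates (padded with [point] when k > n). *)
Definition prefix n k (x : n.-tuple T) : k.-tuple T :=
  [tuple nth point x i | i < k].

(* The law of (x_1, ..., x_k) under alpha^{\otimes n} given L_n \in A.  When the
   conditioning event is null this is the zero function, which is at total
   variation distance 1 from any probability: convergence of [cond_law] to a
   probability thus entails that the event has positive mass for large n. *)
Definition cond_law (alpha : probability T R) (A : set (probability T R))
    (n k : nat) (D : set (k.-tuple T)) : \bar R :=
  (powerm alpha n [set x : n.-tuple T | D (prefix k x) /\ A (empirical x)]
   / powerm alpha n [set x : n.-tuple T | A (empirical x)])%E.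

End conditioning.

Section entropy.
Context d (T : measurableType d) (R : realType).
Implicit Types (alpha beta gamma : probability T R) (C : set (probability T R)).

Definition density beta gamma : T -> \bar R :=
  Radon_Nikodym (charge_of_finite_measure beta) gamma.

Definition rel_entropy beta gamma : \bar R :=
  let I := (\int[beta]_x lne (density beta gamma x))%E in
  if `[< beta `<< gamma >] && (I \is a fin_num) then I else +oo%E.

Definition rel_entropy_set C alpha : \bar R :=
  ereal_inf [set rel_entropy nu alpha | nu in C].

(* For convex C and finite [rel_entropy_set C alpha], strict convexity makes
   alpha' unique as a measure. *)
Definition is_I_projection alpha C alpha' :=
  C alpha' /\ rel_entropy alpha' alpha = rel_entropy_set C alpha.

Definition convex_measures C :=
  forall (mu nu rho : probability T R) (t : R), C mu -> C nu -> 0 <= t <= 1 ->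
    (forall A, measurable A ->
      rho A = t%:E * mu A + (1 - t)%:E * nu A)%E ->
    C rho.

End entropy.

Section metrics.
Context {R : realType} {E : completeMetricType R}.
Implicit Types (f : E -> R) (mu nu : M1 E R).

Definition cont_bounded := {f : E -> R | continuous f /\ bounded_fun f}.

Definition narrow_eval nu : {ptws cont_bounded -> R} :=
  fun h => \int[nu]_x (sval h x).

Definition narrow_closed (C : set (M1 E R)) :=
  closed (C : set (initial_topology narrow_eval)).

(* +oo when A is empty *)
Definition dist_set (x : E) (A : set E) : \bar R :=
  ereal_inf [set (mdist x y)%:E | y in A].

Definition enlarge (A : set E) (r : R) : set E :=
  [set x | dist_set x A <= r%:E]%E.

Definition prohorov mu nu : \bar R :=
  ereal_inf [set r%:E | r in [set r : R | 0 < r /\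
    (ereal_sup [set mu A - nu (enlarge A r) |
                A in (measurable : set (set (borel E)))] <= r%:E)%E]].

Definition sup_norm f : \bar R := ereal_sup [set `|f x|%:E | x in setT].

(* The diagonal contributes 0 / 0 = 0. *)
Definition lip_norm f : \bar R :=
  ereal_sup [set (`|f p.1 - f p.2| / mdist p.1 p.2)%:E | p in setT].

(* The bound on the norms makes f bounded and Lipschitz. *)
Definition fortet_mourier mu nu : \bar R :=
  ereal_sup [set (\int[mu]_x (f x)%:E - \int[nu]_x (f x)%:E)%E |
             f in [set f | sup_norm f + lip_norm f <= 1]%E].

Definition closed_nbhd (dbar : M1 E R -> M1 E R -> \bar R) (C : set (M1 E R))
    (e : \bar R) : set (M1 E R) :=
  [set nu | ereal_inf [set dbar mu nu | mu in C] <= e]%E.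

(* Meaningful when A can be covered by finitely many balls of radius e, the
   infimum of a nonempty set of natural numbers being then its minimum. *)
Definition covering_number (A : set E) (e : R) : R :=
  inf [set n%:R | n in [set n : nat | exists x : n.-tuple E,
    A `<=` \bigcup_(i in [set: 'I_n]) ball (tnth x i) e]].

End metrics.

(* Main.v *)
Require Import Defs.
From HB Require Import structures.
From mathcomp Require Import all_boot all_order all_algebra.
From mathcomp Require Import all_classical all_reals all_analysis.
From mathcomp Require Import measurable_realfun.
From mathcomp Require Import zify ring lra.

Set Implicit Arguments.
Unset Strict Implicit.
Unset Printing Implicit Defensive.

Import Order.TTheory GRing.Theory Num.Theory.
Import numFieldNormedType.Exports.

Local Open Scope classical_set_scope.
Local Open Scope ring_scope.

(** Let [P] be the [I]-projection, [h] its density and [H] its relative entropy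
    with respect to [alpha]. Let [p] be the probability under [alpha^n] that the
    empirical measure lies in [Cn n], and let [g] be the density of the first
    marginal [q] of the conditioned law of the whole sample. This law is
    exchangeable, with relative entropy [- ln p] with respect to [alpha^n]. The
    theorem follows from matching upper and lower bounds on the entropies.

    Upper bound. Either assumption on [alphas (K n)] gives [alphas (K n) --> 1].
    A cover of [K n] by balls of radius [eta n / 8] yields a partition into few
    cells compared with [n * eta n ^+ 2], by the growth condition; so under [P^n]
    the empirical frequencies of the cells are close to their probabilities, the
    empirical measure is within [eps n] of [P], and the conditioning event has
    probability close to 1 ([nbhd_event_prob]). A change of measure then gives
    [- ln p <= n (H + delta)] for large [n] ([event_prob_lower]).

    Lower bound. By exchangeability [q] is the mean of the empirical measure under
    the conditioned law, so it almost satisfies, uniformly, every inequality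
    [c <= \int f] that holds on [C] for a 1-Lipschitz [f] with values in the unit
    interval ([cond_density_almost_in]). By Hahn-Banach such inequalities define
    [C] ([closed_test]), and a Cauchy-sequence argument based on the
    parallelogram inequality for the entropy shows that almost satisfying them
    costs an entropy at least [H - delta] ([entropy_gap], [almost_in_entropy]).
    As [h] satisfies them too, this applies both to [g] and to its midpoint with
    [h].

    Superadditivity of the entropy gives [n * Ent g <= - ln p], so [g], [h] and
    their midpoint all have entropy [H] up to [delta]; the parallelogram
    inequality ([L1_le_entropy]) makes [g] close to [h] in [L^1]. Moreover the
    relative entropy of the conditioned law with respect to [q^n] is
    [- ln p - n * Ent g <= 2 n delta]. Shared between [n / k] blocks of [k]
    coordinates, which all have the same law, it leaves [O(k delta)] for each, so
    the law of a block is close to [q^k] ([conditioned_block_le]), which is close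
    to [P^k] ([integral_powerm_le]). With [delta = l ^+ 2], the total variation
    distance is at most [(2 + 9 k) l] for large [n] ([cond_law_close]). *)

(** * Integrals of nonnegative functions over the whole space *)

Section nonnegative.
Context {R : realType} d (T : measurableType d) (mu : {measure set T -> \bar R}).
Implicit Types f g : T -> \bar R.
Local Open Scope ereal_scope.

Lemma measurable_EFin (h : T -> R) :
  measurable_fun setT h -> measurable_fun setT (fun x => (h x)%:E).
Proof. by move=> mh; apply/measurable_EFinP. Qed.

Lemma ge0_intD f g : measurable_fun setT f -> measurable_fun setT g ->
  (forall x, 0 <= f x) -> (forall x, 0 <= g x) ->
  \int[mu]_x (f x + g x) = \int[mu]_x f x + \int[mu]_x g x.
Proof. by move=> mf mg f0 g0; rewrite ge0_integralD. Qed.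

Lemma ge0_intZl k f : measurable_fun setT f -> (forall x, 0 <= f x) ->
  0 <= k -> \int[mu]_x (k * f x) = k * \int[mu]_x f x.
Proof. by move=> mf f0 k0; rewrite ge0_integralZl. Qed.

Lemma ge0_intZr k f : measurable_fun setT f -> (forall x, 0 <= f x) ->
  0 <= k -> \int[mu]_x (f x * k) = \int[mu]_x f x * k.
Proof. by move=> mf f0 k0; rewrite ge0_integralZr. Qed.

Lemma ge0_int_le f g : measurable_fun setT f -> measurable_fun setT g ->
  (forall x, 0 <= f x) -> (forall x, f x <= g x) ->
  \int[mu]_x f x <= \int[mu]_x g x.
Proof. by move=> mf mg f0 fg; apply: ge0_le_integral. Qed.

Lemma ge0_int f : (forall x, 0 <= f x) -> 0 <= \int[mu]_x f x.
Proof. by move=> f0; apply: integral_ge0. Qed.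

End nonnegative.

(** * The entropy integrand *)

Section entropy_integrand.
Context {R : realType}.
Implicit Types a b m u x : R.

(** The usual integrand [u log u], shifted by an affine function that
    integrates to 0 against a probability density: being nonnegative, its
    integral makes sense without any integrability assumption. *)
Definition entf u : R := u * ln u - u + 1.

Lemma ln_ge1BV x : 0 < x -> 1 - x^-1 <= ln x.
Proof.
move=> x0; have := expR_ge1Dx (- ln x).
by rewrite expRN lnK ?posrE//; lra.
Qed.

Lemma entf_ge0 u : 0 <= u -> 0 <= entf u.
Proof.
rewrite le_eqVlt => /predU1P[<-|u0]; first by rewrite /entf mul0r; lra.
have := ler_wpM2l (ltW u0) (ln_ge1BV u0).
rewrite mulrBr mulr1 divff ?gt_eqF// /entf; lra.
Qed.

Lemma xlnx_ge_sqrt a m : 0 <= a -> 0 < m ->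
  2 * (a - Num.sqrt a * Num.sqrt m) <= a * ln a - a * ln m.
Proof.
rewrite le_eqVlt => /predU1P[<- m0|a0 m0]; first by rewrite sqrtr0; lra.
set s := Num.sqrt a; set t := Num.sqrt m.
have s0 : 0 < s by rewrite sqrtr_gt0.
have t0 : 0 < t by rewrite sqrtr_gt0.
have aE : a = s ^+ 2 by rewrite sqr_sqrtr// ltW.
have mE : m = t ^+ 2 by rewrite sqr_sqrtr// ltW.
have st0 : 0 < s / t by rewrite divr_gt0.
have := ler_wpM2l (sqr_ge0 s) (ln_ge1BV st0).
rewrite aE mE !lnXn// ln_div ?posrE// invf_div.
have -> : s ^+ 2 * (1 - t / s) = s ^+ 2 - s * t.
  by field; rewrite gt_eqF.
nra.
Qed.

(** The convexity defect of [entf] between [a] and [b] dominates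
    [(sqrt a - sqrt b)^2 / 2], as shown by [ln x >= 2 (1 - 1 / sqrt x)].
    Integrated against a reference probability and optimised in [l], this is
    both a parallelogram inequality for the relative entropy and Pinsker's
    inequality, up to constants. *)
Lemma entf_midpoint a b l : 0 <= a -> 0 <= b -> 0 < l ->
  `|a - b| <= (entf a + entf b - 2 * entf ((a + b) / 2)) / l + l * (a + b).
Proof.
move=> a0 b0 l0; set m := (a + b) / 2.
have [m0|m0] := leP m 0.
  have a00 : a = 0 by rewrite /m in m0; lra.
  have b00 : b = 0 by rewrite /m in m0; lra.
  rewrite /m a00 b00 subr0 addr0 mul0r normr0.
  have -> : entf 0 + entf 0 - 2 * entf 0 = 0 :> R by ring.
  by rewrite mul0r mulr0 addr0.
have Ha := xlnx_ge_sqrt a0 m0; have Hb := xlnx_ge_sqrt b0 m0.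
set s := Num.sqrt a in Ha *; set t := Num.sqrt b in Hb *.
set r := Num.sqrt m in Ha Hb *.
have s0 : 0 <= s by exact: sqrtr_ge0.
have t0 : 0 <= t by exact: sqrtr_ge0.
have r0 : 0 < r by rewrite sqrtr_gt0.
have aE : a = s ^+ 2 by rewrite sqr_sqrtr.
have bE : b = t ^+ 2 by rewrite sqr_sqrtr.
have mE : (a + b) / 2 = r ^+ 2 by rewrite sqr_sqrtr// ltW.
have JE : entf a + entf b - 2 * entf m =
    (a * ln a - a * ln m) + (b * ln b - b * ln m).
  rewrite /entf; have -> : a = 2 * m - b by rewrite /m; field.
  by ring.
set J := entf a + _ - _.
have J1 : (s - t) ^+ 2 / 2 <= J.
  rewrite /J JE; apply: le_trans (lerD Ha Hb).
  rewrite aE bE.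
  have r2 : 2 * r ^+ 2 = s ^+ 2 + t ^+ 2 by rewrite -mE aE bE; field.
  have := sqr_ge0 (2 * r - (s + t)).
  nra.
have K : `|a - b| = `|s - t| * (s + t).
  by rewrite aE bE subr_sqr normrM (ger0_norm (addr_ge0 s0 t0)).
have J2 : J = (J / l) * l by rewrite divfK// gt_eqF.
have K2 : `|s - t| ^+ 2 = (s - t) ^+ 2 by rewrite real_normK ?num_real.
have B0 : (s + t) ^+ 2 <= 2 * (a + b).
  by rewrite aE bE; have := sqr_ge0 (s - t); nra.
rewrite K -(ler_pM2r l0) mulrDl divfK ?gt_eqF//.
apply: (@le_trans _ _ (`|s - t| ^+ 2 / 2 + l ^+ 2 * (s + t) ^+ 2 / 2)).
  have := sqr_ge0 (`|s - t| - l * (s + t)); nra.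
by rewrite K2; apply: lerD => //; have := sqr_ge0 l; nra.
Qed.

End entropy_integrand.

(** * Integration against product powers *)

Lemma integral_prob_cst {R : realType} d (T : measurableType d)
  (P : probability T R) (r : \bar R) : (\int[P]_x r = r)%E.
Proof.
have := integral_cst P measurableT r; rewrite /cst => ->.
by rewrite -[RHS]mule1; congr (_ * _)%E; exact: probability_setT.
Qed.

Section product_power.
Context {R : realType} d (T : measurableType d).
Implicit Types (P : probability T R) (n k : nat).

Definition gather n k (s : nat -> nat) (x : n.-tuple T) : k.-tuple T :=
  [tuple nth point x (s i) | i < k].

Lemma nth_gather n k s (x : n.-tuple T) i : (i < k)%N ->
  nth point (gather k s x) i = nth point x (s i).
Proof. by move=> ik; rewrite -(tnth_nth _ _ (Ordinal ik)) tnth_mktuple. Qed.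

Lemma measurable_nth n i :
  measurable_fun [set: n.-tuple T] (fun x => nth point x i).
Proof.
have [iltn|nlei] := ltnP i n.
  rewrite (_ : (fun x => _) = (@tnth n T ^~ (Ordinal iltn))).
    exact: measurable_tnth.
  by apply/funext => x; rewrite (tnth_nth point).
rewrite (_ : (fun x => _) = cst point); first exact: measurable_cst.
by apply/funext => x; rewrite nth_default// size_tuple.
Qed.

Lemma measurable_gather n k s : measurable_fun setT (@gather n k s).
Proof.
apply/measurable_fun_tnthP => i.
rewrite (_ : _ \o _ = fun x : n.-tuple T => nth point x (s i)).
  exact: measurable_nth.
by apply/funext => x /=; rewrite tnth_mktuple.
Qed.

HB.instance Definition _ n k s :=
  isMeasurableFun.Build _ _ _ _ (@gather n k s) (@measurable_gather n k s).

Definition rectangle n (A : 'I_n -> set T) : set (n.-tuple T) :=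
  [set x | forall i, A i (tnth x i)].

Lemma measurable_rectangle n (A : 'I_n -> set T) :
  (forall i, measurable (A i)) -> measurable (rectangle A).
Proof.
move=> mA; rewrite [X in measurable X](_ : _ = \bigcap_(i in [set: 'I_n])
  ((@tnth n T ^~ i) @^-1` A i)); last first.
  by apply/seteqP; split => x /= H i; [move=> _|]; exact: H.
apply: fin_bigcap_measurable => // i _.
by rewrite -[X in measurable X]setTI; exact: measurable_tnth.
Qed.

Definition rectangles n : set (set (n.-tuple T)) :=
  [set rectangle A | A in [set A | forall i, measurable (A i)]].

Lemma measurable_tupleE n : @measurable _ (n.-tuple T) = <<s @rectangles n >>.
Proof.
apply/seteqP; split.
  apply: smallest_sub; first exact: smallest_sigma_algebra.
  rewrite -bigcup_seq => B /= [i _ [Y mY <-]]; rewrite setTI.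
  apply: sub_sigma_algebra.
  exists (fun j => if j == i then Y else setT).
    by move=> j /=; case: ifP.
  apply/seteqP; split => [x /(_ i)|x /= Yx j]; first by rewrite eqxx.
  by case: eqP => // ->.
apply: smallest_sub; first exact: sigma_algebra_measurable.
by move=> _ [A mA <-]; exact: measurable_rectangle.
Qed.

Lemma rectangles_setI n : setI_closed (@rectangles n).
Proof.
move=> _ _ [A mA <-] [B mB <-]; exists (fun i => A i `&` B i).
  by move=> i /=; apply: measurableI; [exact: mA|exact: mB].
apply/seteqP; split => [x /= H|x /= [HA HB] i]; last by split.
by split => i; have [] := H i.
Qed.

(** Distinct coordinates of a product power are independent and identically
    distributed; this gives at once the marginals and the invariance under
    permutations. *)
Lemma powerm_gather P n k s D : (forall i, (i < k)%N -> (s i < n)%N) ->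
  (forall i j, (i < k)%N -> (j < k)%N -> s i = s j -> i = j) ->
  measurable D -> powerm P n (gather k s @^-1` D) = powerm P k D.
Proof.
move=> sn sinj mD.
apply: (measure_unique (@rectangles k) (fun=> setT) _ _ _ _
  (distribution (powerm P n) (gather k s)) (powerm P k)) => //.
- exact: measurable_tupleE.
- exact: rectangles_setI.
- by move=> _; exists (fun=> setT) => //; apply/seteqP; split.
- by apply/seteqP; split => // x _; exists 0%N.
- move=> _ [A mA <-]; rewrite [RHS]powermE//.
  pose B (j : 'I_n) := \bigcap_(i in [set i : 'I_k | s i = j]) A i.
  have mB j : measurable (B j) by apply: fin_bigcap_measurable.
  transitivity (powerm P n (rectangle B)).
    congr (powerm P n _); apply/seteqP; split => x /= H.
      move=> j i /= sij; have := H i; rewrite tnth_mktuple sij.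
      by rewrite (tnth_nth point).
    move=> i; rewrite tnth_mktuple -(tnth_nth _ _ (Ordinal (sn i (ltn_ord i)))).
    exact: H.
  rewrite powermE//.
  rewrite (bigID (fun j => j \in [seq (Ordinal (sn i (ltn_ord i))) | i : 'I_k]))/=.
  rewrite [X in (_ * X)%E]big1 ?mule1; last first.
    move=> j jn; rewrite /B (_ : \bigcap_(i in _) _ = setT) ?probability_setT//.
    apply/seteqP; split => // y _ i /= sij; exfalso; move/negP: jn; apply.
    by apply/fintype.imageP; exists i => //; apply/val_inj.
  rewrite -big_uniq/=; last first.
    rewrite map_inj_uniq ?enum_uniq// => i j [] /sinj ij; apply/val_inj.
    by apply: ij.
  rewrite big_image/=; apply: eq_bigr => i _; congr (P _).
  apply/seteqP; split => [x Bx|x Ax i' /= /sinj ii']; first exact: Bx.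
  by have -> : i' = i by apply/val_inj; exact: ii'.
- by move=> _; rewrite -ge0_fin_numE//; apply: fin_num_measure.
Qed.


Lemma ge0_integral_gather P n k s (F : k.-tuple T -> \bar R) :
  (forall i, (i < k)%N -> (s i < n)%N) ->
  (forall i j, (i < k)%N -> (j < k)%N -> s i = s j -> i = j) ->
  measurable_fun [set: k.-tuple T] F -> (forall x, 0 <= F x)%E ->
  (\int[powerm P n]_x F (gather k s x) = \int[powerm P k]_x F x)%E.
Proof.
move=> sn sinj mF F0.
rewrite -(ge0_integral_distribution (gather k s) mF F0).
by apply: eq_measure_integral => A mA _; exact: powerm_gather.
Qed.

(** In what follows a function of an [n]-tuple is given as a function of lists,
    so that shifting or splitting a tuple requires no change of type. *)
Notation mseq n F := (measurable_fun [set: n.-tuple T] (fun x => F (tval x))).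

Lemma mseq_cons d' (V : measurableType d') n (F : seq T -> V) :
  mseq n.+1 F -> measurable_fun [set: T * n.-tuple T] (fun z : T * n.-tuple T => F (z.1 :: z.2)).
Proof.
move=> mF.
exact: (measurableT_comp mF (@measurable_cons _ _ _ _ fst _ snd _ _)).
Qed.

Lemma mseq_cons1 d' (V : measurableType d') n (F : seq T -> V) a :
  mseq n.+1 F -> mseq n (fun x => F (a :: x)).
Proof.
move=> mF.
have mp : measurable_fun setT (fun x : n.-tuple T => (a, x)).
  exact: measurable_pair1.
exact: (measurableT_comp (mseq_cons mF) mp).
Qed.

Lemma measurable_integral_cons P n (F : seq T -> \bar R) :
  mseq n.+1 F -> (forall x, 0 <= F x)%E ->
  measurable_fun setT (fun a => \int[powerm P n]_x F (a :: x))%E.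
Proof.
move=> mF F0.
exact: (@measurable_fun_fubini_tonelli_F _ _ _ _ _ (powerm P n)
  (fun z : T * n.-tuple T => F (z.1 :: z.2)) (mseq_cons mF) (fun=> F0 _)).
Qed.

Lemma integral_powermS P n (F : seq T -> \bar R) :
  mseq n.+1 F -> (forall x, 0 <= F x)%E ->
  (\int[powerm P n.+1]_x F x =
   \int[P]_a \int[powerm P n]_x F (a :: x))%E.
Proof.
move=> mF F0; rewrite /= ge0_integral_distribution//.
exact: (@fubini_tonelli1 _ _ _ _ _ P (powerm P n)
  (fun z : T * n.-tuple T => F (z.1 :: z.2)) (mseq_cons mF) (fun=> F0 _)).
Qed.

Lemma integral_powerm0 P (F : seq T -> \bar R) :
  (forall x, 0 <= F x)%E -> (\int[powerm P 0]_x F x = F [::])%E.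
Proof.
move=> F0; rewrite /= (_ : (fun x => _) = cst (F [::])).
  by rewrite integral_dirac//= diracT mul1e.
by apply/funext => x; rewrite tuple0.
Qed.

Lemma mseq_take n k d' (V : measurableType d') (F : seq T -> V) :
  (k <= n)%N -> mseq k F -> mseq n (fun x => F (take k x)).
Proof.
move=> kn mF; rewrite (_ : (fun x => _) =
    (fun x : k.-tuple T => F x) \o @gather n k id).
  by apply: measurableT_comp => //; exact: measurable_gather.
apply/funext => x; congr (F _).
have sk : size (take k x) = k by rewrite size_takel// size_tuple.
apply: (@eq_from_nth _ point) => [|i]; rewrite sk ?size_tuple ?card_ord// => ik.
by rewrite nth_gather// nth_take.
Qed.

Lemma mseq_drop n k d' (V : measurableType d') (F : seq T -> V) :
  mseq n F -> mseq (k + n) (fun x => F (drop k x)).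
Proof.
move=> mF; rewrite (_ : (fun x => _) =
    (fun x : n.-tuple T => F x) \o @gather (k + n) n (addn k)).
  by apply: measurableT_comp => //; exact: measurable_gather.
apply/funext => x; congr (F _).
have sn : size (drop k x) = n by rewrite size_drop size_tuple addKn.
apply: (@eq_from_nth _ point) => [|i]; rewrite sn ?size_tuple ?card_ord// => ik.
by rewrite nth_gather// nth_drop.
Qed.

Lemma integral_powerm_split P k n (f g : seq T -> \bar R) :
  mseq k f -> mseq n g -> (forall x, 0 <= f x)%E -> (forall x, 0 <= g x)%E ->
  (\int[powerm P (k + n)]_x (f (take k x) * g (drop k x)) =
   \int[powerm P k]_x f x * \int[powerm P n]_x g x)%E.
Proof.
move=> + mg + g0; elim: k f => [|k IH] f mf f0.
  rewrite integral_powerm0//.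
  under eq_integral do rewrite take0 drop0.
  by rewrite ge0_integralZl.
rewrite addSn (@integral_powermS P (k + n)
  (fun x => f (take k.+1 x) * g (drop k.+1 x))%E).
- transitivity (\int[P]_a ((\int[powerm P k]_x f (a :: x)) *
      \int[powerm P n]_x g x))%E.
    apply: eq_integral => a _ /=.
    exact: (IH (fun x => f (a :: x)) (mseq_cons1 a mf)).
  rewrite ge0_integralZr//.
  + by rewrite -integral_powermS.
  + exact: measurable_integral_cons.
  + by move=> a _; apply: integral_ge0.
  + exact: integral_ge0.
- apply: emeasurable_funM.
    by apply: mseq_take => //; rewrite ltnS leq_addr.
  exact: (@mseq_drop _ k.+1).
- by move=> x; rewrite mule_ge0.
Qed.


Lemma integral_powerm_blocks P k m r (f : seq T -> \bar R) :
  mseq k f -> (forall x, 0 <= f x)%E ->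
  (\int[powerm P (m * k + r)]_x
      \prod_(b < m) f (take k (drop (b * k) x)) =
   (\int[powerm P k]_x f x) ^+ m)%E.
Proof.
move=> mf f0.
pose F m x : \bar R := (\prod_(b < m) f (take k (drop (b * k) x)))%E.
have FS m' x : F m'.+1 x = (f (take k x) * F m' (drop k x))%E.
  rewrite /F big_ord_recl mul0n drop0; congr (_ * _)%E.
  apply: eq_bigr => b _; congr (f (take k _)).
  by rewrite lift0 drop_drop mulSn addnC.
have F0 m' x : (0 <= F m' x)%E by apply: prode_ge0.
have mF m' : mseq (m' * k + r) (F m').
  elim: m' => [|m' IH].
    rewrite (_ : (fun _ => _) = cst 1%E); first exact: measurable_cst.
    by apply/funext => x; rewrite /F big_ord0.
  rewrite mulSn -addnA (_ : (fun _ => _) = (fun x : (k + (m' * k + r)).-tuple T =>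
    (f (take k x) * F m' (drop k x))%E)).
    apply: emeasurable_funM; last exact: mseq_drop.
    by apply: mseq_take => //; exact: leq_addr.
  by apply/funext => x; rewrite FS.
elim: m => [|m IH].
  rewrite (eq_integral (cst 1%E)); first exact: integral_prob_cst.
  by move=> x _; rewrite big_ord0.
rewrite expeS -IH mulSn -addnA.
rewrite -(integral_powerm_split P mf (mF m) f0 (F0 m)).
by apply: eq_integral => x _; exact: FS.
Qed.

End product_power.

Notation mseq n F := (measurable_fun [set: n.-tuple _] (fun x => F (tval x))).

(** * Probabilities given by densities *)

Section density.
Context {R : realType} d (T : measurableType d).
Implicit Types (P Q mu : probability T R) (f g : T -> R).

Definition is_density mu f := [/\ measurable_fun setT f, forall x, 0 <= f x &
  (\int[mu]_x (f x)%:E = 1)%E].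

Definition has_density P mu f :=
  forall A, measurable A -> P A = (\int[mu]_(x in A) (f x)%:E)%E.

Section construction.
Variables (mu : probability T R) (f : T -> R).

Definition density_measure of is_density mu f : set T -> \bar R :=
  fun A => (\int[mu]_(x in A) (f x)%:E)%E.

Hypothesis fd : is_density mu f.

Let mf : measurable_fun setT f. Proof. by case: fd. Qed.
Let f0 x : 0 <= f x. Proof. by case: fd. Qed.

Let density0 : density_measure fd set0 = 0%E.
Proof. by rewrite /density_measure integral_set0. Qed.

Let density_ge0 A : (0 <= density_measure fd A)%E.
Proof. by apply: integral_ge0 => x _; rewrite lee_fin. Qed.

Let density_sigma_additive : semi_sigma_additive (density_measure fd).
Proof.
move=> /= F mF tF mUF; rewrite /density_measure; apply: cvg_toP.
  apply: ereal_nondecreasing_is_cvgn => m n mn.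
  apply: lee_sum_nneg_natr => // k _ _.
  by apply: integral_ge0 => /= x Fkx; rewrite lee_fin.
rewrite ge0_integral_bigcup//=.
- by apply: measurable_funTS; exact/measurable_EFinP.
- by move=> x _; rewrite lee_fin.
Qed.

HB.instance Definition _ := isMeasure.Build _ _ _ (density_measure fd)
  density0 density_ge0 density_sigma_additive.

Let density_setT : density_measure fd setT = 1%E.
Proof. by case: fd. Qed.

HB.instance Definition _ := @Measure_isProbability.Build _ _ R
  (density_measure fd) density_setT.

Lemma ex_probability_of_density : exists P, has_density P mu f.
Proof. by exists (density_measure fd). Qed.

End construction.

Lemma has_density_dominates P mu f : measurable_fun setT f ->
  has_density P mu f -> P `<< mu.
Proof.
move=> mf Pf; apply/null_content_dominatesP => A mA A0.
rewrite Pf//; apply: null_set_integral => //.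
by apply: measurable_funTS; exact/measurable_EFinP.
Qed.

Lemma has_density_int1 P mu f : has_density P mu f ->
  (\int[mu]_x (f x)%:E = 1)%E.
Proof. by move=> Pf; rewrite -Pf// probability_setT. Qed.

Lemma ge0_integral_density P mu f (u : T -> \bar R) :
  measurable_fun setT f -> (forall x, 0 <= f x) -> has_density P mu f ->
  measurable_fun setT u -> (forall x, 0 <= u x)%E ->
  (\int[P]_x u x = \int[mu]_x (u x * (f x)%:E))%E.
Proof.
move=> mf f0 Pf mu_ u0.
have Pmu := has_density_dominates mf Pf.
rewrite -(Radon_Nikodym_SigmaFinite.change_of_variables Pmu u0 measurableT)//.
have mRN : measurable_fun setT (Radon_Nikodym_SigmaFinite.f P mu).
  exact: measurable_int (Radon_Nikodym_SigmaFinite.f_integrable Pmu).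
apply: ge0_ae_eq_integral => //.
- exact: emeasurable_funM.
- by apply: emeasurable_funM => //; exact/measurable_EFinP.
- by move=> x _; rewrite mule_ge0// Radon_Nikodym_SigmaFinite.f_ge0.
- by move=> x _; rewrite mule_ge0// lee_fin.
apply: ae_eqe_mul2l; apply: integral_ae_eq => //.
- exact: Radon_Nikodym_SigmaFinite.f_integrable.
- exact/measurable_EFinP.
- move=> A _ mA; rewrite -(Radon_Nikodym_SigmaFinite.f_integral Pmu mA).
  exact: Pf.
Qed.

Lemma integral_powerm_density P mu f n (F : seq T -> \bar R) :
  measurable_fun setT f -> (forall x, 0 <= f x) -> has_density P mu f ->
  mseq n F -> (forall x, 0 <= F x)%E ->
  (\int[powerm P n]_x F x =
   \int[powerm mu n]_x (F x * (\prod_(a <- x) f a)%:E))%E.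
Proof.
move=> mf f0 Pf; elim: n F => [|n IH] F mF F0.
  rewrite integral_powerm0//.
  rewrite (@integral_powerm0 _ _ _ mu (fun x => F x * (\prod_(a <- x) f a)%:E)%E).
    by rewrite big_nil mule1.
  by move=> x; rewrite mule_ge0// lee_fin prodr_ge0.
pose pf (x : seq T) := \prod_(a <- x) f a.
have pf0 x : 0 <= pf x by exact: prodr_ge0.
have mpf m : mseq m pf.
  rewrite (_ : (fun _ => _) = (fun x : m.-tuple T => \prod_(i < m) f (nth point x i))).
    apply: measurable_prod => i _; apply: measurableT_comp => //.
    exact: measurable_nth.
  by apply/funext => x; rewrite /pf (big_nth point) big_mkord size_tuple.
have FpfS0 x : (0 <= F x * (pf x)%:E)%E by rewrite mule_ge0// lee_fin.
have mFpf : mseq n.+1 (fun x => F x * (pf x)%:E)%E.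
  by apply: emeasurable_funM => //; apply/measurable_EFinP; exact: mpf.
rewrite integral_powermS// (integral_powermS mu mFpf FpfS0).
rewrite (ge0_integral_density mf f0 Pf)//; last 2 first.
- exact: measurable_integral_cons.
- by move=> a; exact: integral_ge0.
apply: eq_integral => a _.
rewrite (IH (fun x => F (a :: x)))//; last exact: mseq_cons1.
rewrite -ge0_integralZr//; last 3 first.
- apply: emeasurable_funM; first exact: mseq_cons1.
  by apply/measurable_EFinP; exact: mpf.
- by move=> x _; apply: mule_ge0 => //; rewrite lee_fin; exact: pf0.
- by rewrite lee_fin.
apply: eq_integral => x _; rewrite /pf big_cons -muleA; congr (_ * _)%E.
by rewrite -EFinM mulrC.
Qed.

(** Replacing the factors of the product one at a time, each replacement costs
    at most the [L^1] distance of the densities. *)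
Lemma integral_powerm_le P Q mu f g t k (F : seq T -> \bar R) :
  is_density mu f -> is_density mu g -> has_density P mu f ->
  has_density Q mu g -> (\int[mu]_x `|f x - g x|%:E <= t%:E)%E ->
  mseq k F -> (forall x, 0 <= F x <= 1)%E ->
  (\int[powerm P k]_x F x <= \int[powerm Q k]_x F x + (k%:R * t)%:E)%E.
Proof.
move=> [mf f0 f1] [mg g0 g1] Pf Qg fgt.
have mfg : measurable_fun setT (fun x => `|f x - g x|%:E).
  by apply/measurable_EFinP; apply: measurableT_comp => //; exact: measurable_funB.
elim: k F => [|k IH] F mF F01.
  have F0 x : (0 <= F x)%E by case/andP: (F01 x).
  by rewrite !integral_powerm0// mul0r adde0.
have F0 x : (0 <= F x)%E by case/andP: (F01 x).
have t0 : 0 <= t.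
  by rewrite -lee_fin; apply: le_trans fgt; apply: integral_ge0 => x _; rewrite lee_fin.
rewrite !integral_powermS//.
pose U a := (\int[powerm Q k]_x F (a :: x))%E.
have mU : measurable_fun setT U by exact: measurable_integral_cons.
have U0 a : (0 <= U a)%E by exact: integral_ge0.
have U1 a : (U a <= 1)%E.
  rewrite -[leRHS](integral_prob_cst (powerm Q k)).
  apply: ge0_le_integral => //; first exact: mseq_cons1.
  by move=> x _; case/andP: (F01 (a :: x)).
apply: (@le_trans _ _ (\int[P]_a (U a + (k%:R * t)%:E))%E).
  apply: ge0_le_integral => //.
  - by move=> a _; exact: integral_ge0.
  - exact: measurable_integral_cons.
  - exact: (emeasurable_funD mU (measurable_cst _)).
  - move=> a _.
    exact: (IH (fun x => F (a :: x)) (mseq_cons1 a mF) (fun=> F01 _)).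
rewrite ge0_integralD//; last by move=> *; rewrite lee_fin mulr_ge0.
rewrite integral_prob_cst -natr1 mulrDl mul1r EFinD addeA.
rewrite addeAC; apply: leeD => //.
rewrite (ge0_integral_density mf f0 Pf)// (ge0_integral_density mg g0 Qg)//.
apply: le_trans (leeD (lexx _) fgt).
have mUf h : measurable_fun setT h -> measurable_fun setT (fun x => U x * (h x)%:E)%E.
  by move=> mh; apply: emeasurable_funM => //; exact/measurable_EFinP.
have Uf0 h x : 0 <= h x -> (0 <= U x * (h x)%:E)%E.
  by move=> h0; rewrite mule_ge0// lee_fin.
have Ug0 x : (0 <= U x * (g x)%:E)%E by exact: Uf0.
have mUg := mUf _ mg.
rewrite -ge0_integralD//; last by move=> x _; exact: Ug0.
apply: ge0_le_integral => //.
- by move=> x _; exact: Uf0.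
- exact: mUf.
- exact: emeasurable_funD.
move=> x _; rewrite -/(U x); have Ufin : U x \is a fin_num.
  by rewrite ge0_fin_numE// (le_lt_trans (U1 x))// ltry.
have := U0 x; have := U1 x; rewrite -(fineK Ufin) lee_fin => ux1.
rewrite lee_fin => ux0; rewrite -!EFinM -EFinD lee_fin.
set u := fine _ in ux1 ux0 *.
rewrite -lerBlDl -mulrBr; apply: le_trans (ler_norm _) _.
by rewrite normrM (ger0_norm ux0) ler_piMl.
Qed.

End density.

(** * Relative entropy of densities *)

Section limits.
Context {R : realType}.
Local Open Scope ereal_scope.
Implicit Types u v : (\bar R)^nat.

Lemma limn_einf_sup_einfs u : limn_einf u = ereal_sup (range (einfs u)).
Proof.
rewrite limn_einf_lim; apply: cvg_lim => //; exact: cvg_einfs_sup.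
Qed.

Lemma limn_einf_ub u b : (forall n, u n <= b) -> limn_einf u <= b.
Proof.
move=> ub; rewrite limn_einf_sup_einfs; apply: ge_ereal_sup => _ [n _ <-].
apply: le_trans (ub n); apply: ereal_inf_lbound; exists n => //=.
Qed.

Lemma le_limn_einf u v : (forall n, u n <= v n) -> limn_einf u <= limn_einf v.
Proof.
move=> uv; rewrite !limn_einf_sup_einfs; apply: ge_ereal_sup => _ [n _ <-].
apply: (@le_trans _ _ (einfs v n)); last by apply: ereal_sup_ubound; exists n.
apply: le_ereal_inf_tmp => _ [k nk <-]; apply: le_trans (uv k).
by apply: ereal_inf_lbound; exists k.
Qed.

Lemma cvg_limn_einf u l : u @ \oo --> l -> limn_einf u = l.
Proof.
move=> ul; rewrite is_cvg_limn_einfE; first exact: cvg_lim.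
by apply/cvg_ex; exists l.
Qed.

End limits.

Section fatou.
Context {R : realType} d (T : measurableType d).
Local Open Scope ereal_scope.

Lemma fatou_ae (mu : {measure set T -> \bar R}) (G : nat -> T -> \bar R)
    (g : T -> \bar R) b :
  (forall n, measurable_fun setT (G n)) -> (forall n x, 0 <= G n x) ->
  measurable_fun setT g -> (forall x, 0 <= g x) ->
  {ae mu, forall x, g x <= limn_einf (G ^~ x)} ->
  (forall n, \int[mu]_x G n x <= b) -> \int[mu]_x g x <= b.
Proof.
move=> mG G0 mg g0 gG Gb.
apply: (@le_trans _ _ (\int[mu]_x limn_einf (G ^~ x))).
  apply: ae_ge0_le_integral => //.
  - move=> x _; rewrite limn_einf_sup_einfs.
    apply: (@le_trans _ _ (einfs (G ^~ x) 0%N)).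
      by apply: le_ereal_inf_tmp => _ [k _ <-].
    by apply: ereal_sup_ubound; exists 0%N.
  - rewrite (_ : (fun x => _) = fun x => - limn_esup (fun n => - G n x)).
      apply: measurableT_comp => //.
      apply: measurable_fun_limn_esup => n.
      exact: measurableT_comp.
    by apply/funext => x; rewrite -limn_einfN; congr limn_einf;
      apply/funext => n /=; rewrite oppeK.
  - by apply: filterS gG => x + _.
apply: le_trans (@fatou _ _ _ mu _ measurableT _ mG _) _ => //.
exact: limn_einf_ub.
Qed.

End fatou.

(** Completeness of [L^1], for sequences of summable increments. *)
Section L1_limit.
Context {R : realType} d (T : measurableType d) (mu : probability T R).
Variables (F : nat -> T -> R) (c : R).
Hypothesis mF : forall l, measurable_fun setT (F l).
Hypothesis c0 : 0 <= c.
Hypothesis F0 : forall l x, 0 <= F l x.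
Hypothesis Fc : forall l,
  (\int[mu]_x `|F l x - F l.+1 x|%:E <= (c / 2 ^+ l)%:E)%E.

Let mdF l m : measurable_fun setT (fun x => `|F l x - F m x|%:E).
Proof.
by apply/measurable_EFinP; apply: measurableT_comp => //; exact: measurable_funB.
Qed.

Let tail m l : (\int[mu]_x `|F l x - F (l + m)%N x|%:E
  <= (2 * c / 2 ^+ l - 2 * c / 2 ^+ (l + m))%:E)%E.
Proof.
elim: m => [|m IH].
  rewrite addn0 subrr; under eq_integral do rewrite subrr normr0.
  by rewrite integral0.
apply: (@le_trans _ _ (\int[mu]_x (`|F l x - F (l + m)%N x|%:E +
    `|F (l + m)%N x - F (l + m).+1 x|%:E))%E).
  rewrite addnS; apply: ge0_le_integral => //.
  - by apply: emeasurable_funD.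
  - by move=> x _; rewrite -EFinD lee_fin ler_distD.
rewrite ge0_integralD//; apply: le_trans (leeD IH (Fc _)) _.
rewrite -EFinD lee_fin addnS exprS invfM.
by rewrite -!mulrA; lra.
Qed.

Let L x := limn_esup (fun l => (F l x)%:E).

Definition L1_lim x := Num.max 0 (fine (L x)).

Let mL : measurable_fun setT L.
Proof. by apply: measurable_fun_limn_esup => n; exact/measurable_EFinP. Qed.

Lemma measurable_L1_lim : measurable_fun setT L1_lim.
Proof. by apply: measurable_maxr => //; exact: measurableT_comp. Qed.

Lemma ae_cvg_L1_lim : {ae mu, forall x, F l x @[l --> \oo] --> L1_lim x}.
Proof.
pose S x := (\sum_(l <oo) `|F l x - F l.+1 x|%:E)%E.
have dF0 l x : (0 <= `|F l x - F l.+1 x|%:E)%E by rewrite lee_fin.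
have S0 x : (0 <= S x)%E by exact: nneseries_ge0.
have mS : measurable_fun setT S by apply: ge0_emeasurable_sum.
have Sint : mu.-integrable setT S.
  apply/integrableP; split => //.
  under eq_integral do rewrite gee0_abs//.
  rewrite integral_nneseries//; apply: (@le_lt_trans _ _ (2 * c)%:E); last exact: ltry.
  apply: lime_le.
    by apply: is_cvg_nneseries => n _ _; exact: integral_ge0.
  apply: nearW => n; apply: (@le_trans _ _ (2 * c - 2 * c / 2 ^+ n)%:E).
    elim: n => [|n IH]; first by rewrite big_geq// expr0 divr1 subrr.
    rewrite big_nat_recr//=; apply: le_trans (leeD IH (Fc _)) _.
    by rewrite -EFinD lee_fin exprS invfM -!mulrA; lra.
  by rewrite lee_fin lerBlDr lerDl divr_ge0// mulr_ge0.
have := integrable_ae measurableT Sint; apply: filterS => x /(_ I) Sfin.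
have cvF : cvgn (fun l => F l x).
  have : cvgn (series (fun l => F l.+1 x - F l x)).
    apply: normed_cvg; apply: nondecreasing_is_cvgn.
      apply: (@nondecreasing_series R (fun l => `|F l.+1 x - F l x|) xpredT 0).
      by move=> *; exact: normr_ge0.
    exists (fine (S x)) => _ [n _ <-]; rewrite -lee_fin fineK//.
    rewrite /series/= -sumEFin; under eq_bigr do rewrite distrC.
    exact: nneseries_lim_ge.
  move=> cS; have : cvgn (fun l => F 0%N x + series (fun l => F l.+1 x - F l x) l).
    by apply: is_cvgD => //; exact: is_cvg_cst.
  by under eq_fun do rewrite seriesEnat/= telescope_sumr// addrC subrK.
have cvFE : (F l x)%:E @[l --> \oo] --> (limn (fun l => F l x))%:E.
  by apply: cvg_EFin => //; exact: nearW.
suff -> : L1_lim x = limn (fun l => F l x) by [].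
rewrite /L1_lim /L; rewrite (is_cvg_limn_esupE (u := fun l => (F l x)%:E)).
  rewrite (cvg_lim _ cvFE)//= max_r//.
  by apply: limr_ge => //; exact: nearW.
by apply/cvg_ex; eexists; exact: cvFE.
Qed.

Lemma L1_lim_le l : (\int[mu]_x `|F l x - L1_lim x|%:E <= (2 * c / 2 ^+ l)%:E)%E.
Proof.
apply: (@fatou_ae _ _ _ mu (fun m x => `|F l x - F (l + m)%N x|%:E)) => //.
- apply/measurable_EFinP; apply: measurableT_comp => //.
  by apply: measurable_funB => //; exact: measurable_L1_lim.
- apply: filterS ae_cvg_L1_lim => x cx; rewrite (@cvg_limn_einf _ _ `|F l x - L1_lim x|%:E)//.
  apply: cvg_EFin; first exact: nearW.
  apply: cvg_norm; apply: cvgB; first exact: cvg_cst.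
  by move: cx; rewrite -(cvg_shiftn l) /=; under eq_fun do rewrite addnC.
- move=> m; apply: le_trans (tail m l) _.
  by rewrite lee_fin lerBlDr lerDl divr_ge0// mulr_ge0.
Qed.

Lemma ge0_L1_lim x : 0 <= L1_lim x.
Proof. by rewrite le_max lexx. Qed.

End L1_limit.

Section entropy.
Context {R : realType} d (T : measurableType d) (mu : probability T R).
Implicit Types f g : T -> R.

Lemma measurable_entf f : measurable_fun setT f ->
  measurable_fun setT (fun x => entf (f x)).
Proof.
move=> mf; apply: measurable_funD => //; apply: measurable_funB => //.
by apply: measurable_funM => //; apply: measurableT_comp => //; exact: measurable_ln.
Qed.

Definition Ent f : \bar R := (\int[mu]_x (entf (f x))%:E)%E.

Definition mid f g : T -> R := fun x => (f x + g x) / 2.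

Lemma measurable_mid f g : measurable_fun setT f -> measurable_fun setT g ->
  measurable_fun setT (mid f g).
Proof. by move=> mf mg; apply: measurable_funM => //; exact: measurable_funD. Qed.

Lemma is_density_mid f g : is_density mu f -> is_density mu g ->
  is_density mu (mid f g).
Proof.
move=> [mf f0 f1] [mg g0 g1]; split; first exact: measurable_mid.
  by move=> x; rewrite divr_ge0// addr_ge0.
under eq_integral do rewrite /mid EFinM EFinD.
have mF := measurable_EFin mf; have mG := measurable_EFin mg.
have F0 x : (0 <= (f x)%:E)%E by rewrite lee_fin.
have G0 x : (0 <= (g x)%:E)%E by rewrite lee_fin.
rewrite ge0_intZr//; [|exact: emeasurable_funD|by move=> x; exact: adde_ge0].
rewrite ge0_intD//.
by rewrite f1 g1 -EFinD -EFinM divff.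
Qed.

(** The parallelogram inequality: densities of small entropy whose midpoint
    has no smaller entropy are close in [L^1]. *)
Lemma L1_le_entropy f g a b c l : is_density mu f -> is_density mu g -> 0 < l ->
  (Ent f <= a%:E)%E -> (Ent g <= b%:E)%E -> (c%:E <= Ent (mid f g))%E ->
  (\int[mu]_x `|f x - g x|%:E <= ((a + b - 2 * c) / l + 2 * l)%:E)%E.
Proof.
move=> [mf f0 f1] [mg g0 g1] l0 fa gb cm.
have mm := measurable_mid mf mg.
have m0 x : 0 <= mid f g x by rewrite divr_ge0// addr_ge0.
have ef (h : T -> R) : (forall x, 0 <= h x) -> forall x, (0 <= (entf (h x))%:E)%E.
  by move=> h0 x; rewrite lee_fin entf_ge0.
have mE (h : T -> R) : measurable_fun setT h -> measurable_fun setT (fun x => (entf (h x))%:E).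
  by move=> mh; exact: (measurable_EFin (measurable_entf mh)).
have mF := measurable_EFin mf; have mG := measurable_EFin mg.
have F0 x : (0 <= (f x)%:E)%E by rewrite lee_fin.
have G0 x : (0 <= (g x)%:E)%E by rewrite lee_fin.
have il0 : (0 <= (l^-1)%:E)%E by rewrite lee_fin invr_ge0 ltW.
have l0' : (0 <= l%:E)%E by rewrite lee_fin ltW.
have l20 : (0 <= (2 / l)%:E)%E by rewrite lee_fin divr_ge0// ltW.
have mn : measurable_fun setT (fun x => `|f x - g x|%:E).
  by apply/measurable_EFinP; apply: measurableT_comp => //; exact: measurable_funB.
have mEf := mE _ mf; have mEg := mE _ mg; have mEm := mE _ mm.
have Ef0 := ef _ f0; have Eg0 := ef _ g0; have Em0 := ef _ m0.
have key : (\int[mu]_x `|f x - g x|%:E + (2 / l)%:E * Ent (mid f g) <=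
    (Ent f + Ent g) * (l^-1)%:E +
    (\int[mu]_x (f x)%:E + \int[mu]_x (g x)%:E) * l%:E)%E.
  rewrite /Ent -!ge0_intD// -ge0_intZl//.
  have A0 x : (0 <= (entf (f x))%:E + (entf (g x))%:E)%E by exact: adde_ge0.
  have B0 x : (0 <= (f x)%:E + (g x)%:E)%E by exact: adde_ge0.
  have mA : measurable_fun setT (fun x => (entf (f x))%:E + (entf (g x))%:E)%E.
    exact: emeasurable_funD.
  have mB : measurable_fun setT (fun x => (f x)%:E + (g x)%:E)%E.
    exact: emeasurable_funD.
  have C0 x : (0 <= (2 / l)%:E * (entf (mid f g x))%:E)%E by exact: mule_ge0.
  have mC : measurable_fun setT (fun x => (2 / l)%:E * (entf (mid f g x))%:E)%E.
    exact: emeasurable_funM.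
  rewrite -!ge0_intZr// -!ge0_intD//; last 4 first.
  - exact: emeasurable_funM.
  - exact: emeasurable_funM.
  - by move=> x; exact: mule_ge0.
  - by move=> x; exact: mule_ge0.
  apply: ge0_int_le.
  - exact: emeasurable_funD.
  - by apply: emeasurable_funD; exact: emeasurable_funM.
  - by move=> x; rewrite adde_ge0// lee_fin.
  move=> x; rewrite !(=^~ EFinD, =^~ EFinM) lee_fin.
  by have := entf_midpoint (f0 x) (g0 x) l0; rewrite -/(mid f g x); lra.
have : (\int[mu]_x `|f x - g x|%:E + (2 / l * c)%:E <=
    ((a + b) / l + 2 * l)%:E)%E.
  apply: le_trans (le_trans _ key) _.
    by apply: leeD => //; rewrite EFinM lee_wpmul2l// lee_fin divr_ge0// ltW.
  rewrite f1 g1 EFinD; apply: leeD; last by rewrite -EFinD -EFinM.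
  by rewrite [leRHS]EFinM lee_wpmul2r ?lee_fin// EFinD; exact: leeD.
by rewrite -leeBrDr// -EFinB => /le_trans; apply; rewrite lee_fin; lra.
Qed.


Lemma entf_lsc (u : R^nat) (v : R) : (forall n, 0 <= u n) -> 0 <= v ->
  u @ \oo --> v -> ((entf v)%:E <= limn_einf (fun n => (entf (u n))%:E))%E.
Proof.
move=> u0 v0 uv.
(* The minorant below is continuous and agrees with [entf] at [v]. At [v = 0]
   the tangent of [u log u] is vertical, hence the change of base point. *)
pose m := if v == 0 then 1 else v.
have m0 : 0 < m by rewrite /m; case: eqP => // /eqP v_neq0; rewrite lt_def v_neq0.
pose phi w := w * ln m + 2 * (w - Num.sqrt w * Num.sqrt m) - w + 1.
have phiv : phi v = entf v.
  rewrite /phi /entf /m; have [->|v_neq0] := eqVneq v 0.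
    by rewrite sqrtr0; ring.
  by rewrite -expr2 sqr_sqrtr//; ring.
have phi_cvg : phi (u n) @[n --> \oo] --> phi v.
  have su : Num.sqrt (u n) @[n --> \oo] --> Num.sqrt v.
    by apply: cvg_comp uv _; exact: sqrt_continuous.
  apply: cvgD; last exact: cvg_cst.
  apply: cvgB => //; apply: cvgD; first by apply: cvgM => //; exact: cvg_cst.
  apply: cvgM; first exact: cvg_cst.
  by apply: cvgB => //; apply: cvgM => //; exact: cvg_cst.
rewrite -phiv -(@cvg_limn_einf _ (fun n => (phi (u n))%:E) (phi v)%:E).
  apply: le_limn_einf => n; rewrite lee_fin /phi /entf.
  by have := xlnx_ge_sqrt (u0 n) m0; lra.
by apply: cvg_EFin => //; exact: nearW.
Qed.

Lemma Ent_le_ae (F : nat -> T -> R) f b :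
  (forall n, is_density mu (F n)) -> measurable_fun setT f ->
  (forall x, 0 <= f x) -> {ae mu, forall x, F n x @[n --> \oo] --> f x} ->
  (forall n, Ent (F n) <= b)%E -> (Ent f <= b)%E.
Proof.
move=> dF mf f0 Ff Fb.
have mE (h : T -> R) : measurable_fun setT h -> measurable_fun setT (fun x => (entf (h x))%:E).
  by move=> mh; exact: (measurable_EFin (measurable_entf mh)).
apply: (@fatou_ae _ _ _ mu (fun n x => (entf (F n x))%:E)) => //.
- by move=> n; apply: mE; case: (dF n).
- by move=> n x; rewrite lee_fin entf_ge0//; case: (dF n).
- exact: mE.
- by move=> x; rewrite lee_fin entf_ge0.
- apply: filterS Ff => x; apply: entf_lsc => //.
  by move=> n; case: (dF n).
Qed.

Lemma is_density_L1_limit (F : nat -> T -> R) f c :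
  (forall n, is_density mu (F n)) -> measurable_fun setT f ->
  (forall x, 0 <= f x) ->
  (forall n, \int[mu]_x `|F n x - f x|%:E <= (c / 2 ^+ n)%:E)%E ->
  is_density mu f.
Proof.
move=> dF mf f0 Ff; split => //.
have mF n : measurable_fun setT (F n) by case: (dF n).
have md n : measurable_fun setT (fun x => `|F n x - f x|%:E).
  by apply/measurable_EFinP; apply: measurableT_comp => //; exact: measurable_funB.
have d0 n x : (0 <= `|F n x - f x|%:E)%E by rewrite lee_fin.
have mfE := measurable_EFin mf.
have f0E x : (0 <= (f x)%:E)%E by rewrite lee_fin.
have F0E n x : (0 <= (F n x)%:E)%E by rewrite lee_fin; case: (dF n).
have F1 n : (\int[mu]_x (F n x)%:E = 1)%E by case: (dF n).
have small e : 0 < e -> exists n, c / 2 ^+ n <= e.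
  move=> e0; have := @cvg_geometric R c 2^-1.
  rewrite ger0_norm ?invr_ge0// invf_lt1// ltr1n => /(_ isT) cg.
  have /cvgr_lt -/(_ _ e0)[N _ HN] := cg.
  exists N; have := HN N (leqnn N); rewrite /= exprVn => /ltW; apply.
apply/eqP; rewrite eq_le; apply/andP; split; apply/lee_addgt0Pr => e e0.
- have [n cn] := small e e0.
  apply: le_trans (leeD (lexx 1%E) (le_trans (Ff n) _)); last by rewrite lee_fin; exact: cn.
  rewrite -(F1 n) -ge0_intD//; last exact: (measurable_EFin (mF n)).
  apply: ge0_int_le => //.
    by apply: emeasurable_funD => //; exact: (measurable_EFin (mF n)).
  move=> x; rewrite -EFinD lee_fin -lerBlDl distrC; exact: ler_norm.
- have [n cn] := small e e0.
  apply: le_trans (leeD (lexx _) (le_trans (Ff n) _)); last by rewrite lee_fin; exact: cn.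
  rewrite -{1}(F1 n) -ge0_intD//.
  apply: ge0_int_le => //; first exact: (measurable_EFin (mF n)).
    exact: emeasurable_funD.
  move=> x; rewrite -EFinD lee_fin -lerBlDl; exact: ler_norm.
Qed.

End entropy.

(** * Stability of a minimum entropy *)

(** Near-minimisers of the entropy in [Fam j] are Cauchy in [L^1], because their
    midpoints, which stay in the class, cannot do much better. By Fatou's lemma
    the entropy of their limit is no larger; so if the infimum over [Fam j]
    stayed below [H - e] for all [j], some limit would have entropy below [H]. *)
Lemma entropy_gap {R : realType} d (T : measurableType d)
  (mu : probability T R) (Fam : nat -> set (T -> R)) (H e : R) :
  0 < e ->
  (forall j f, Fam j f -> is_density mu f) ->
  (forall j f g, Fam j f -> Fam j g -> Fam j (mid f g)) ->
  (forall i j, (i <= j)%N -> Fam j `<=` Fam i) ->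
  (forall (F : nat -> T -> R) f c, (forall j, Fam j (F j)) ->
    is_density mu f ->
    (forall j, \int[mu]_x `|F j x - f x|%:E <= (c / 2 ^+ j)%:E)%E ->
    (H%:E <= Ent mu f)%E) ->
  exists j, forall f, Fam j f -> ((H - e)%:E <= Ent mu f)%E.
Proof.
move=> e0 Fd Fm Fn FH; apply: contrapT => Hno.
have Ent0 j f : Fam j f -> (0 <= Ent mu f)%E.
  move=> /Fd[_ f0 _]; apply: ge0_int => x.
  by rewrite lee_fin entf_ge0.
pose h j := ereal_inf [set Ent mu f | f in Fam j].
have h_nd i j : (i <= j)%N -> (h i <= h j)%E.
  by move=> ij; apply: ereal_inf_le_tmp => _ [f /(Fn _ _ ij) Ff <-]; exists f.
have h0 j : (0 <= h j)%E.
  by apply: le_ereal_inf_tmp => _ [f /Ent0 f0 <-].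
have hH j : (h j <= (H - e)%:E)%E.
  rewrite leNgt; apply/negP => Hj; apply: Hno; exists j => f Ff.
  apply: (le_trans (ltW Hj)); apply: ereal_inf_lbound; by exists f.
pose S := ereal_sup (range h).
have SH : (S <= (H - e)%:E)%E by apply: ge_ereal_sup => _ [j _ <-].
have hS j : (h j <= S)%E by apply: ereal_sup_ubound; exists j.
have Sfin : S \is a fin_num.
  rewrite ge0_fin_numE; first exact: le_lt_trans SH (ltry _).
  exact: le_trans (h0 0%N) (hS 0%N).
have hfin j : h j \is a fin_num.
  by rewrite ge0_fin_numE//; exact: le_lt_trans (hH j) (ltry _).
pose s := fine S; have sE : S = s%:E by rewrite fineK.
pose a l : R := 2^-1 ^+ l.
have a0 l : 0 < a l by rewrite exprn_gt0// invr_gt0.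
have ex l : exists fj : (T -> R) * nat, [/\ (l <= fj.2)%N, Fam fj.2 fj.1,
    ((s - a l ^+ 2)%:E <= h fj.2)%E & (Ent mu fj.1 <= (s + a l ^+ 2)%:E)%E].
  have al0 : 0 < a l ^+ 2 by rewrite exprn_gt0.
  have [_ [j _ <-] Sj] := ub_ereal_sup_adherent al0 Sfin.
  pose j' := maxn l j.
  have [_ [f Ff <-] fj] := lb_ereal_inf_adherent al0 (hfin j').
  exists (f, j'); split => //=; first exact: leq_maxl.
    rewrite EFinB -sE; apply: (le_trans (ltW Sj)).
    by apply: h_nd; exact: leq_maxr.
  apply: (le_trans (ltW fj)); rewrite EFinD -sE.
  by apply: leeD => //; exact: hS.
have {ex}[FJ HFJ] := choice ex.
pose F l := (FJ l).1; pose J l := (FJ l).2.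
have FF l : Fam l (F l).
  by have [lJ FJl _ _] := HFJ l; exact: Fn FJl.
have dF l : is_density mu (F l) by exact: Fd (FF l).
have incr l : (\int[mu]_x `|F l x - F l.+1 x|%:E <= (6 / 2 ^+ l)%:E)%E.
  have [_ Fl Sl El] := HFJ l; have [_ Fl1 Sl1 El1] := HFJ l.+1.
  have aS : a l.+1 = a l / 2 by rewrite /a exprS mulrC.
  have aS2 : a l.+1 ^+ 2 <= a l ^+ 2.
    by have := a0 l; rewrite aS; nra.
  have Emid : ((s - a l ^+ 2)%:E <= Ent mu (mid (F l) (F l.+1)))%E.
    have [lel1|/ltnW lel1] := leqP (J l) (J l.+1).
      apply: (le_trans Sl); apply: ereal_inf_lbound; exists (mid (F l) (F l.+1)) => //.
      by apply: Fm => //; exact: (Fn _ _ lel1).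
    apply: (@le_trans _ _ (s - a l.+1 ^+ 2)%:E); first by rewrite lee_fin lerB.
    apply: (le_trans Sl1); apply: ereal_inf_lbound; exists (mid (F l) (F l.+1)) => //.
    by apply: Fm => //; exact: (Fn _ _ lel1).
  apply: (le_trans (L1_le_entropy (dF l) (dF l.+1) (a0 l) El El1 Emid)).
  have -> : 6 / 2 ^+ l = 6 * a l by rewrite /a exprVn.
  rewrite lee_fin; set b := a l.+1 ^+ 2 in aS2 *.
  apply: (@le_trans _ _ ((4 * a l ^+ 2) / a l + 2 * a l)).
    by rewrite lerD2r ler_pM2r ?invr_gt0//; lra.
  by rewrite expr2 mulrA mulfK ?gt_eqF//; lra.
have mF l : measurable_fun setT (F l) by case: (dF l).
have F0 l x : 0 <= F l x by case: (dF l).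
have six : 0 <= 6 :> R by [].
pose f := L1_lim F.
have mf : measurable_fun setT f by exact: measurable_L1_lim.
have f0 x : 0 <= f x by exact: ge0_L1_lim.
have Ff l : (\int[mu]_x `|F l x - f x|%:E <= (2 * 6 / 2 ^+ l)%:E)%E.
  exact: (L1_lim_le mF six F0 incr).
have df : is_density mu f by exact: (is_density_L1_limit dF mf f0 Ff).
have HE := FH F f (2 * 6) FF df Ff.
have cvF := ae_cvg_L1_lim mF six F0 incr.
have : (Ent mu f <= (s + e / 2)%:E)%E.
  have [N HN] : exists N, a N ^+ 2 <= e / 2.
    have : a n @[n --> \oo] --> 0.
      by apply: cvg_expr; rewrite ger0_norm ?invr_ge0// invf_lt1// ltr1n.
    have e20 : 0 < Num.min 1 (e / 2) by rewrite lt_min ltr01 divr_gt0.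
    move=> /cvgr_lt -/(_ _ e20)[N _ HN]; exists N.
    have := HN N (leqnn N); rewrite /= lt_min => /andP[a1 ae].
    by have := a0 N; nra.
  apply: (@Ent_le_ae _ _ _ mu (fun n => F (n + N)%N)) => //.
    by apply: filterS cvF => x; rewrite -(cvg_shiftn N).
  move=> n; have [_ _ _ En] := HFJ (n + N)%N; apply: (le_trans En).
  rewrite lee_fin lerD2l; apply: le_trans HN.
  rewrite /a exprD exprMn ler_piMl ?sqr_ge0// -exprM.
  by apply: exprn_ile1; rewrite ?invr_ge0// invf_le1// ler1n.
move=> /(le_trans HE); rewrite lee_fin => Hs.
move: SH; rewrite sE lee_fin => sH.
by suff : 0 < 0 :> R; [rewrite ltxx|lra].
Qed.

(** * Conditioning a product power on a symmetric event *)

Lemma expR_le_quadratic {R : realType} (u : R) :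
  u <= 2^-1 -> expR u <= 1 + u + 2 * u ^+ 2.
Proof.
move=> u2; have : 1 - u <= expR (- u) by exact: expR_ge1Dx.
rewrite expRN => eu; have eu0 := expR_gt0 u.
have : expR u * (1 - u) <= 1.
  by have := ler_wpM2l (ltW eu0) eu; rewrite divff ?gt_eqF.
move=> e1; have u10 : 0 < 1 - u by lra.
rewrite -(ler_pM2r u10); apply: (le_trans e1).
have := sqr_ge0 u; nra.
Qed.

(** A crude form of Hoeffding's lemma. *)
Lemma mgf_le {R : realType} d (T : measurableType d) (P : probability T R)
    (f : T -> R) (m l : R) : measurable_fun setT f ->
  (forall x, 0 <= f x <= 1) -> (\int[P]_x (f x)%:E = m%:E)%E -> 0 <= l <= 2^-1 ->
  (\int[P]_x (expR (l * (f x - m)))%:E <= (expR (2 * l ^+ 2))%:E)%E.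
Proof.
move=> mf f01 fm /andP[l0 l2].
have fE := measurable_EFin mf.
have f0 x : (0 <= (f x)%:E)%E by rewrite lee_fin; case/andP: (f01 x).
have m0 : 0 <= m by rewrite -lee_fin -fm; exact: ge0_int.
have m1 : m <= 1.
  rewrite -lee_fin -fm -[leRHS](integral_prob_cst P); apply: ge0_int_le => //.
  by move=> x; rewrite lee_fin; case/andP: (f01 x).
have me : measurable_fun setT (fun x => (expR (l * (f x - m)))%:E).
  apply/measurable_EFinP; apply: measurableT_comp => //.
  by apply: measurable_funM => //; exact: measurable_funB.
have e0 x : (0 <= (expR (l * (f x - m)))%:E)%E by rewrite lee_fin expR_ge0.
have : (\int[P]_x ((expR (l * (f x - m)))%:E + (l * m)%:E) <=
    \int[P]_x ((1 + 2 * l ^+ 2)%:E + l%:E * (f x)%:E))%E.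
  apply: ge0_int_le.
  - exact: (emeasurable_funD me (measurable_cst _)).
  - apply: (emeasurable_funD (measurable_cst _)).
    exact: (emeasurable_funM (measurable_cst _)).
  - by move=> x; rewrite adde_ge0// lee_fin mulr_ge0.
  move=> x; rewrite !(=^~ EFinD, =^~ EFinM) lee_fin.
  have /andP[fx0 fx1] := f01 x.
  have := @expR_le_quadratic R (l * (f x - m)).
  have lfm : l * (f x - m) <= 2^-1.
    by apply: le_trans l2; rewrite ler_piMr//; lra.
  move=> /(_ lfm); have : (f x - m) ^+ 2 <= 1.
    have : 0 <= (1 - (f x - m)) * (1 + (f x - m)) by apply: mulr_ge0; lra.
    by lra.
  have := sqr_ge0 l; rewrite exprMn; nra.
rewrite ge0_intD//; last by move=> x; rewrite lee_fin mulr_ge0.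
have lf : measurable_fun setT (fun x => l%:E * (f x)%:E)%E.
  exact: (emeasurable_funM (measurable_cst _)).
rewrite ge0_intD//; last 2 first.
- by move=> x; rewrite lee_fin addr_ge0// mulr_ge0// sqr_ge0.
- by move=> x; rewrite mule_ge0// lee_fin.
rewrite ge0_intZl ?lee_fin// !integral_prob_cst fm -EFinM -leeBrDr// -EFinB.
by rewrite addrK => /le_trans; apply; rewrite lee_fin; exact: expR_ge1Dx.
Qed.

Section conditioned.
Context {R : realType} d (T : measurableType d) (alpha : probability T R).
Variables (n : nat) (G : set (seq T)) (p : R).
Hypothesis mG : measurable [set x : n.+1.-tuple T | G x].
Hypothesis symG : forall j s, size s = n.+1 -> G (rot j s) <-> G s.
Hypothesis pE : powerm alpha n.+1 [set x : n.+1.-tuple T | G x] = p%:E.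
Hypothesis p0 : 0 < p.

Let chi (s : seq T) : R := \1_G s.

Let chi0 s : 0 <= chi s. Proof. by rewrite /chi indicE. Qed.

Let chi01 s : (chi s = 0 /\ ~ G s) \/ (chi s = 1 /\ G s).
Proof.
rewrite /chi indicE; have [|] := boolP (s \in G).
  by rewrite inE => Gs; right.
by rewrite notin_setE => Gs; left.
Qed.

Let mchi : mseq n.+1 chi.
Proof.
rewrite (_ : (fun _ => _) = \1_[set x : n.+1.-tuple T | G x]).
  exact: measurable_indic.
by apply/funext => x; rewrite /chi !indicE; congr (_%:R); apply/idP/idP;
  rewrite !inE.
Qed.

Let mchiE : mseq n.+1 (fun x => (chi x)%:E).
Proof. exact: (measurable_EFin mchi). Qed.

Let int_chi : (\int[powerm alpha n.+1]_x (chi x)%:E = p%:E)%E.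
Proof.
rewrite -pE -[in RHS](setIT [set x : n.+1.-tuple T | G x]) -integral_indic//.
Qed.

Lemma integral_rot_sym j (F : seq T -> \bar R) :
  (j <= n.+1)%N -> mseq n.+1 F -> (forall s, 0 <= F s)%E ->
  (\int[powerm alpha n.+1]_x ((chi x)%:E * F (rot j x)) =
   \int[powerm alpha n.+1]_x ((chi x)%:E * F x))%E.
Proof.
move=> jn mF F0.
pose s i := ((i + j) %% n.+1)%N.
rewrite -(@ge0_integral_gather _ _ _ alpha n.+1 n.+1 s
  (fun x => (chi x)%:E * F x)%E).
- apply: eq_integral => x _.
  have -> : tval (gather n.+1 s x) = rot j x.
    apply: (@eq_from_nth _ point); first by rewrite size_rot !size_tuple.
    rewrite size_tuple => i iN; rewrite nth_gather// /s /rot nth_cat.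
    rewrite size_drop size_tuple nth_drop; case: ltnP => ij.
      by rewrite modn_small addnC// -ltn_subRL.
    rewrite nth_take; last by rewrite ltn_subLR ?subnK//; lia.
    congr (nth _ _ _); rewrite -[in LHS](@subnK n.+1 (i + j)); last by lia.
    by rewrite modnDr modn_small; lia.
  have -> : chi (rot j x) = chi x; last by [].
  have sym := symG j (size_tuple x); rewrite /chi !indicE.
  by congr ((_ : bool)%:R); apply/idP/idP; rewrite !inE => /sym.
- by move=> i _; rewrite ltn_mod.
- move=> i i' iN i'N /eqP; rewrite eqn_modDr !modn_small// => /eqP //.
- exact: emeasurable_funM.
- by move=> x; rewrite mule_ge0// lee_fin.
Qed.

(** The density, with respect to [alpha], of the first marginal of the
    conditioned law. *)
Definition cond_density (a : T) : R :=
  p^-1 * fine (\int[powerm alpha n]_x (chi (a :: x))%:E)%E.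

Let section_le1 a : (\int[powerm alpha n]_x (chi (a :: x))%:E <= 1)%E.
Proof.
rewrite -[leRHS](integral_prob_cst (powerm alpha n)).
apply: ge0_int_le => //; first exact: (mseq_cons1 a mchiE).
- by move=> x; rewrite lee_fin.
- by move=> x; rewrite lee_fin; case: (chi01 (a :: x)) => -[->].
Qed.

Let section_fin a : (\int[powerm alpha n]_x (chi (a :: x))%:E)%E \is a fin_num.
Proof.
rewrite ge0_fin_numE; first exact: le_lt_trans (section_le1 a) (ltry _).
by apply: ge0_int => x; rewrite lee_fin.
Qed.

Let cond_densityE a : ((p * cond_density a)%:E =
  \int[powerm alpha n]_x (chi (a :: x))%:E)%E.
Proof. by rewrite /cond_density mulrA divff ?gt_eqF// mul1r fineK. Qed.

Lemma cond_density_ge0 a : 0 <= cond_density a.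
Proof.
apply: mulr_ge0; first by rewrite invr_ge0 ltW.
by apply: fine_ge0; apply: ge0_int => x; rewrite lee_fin.
Qed.

Lemma cond_density_le1 a : p * cond_density a <= 1.
Proof. by rewrite -lee_fin cond_densityE. Qed.

Lemma measurable_cond_density : measurable_fun setT cond_density.
Proof.
apply: measurable_funM => //; apply: measurableT_comp => //.
exact: (@measurable_integral_cons _ _ _ alpha n (fun x => (chi x)%:E)).
Qed.

Lemma integral_cond_density (u : T -> \bar R) : measurable_fun setT u ->
  (forall a, 0 <= u a)%E ->
  (p%:E * \int[alpha]_a (u a * (cond_density a)%:E) =
   \int[powerm alpha n.+1]_x ((chi x)%:E * u (nth point x 0)))%E.
Proof.
move=> mu u0.
have mg := measurable_EFin measurable_cond_density.
have g0 a : (0 <= (cond_density a)%:E)%E by rewrite lee_fin cond_density_ge0.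
rewrite -ge0_intZl//; last 3 first.
- exact: emeasurable_funM.
- by move=> a; exact: mule_ge0.
- by rewrite lee_fin ltW.
rewrite (@integral_powermS _ _ _ alpha n
  (fun x => (chi x)%:E * u (nth point x 0))%E); last 2 first.
- apply: emeasurable_funM => //; apply: measurableT_comp => //.
  exact: measurable_nth.
- by move=> x; rewrite mule_ge0// lee_fin.
apply: eq_integral => a _ /=; rewrite ge0_intZr//; last 2 first.
- exact: (mseq_cons1 a mchiE).
- by move=> x; rewrite lee_fin.
by rewrite -cond_densityE EFinM muleCA muleC.
Qed.

Lemma integral_cond_density_nth (u : T -> \bar R) i : (i < n.+1)%N ->
  measurable_fun setT u -> (forall a, 0 <= u a)%E ->
  (\int[powerm alpha n.+1]_x ((chi x)%:E * u (nth point x i)) =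
   p%:E * \int[alpha]_a (u a * (cond_density a)%:E))%E.
Proof.
move=> iN mu u0; rewrite integral_cond_density//.
rewrite -(@integral_rot_sym i (fun x => u (nth point x 0))) ?(ltnW iN)//; last first.
  by apply: measurableT_comp => //; exact: measurable_nth.
apply: eq_integral => x _; congr (_ * u _)%E.
rewrite /rot nth_cat size_drop size_tuple subn_gt0 iN nth_drop addn0//.
Qed.

Lemma is_density_cond : is_density alpha cond_density.
Proof.
split; [exact: measurable_cond_density|exact: cond_density_ge0|].
have := integral_cond_density (measurable_cst 1%E) (fun=> lee01).
under eq_integral do rewrite mul1e.
under [in RHS]eq_integral do rewrite mule1.
rewrite int_chi => /(congr1 (fun z => p^-1%:E * z)%E).
by rewrite muleA -!EFinM mulVf ?gt_eqF// mul1e.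
Qed.


(** The information content of the section of the event at [a]; it is
    nonnegative because [p * cond_density a <= 1]. *)
Let w (a : T) : \bar R :=
  if cond_density a == 0 then +oo%E else (- ln (p * cond_density a))%:E.

Let w0 a : (0 <= w a)%E.
Proof.
rewrite /w; case: ifPn => // _.
by rewrite lee_fin oppr_ge0 ln_le0// cond_density_le1.
Qed.

Let mw : measurable_fun setT w.
Proof.
have mg := measurable_cond_density.
apply: measurable_fun_if => //.
- exact: (measurable_fun_eqr mg (measurable_cst _)).
- apply: measurable_funTS; apply/measurable_EFinP; apply: measurableT_comp => //.
  by apply: measurableT_comp; [exact: measurable_ln|exact: measurable_funM].
Qed.

Let w_Ent : (\int[alpha]_a (w a * (cond_density a)%:E) +
  Ent alpha cond_density = (- ln p)%:E)%E.
Proof.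
have [mg g0 g1] := is_density_cond.
have mgE := measurable_EFin mg.
have g0E a : (0 <= (cond_density a)%:E)%E by rewrite lee_fin.
have p1 : p <= 1 by rewrite -lee_fin -pE; exact: probability_le1.
have lp0 : 0 <= - ln p by rewrite oppr_ge0 ln_le0.
have mwg : measurable_fun setT (fun a => w a * (cond_density a)%:E)%E.
  exact: emeasurable_funM.
have wg0 a : (0 <= w a * (cond_density a)%:E)%E by exact: mule_ge0.
have mEg : measurable_fun setT (fun a => (entf (cond_density a))%:E).
  exact: (measurable_EFin (measurable_entf mg)).
have Eg0 a : (0 <= (entf (cond_density a))%:E)%E by rewrite lee_fin entf_ge0.
set X := (X in X = _); suff : (X + 1 = (1 - ln p)%:E)%E.
  move=> XE; have X1 : (1%E : \bar R) \is a fin_num by [].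
  by rewrite -[LHS](addeK _ X1) XE -EFinB addrAC subrr add0r.
rewrite /X -[in LHS]g1 /Ent -ge0_intD//.
rewrite -ge0_intD//; last 2 first.
- exact: emeasurable_funD.
- by move=> a; exact: adde_ge0.
transitivity (\int[alpha]_a (1 + (- ln p)%:E * (cond_density a)%:E))%E.
  apply: eq_integral => a _; rewrite /w /entf; case: eqP => [->|/eqP ga0].
    by rewrite mule0 mul0r adde0 add0e mule0 adde0 subrr add0r.
  have ga : 0 < cond_density a by rewrite lt_def ga0 g0.
  by rewrite lnM ?posrE// !(=^~ EFinD, =^~ EFinM); congr EFin; ring.
rewrite ge0_intD//; last 2 first.
- exact: (emeasurable_funM (measurable_cst _)).
- by move=> a; rewrite mule_ge0// lee_fin.
by rewrite integral_prob_cst ge0_intZl ?lee_fin// g1 mule1.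
Qed.


Let sum_w (s : seq T) : (\sum_(a <- s) w a = +oo)%E \/
  (0 < \prod_(a <- s) cond_density a /\ (\sum_(a <- s) w a =
    ((size s)%:R * - ln p - ln (\prod_(a <- s) cond_density a))%:E)%E).
Proof.
elim: s => [|a s IH]; first by right; rewrite !big_nil ln1 mul0r subrr.
have sum0 : (0 <= \sum_(a <- s) w a)%E by apply: sume_ge0.
rewrite !big_cons {1 3}/w; case: ifPn => [_|ga0].
  by left; rewrite addye// gt_eqF// (lt_le_trans _ sum0).
have ga : 0 < cond_density a by rewrite lt_def ga0 cond_density_ge0.
case: IH => [->|[gs ->]]; first by left; rewrite addey.
right; split; first exact: mulr_gt0.
have H : - ln (p * cond_density a) +
    ((size s)%:R * - ln p - ln (\prod_(j <- s) cond_density j)) =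
    (size (a :: s))%:R * - ln p -
    ln (cond_density a * \prod_(j <- s) cond_density j).
  have -> : (size (a :: s))%:R = (size s)%:R + 1 :> R by rewrite natr1.
  rewrite (@lnM _ p) ?posrE// (@lnM _ (cond_density a)) ?posrE//.
  by move: (ln p) (ln (cond_density a)) (ln _) ((size s)%:R) => A B C D; ring.
exact: (congr1 EFin H).
Qed.

(** The entropy inequality for the conditioned law against the [n.+1]-st power
    of its own first marginal [q], applied to the number of blocks of
    coordinates that fall in a given event. It comes from integrating
    [1 + y <= exp y] and bounds how far the law of a block is from the product
    law [q^k]. *)
Lemma conditioned_block_le k m r (f : seq T -> R) (q : probability T R) E l Qf qf :
  n.+1 = (m * k + r)%N -> 0 <= l <= 2^-1 -> mseq k f ->
  (forall s, 0 <= f s <= 1) -> has_density q alpha cond_density ->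
  (E%:E <= Ent alpha cond_density)%E ->
  (\int[powerm alpha n.+1]_x ((chi x)%:E * (f (take k x))%:E) = (p * Qf)%:E)%E ->
  (\int[powerm q k]_x (f x)%:E = qf%:E)%E ->
  m%:R * l * (Qf - qf) <= m%:R * (2 * l ^+ 2) - ln p - n.+1%:R * E.
Proof.
move=> nE l01 mf f01 qd EE QfE qfE; have /andP[l0 l2] := l01.
have [mg g0 g1] := is_density_cond.
have p1 : p <= 1 by rewrite -lee_fin -pE; exact: probability_le1.
have lp0 : 0 <= - ln p by rewrite oppr_ge0 ln_le0.
have fmE := measurable_EFin mf.
have f0 s : 0 <= f s by case/andP: (f01 s).
have qf0 : 0 <= qf by rewrite -lee_fin -qfE; apply: ge0_int => x; rewrite lee_fin.
have qf1 : qf <= 1.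
  rewrite -lee_fin -qfE -[leRHS](integral_prob_cst (powerm q k)).
  apply: ge0_int_le => //; first by move=> x; rewrite lee_fin.
  by move=> x; rewrite lee_fin; case/andP: (f01 x).
pose blk b (s : seq T) := take k (drop (b * k) s).
pose c := m%:R * (2 * l ^+ 2).
pose W (s : seq T) := \sum_(b < m) l * (f (blk b s) - qf).
pose g_ := cond_density.
pose pg (s : seq T) := \prod_(a <- s) g_ a.
pose K := 1 + m%:R * l * (1 - qf) + n%:R * - ln p.
have c0 : 0 <= c by rewrite mulr_ge0// mulr_ge0// sqr_ge0.
have K0 : 0 <= K.
  by rewrite !addr_ge0// !mulr_ge0// subr_ge0.
have pg0 s : 0 <= pg s by apply: prodr_ge0 => a _; exact: g0.
have WE s : W s = l * (\sum_(b < m) f (blk b s)) - m%:R * l * qf.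
  rewrite /W -mulr_sumr sumrB sumr_const card_ord -mulr_natl mulrBr; ring.
(* [1 + y <= exp y] for [y = W s - c + ln (pg s) + ln p], rearranged so that all
   terms are nonnegative and can be integrated without integrability conditions. *)
have key s : size s = n.+1 ->
  ((K + l * (\sum_(b < m) f (blk b s)))%:E <=
   (p * expR (W s - c) * pg s)%:E + (c + m%:R * l)%:E + \sum_(a <- s) w a)%E.
  move=> sz; case: (sum_w s) => [->|[pgs ->]].
    by rewrite addey// leey.
  rewrite -!EFinD lee_fin sz.
  have := expR_ge1Dx (W s - c + ln (pg s) + ln p).
  rewrite expRD lnK ?posrE// expRD lnK ?posrE// WE /K -natr1.
  by rewrite -/(pg s); lra.
have mblk b : (b < m)%N -> mseq n.+1 (fun s => f (blk b s)).
  move=> bm.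
  have bk : (b * k + (m * k - b * k + r) = n.+1)%N.
    by rewrite addnA subnKC// leq_mul2r ltnW ?orbT.
  rewrite -bk; apply: (@mseq_drop _ _ _ (b * k) _ _ (fun s => f (take k s))).
  apply: mseq_take => //.
  by rewrite -mulnBl (leq_trans _ (leq_addr _ _))// leq_pmull// subn_gt0.
have mW : mseq n.+1 W.
  rewrite /W; apply: measurable_sum => b; apply: measurable_funM => //.
  by apply: measurable_funB => //; exact: mblk.
have mpg : mseq n.+1 pg.
  rewrite (_ : (fun _ => _) = (fun x : n.+1.-tuple T => \prod_(i < n.+1) g_ (nth point x i))).
    apply: measurable_prod => i _; apply: measurableT_comp => //.
    exact: measurable_nth.
  by apply/funext => x; rewrite /pg (big_nth point) big_mkord size_tuple.
have Qblk b : (b < m)%N -> (\int[powerm alpha n.+1]_x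
    ((chi x)%:E * (f (blk b x))%:E) = (p * Qf)%:E)%E.
  move=> bm; rewrite -QfE.
  have bk : (b * k + k <= n.+1)%N.
    by rewrite nE -mulSnr (leq_trans _ (leq_addr _ _))// leq_mul2r bm orbT.
  have bN : (b * k <= n.+1)%N by rewrite (leq_trans (leq_addr _ _) bk).
  rewrite -(@integral_rot_sym (b * k) (fun x => (f (take k x))%:E))//.
  - apply: eq_integral => x _; congr (_ * (f _)%:E)%E.
    rewrite /rot /blk takel_cat// size_drop size_tuple.
    by rewrite leq_subRL.
  - have kN : (k <= n.+1)%N by apply: leq_trans bk; rewrite leq_addl.
    exact: (mseq_take (F := fun x => (f x)%:E) kN fmE).
  - by move=> x; rewrite lee_fin.
(* The blocks are independent under the powers of [q], and each contributes a
   factor at most [expR (2 * l ^+ 2)]. *)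
have expW : (\int[powerm alpha n.+1]_x
    ((chi x)%:E * (p * expR (W x - c) * pg x)%:E) <= p%:E)%E.
  pose h (s : seq T) := (expR (l * (f s - qf)))%:E.
  have mh : mseq k h.
    apply/measurable_EFinP; apply: measurableT_comp => //.
    by apply: measurable_funM => //; exact: measurable_funB.
  have h0 s : (0 <= h s)%E by rewrite lee_fin expR_ge0.
  have hW s : (\prod_(b < m) h (blk b s) = (expR (W s))%:E)%E.
    by rewrite /h prodEFin /W expR_sum.
  have eW0 (s : seq T) : (0 <= (expR (W s))%:E)%E by rewrite lee_fin expR_ge0.
  have meW : mseq n.+1 (fun x => (expR (W x))%:E).
    by apply/measurable_EFinP; apply: measurableT_comp.
  have eW : (\int[powerm q n.+1]_x (expR (W x))%:E <= (expR c)%:E)%E.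
    have := integral_powerm_blocks q m r mh h0; rewrite -nE.
    under eq_integral do rewrite hW.
    move=> ->; rewrite /c expRM_natl.
    have hle : (\int[powerm q k]_x h x <= (expR (2 * l ^+ 2))%:E)%E.
      exact: (mgf_le mf (fun x => f01 x) qfE l01).
    have hfin : (\int[powerm q k]_x h x)%E \is a fin_num.
      by rewrite ge0_fin_numE ?ge0_int// (le_lt_trans hle)// ltry.
    move: hle; rewrite -(fineK hfin) lee_fin => hle.
    by rewrite -EFin_expe lee_fin lerXn2r// nnegrE ?expR_ge0// fine_ge0// ge0_int.
  move: eW; rewrite (integral_powerm_density mg g0 qd meW eW0) => eW.
  have pe0 : (0 <= (p * expR (- c))%:E)%E.
    by rewrite lee_fin mulr_ge0 ?expR_ge0 ?ltW.
  have pec : ((p * expR (- c))%:E * (expR c)%:E = p%:E)%E.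
    by rewrite -EFinM -mulrA -expRD addNr expR0 mulr1.
  rewrite -pec; apply: le_trans (lee_wpmul2l pe0 eW).
  rewrite -ge0_intZl//; last 2 first.
  - exact: (emeasurable_funM meW (measurable_EFin mpg)).
  - by move=> x; rewrite mule_ge0// lee_fin; exact: pg0.
  apply: ge0_int_le => //.
  - apply: emeasurable_funM => //; apply/measurable_EFinP.
    apply: measurable_funM => //; apply: measurable_funM => //.
    by apply: measurableT_comp => //; exact: measurable_funB.
  - exact: (emeasurable_funM (measurable_cst _)
      (emeasurable_funM meW (measurable_EFin mpg))).
  - move=> x; rewrite mule_ge0// lee_fin// mulr_ge0// mulr_ge0 ?expR_ge0//.
    exact: ltW.
  - move=> x; rewrite !(=^~ EFinM) lee_fin expRD.
    have H : 0 <= p * (expR (W x) * expR (- c)) * pg x.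
      by rewrite mulr_ge0// mulr_ge0 ?(ltW p0)// mulr_ge0// expR_ge0.
    rewrite -/(pg x) (_ : p * expR (- c) * (expR (W x) * pg x) =
      p * (expR (W x) * expR (- c)) * pg x); last by ring.
    by case: (chi01 x) => -[-> _]; rewrite ?mul0r// mul1r.
pose om := fine (\int[alpha]_a (w a * (cond_density a)%:E))%E.
have wg0 : (0 <= \int[alpha]_a (w a * (cond_density a)%:E))%E.
  by apply: ge0_int => a; rewrite mule_ge0// lee_fin.
have EG0 : (0 <= Ent alpha cond_density)%E.
  by apply: ge0_int => a; rewrite lee_fin entf_ge0.
have omE : (\int[alpha]_a (w a * (cond_density a)%:E) = om%:E)%E.
  rewrite fineK// ge0_fin_numE//; apply: (@le_lt_trans _ _ (- ln p)%:E).
    by rewrite -w_Ent leeDl.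
  exact: ltry.
have om_le : om <= - ln p - E.
  by rewrite lerBrDr -lee_fin EFinD -omE -w_Ent leeD2l.
pose LHS (x : seq T) := (K%:E * (chi x)%:E +
  \sum_(b < m) (l%:E * ((chi x)%:E * (f (blk b x))%:E)))%E.
pose A (x : seq T) := ((chi x)%:E * (p * expR (W x - c) * pg x)%:E)%E.
pose B (x : seq T) := ((c + m%:R * l)%:E * (chi x)%:E)%E.
pose D (x : seq T) := (\sum_(i < n.+1) ((chi x)%:E * w (nth point x i)))%E.
have chiE0 x : (0 <= (chi x)%:E)%E by rewrite lee_fin.
have lf0 b x : (0 <= l%:E * ((chi x)%:E * (f (blk b x))%:E))%E.
  by rewrite !mule_ge0// lee_fin.
have A0 x : (0 <= A x)%E.
  by rewrite mule_ge0// lee_fin mulr_ge0// mulr_ge0 ?expR_ge0 ?ltW.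
have B0 x : (0 <= B x)%E by rewrite mule_ge0// lee_fin addr_ge0 ?mulr_ge0.
have D0 x : (0 <= D x)%E by apply: sume_ge0 => i _; exact: mule_ge0.
have mA : mseq n.+1 A.
  apply: (emeasurable_funM mchiE); apply/measurable_EFinP.
  apply: measurable_funM => //; apply: measurable_funM => //.
  by apply: measurableT_comp => //; exact: measurable_funB.
have mB : mseq n.+1 B by exact: (emeasurable_funM (measurable_cst _) mchiE).
have mDi i : measurable_fun setT
    (fun x : n.+1.-tuple T => (chi x)%:E * w (nth point x i))%E.
  apply: (emeasurable_funM mchiE); apply: measurableT_comp => //.
  exact: measurable_nth.
have mD : mseq n.+1 D by apply: emeasurable_sum => i; exact: mDi.
have mcf b : (b < m)%N -> mseq n.+1 (fun x => (chi x)%:E * (f (blk b x))%:E)%E.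
  by move=> bm; exact: (emeasurable_funM mchiE (measurable_EFin (mblk b bm))).
have mlf b : (b < m)%N ->
    mseq n.+1 (fun x => l%:E * ((chi x)%:E * (f (blk b x))%:E))%E.
  by move=> bm; exact: (emeasurable_funM (measurable_cst _) (mcf b bm)).
have mKc : mseq n.+1 (fun x => K%:E * (chi x)%:E)%E.
  exact: (emeasurable_funM (measurable_cst _) mchiE).
have mS : mseq n.+1 (fun x => \sum_(b < m) (l%:E * ((chi x)%:E * (f (blk b x))%:E)))%E.
  by apply: emeasurable_sum => b; exact: mlf.
have Kc0 x : (0 <= K%:E * (chi x)%:E)%E by rewrite mule_ge0// lee_fin.
have S0 x : (0 <= \sum_(b < m) (l%:E * ((chi x)%:E * (f (blk b x))%:E)))%E.
  by apply: sume_ge0 => b _; exact: lf0.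
have : (\int[powerm alpha n.+1]_x LHS x <=
        \int[powerm alpha n.+1]_x (A x + (B x + D x)))%E.
  apply: ge0_int_le.
  - exact: (emeasurable_funD mKc mS).
  - exact: (emeasurable_funD mA (emeasurable_funD mB mD)).
  - by move=> x; exact: (adde_ge0 (Kc0 x) (S0 x)).
  move=> x; case: (chi01 x) => -[chix Gx].
    rewrite {1}/LHS chix mule0 add0e big1 ?adde_ge0// => b _.
    by rewrite mul0e mule0.
  rewrite /LHS /A /B /D chix !mule1 mul1e.
  under eq_bigr do rewrite mul1e -EFinM.
  under [X in (_ <= _ + (_ + X))%E]eq_bigr do rewrite mul1e.
  rewrite sumEFin -mulr_sumr -EFinD addeA.
  have -> : (\sum_(i < n.+1) w (nth point x i) = \sum_(a <- x) w a)%E.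
    by rewrite (big_nth point) big_mkord size_tuple.
  by apply: key; rewrite size_tuple.
have -> : (\int[powerm alpha n.+1]_x LHS x = (K * p + m%:R * (l * (p * Qf)))%:E)%E.
  rewrite /LHS (ge0_intD _ mKc mS Kc0 S0) ge0_intZl ?lee_fin// int_chi.
  rewrite (@ge0_integral_sum _ _ _ _ _ measurableT _ _
    (fun (b : 'I_m) => mlf b (ltn_ord b)) (fun b x _ => lf0 b x)).
  rewrite (eq_bigr (fun=> (l * (p * Qf))%:E)) => [|b _].
    by rewrite sumEFin sumr_const card_ord mulr_natl.
  rewrite (ge0_intZl _ (mcf b (ltn_ord b))) ?lee_fin ?Qblk//.
  by move=> x; rewrite mule_ge0// lee_fin.
have mBD : mseq n.+1 (fun x => B x + D x)%E by exact: (emeasurable_funD mB mD).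
rewrite (ge0_intD _ mA mBD A0 (fun x => adde_ge0 (B0 x) (D0 x))).
rewrite (ge0_intD _ mB mD B0 D0).
have -> : (\int[powerm alpha n.+1]_x B x = ((c + m%:R * l) * p)%:E)%E.
  by rewrite /B ge0_intZl ?lee_fin ?addr_ge0 ?mulr_ge0// int_chi.
have -> : (\int[powerm alpha n.+1]_x D x = (n.+1%:R * (p * om))%:E)%E.
  rewrite /D (@ge0_integral_sum _ _ _ _ _ measurableT _ _
    (fun (i : 'I_n.+1) => mDi i) (fun i x _ => mule_ge0 (chiE0 x) (w0 _))).
  rewrite (eq_bigr (fun=> (p * om)%:E)) => [|i _].
    by rewrite sumEFin sumr_const card_ord mulr_natl.
  by rewrite integral_cond_density_nth// omE.
move=> H; have := le_trans H (leeD expW (lexx _)).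
rewrite -!EFinD lee_fin => {}H.
have : p * (K + m%:R * l * Qf) <= p * (1 + (c + m%:R * l) + n.+1%:R * om).
  by move: H; lra.
rewrite ler_pM2l// /K -natr1 => {}H.
have : n.+1%:R * om <= n.+1%:R * (- ln p - E) by rewrite ler_wpM2l.
by rewrite -natr1 -/c; lra.
Qed.

End conditioned.

(** * A lower bound by change of measure *)

Lemma ge0_measurable_inv {R : realType} d (T : measurableType d) (h : T -> R) :
  measurable_fun setT h -> (forall x, 0 <= h x) ->
  measurable_fun setT (fun x => (h x)^-1).
Proof.
move=> mh h0.
rewrite (_ : (fun _ => _) = (fun x => if h x == 0 then 0 else expR (- ln (h x)))).
  apply: measurable_fun_if => //.
  - exact: (measurable_fun_eqr mh (measurable_cst _)).
  - apply: measurable_funTS; apply: measurableT_comp => //.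
    by apply: measurableT_comp => //; apply: measurableT_comp => //; exact: measurable_ln.
apply/funext => x; have [->|hx] := eqVneq (h x) 0; first by rewrite invr0.
by rewrite expRN lnK// posrE lt_def hx h0.
Qed.

Lemma integral_powerm_sum {R : realType} d (T : measurableType d)
    (P : probability T R) n (u : T -> \bar R) :
  measurable_fun setT u -> (forall a, 0 <= u a)%E ->
  (\int[powerm P n]_x (\sum_(a <- x) u a) = n%:R%:E * \int[P]_a u a)%E.
Proof.
move=> mu u0; pose F (s : seq T) := (\sum_(a <- s) u a)%E.
have F0 s : (0 <= F s)%E by apply: sume_ge0.
have mF m : mseq m F.
  rewrite (_ : (fun _ => _) = (fun x : m.-tuple T => \sum_(i < m) u (nth point x i))%E).
    apply: emeasurable_sum => i; apply: measurableT_comp => //.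
    exact: measurable_nth.
  by apply/funext => x; rewrite /F (big_nth point) big_mkord size_tuple.
elim: n => [|n IH]; first by rewrite (integral_powerm0 _ F0) /F big_nil mul0e.
rewrite (integral_powermS _ (mF n.+1) F0).
transitivity (\int[P]_a (u a + n%:R%:E * \int[P]_a u a))%E.
  apply: eq_integral => a _; rewrite -IH.
  transitivity (\int[powerm P n]_x (u a + F x))%E.
    by apply: eq_integral => x _; rewrite /F big_cons.
  rewrite (ge0_intD _ (measurable_cst _) (mF n) (fun=> u0 a) F0).
  by rewrite integral_prob_cst.
have U0 : (0 <= n%:R%:E * \int[P]_a u a)%E.
  by rewrite mule_ge0 ?lee_fin// ge0_int.
rewrite (ge0_intD P mu (measurable_cst _) u0 (fun=> U0)) integral_prob_cst.
by rewrite -natr1 EFinD ge0_muleDl ?lee_fin// mul1e addeC.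
Qed.

Section change_of_measure.
Context {R : realType} d (T : measurableType d).
Variables (alpha P : probability T R) (h : T -> R) (H : R).
Hypothesis hd : is_density alpha h.
Hypothesis Ph : has_density P alpha h.
Hypothesis HE : Ent alpha h = H%:E.

Let mh : measurable_fun setT h. Proof. by case: hd. Qed.
Let h0 a : 0 <= h a. Proof. by case: hd. Qed.
Let h1 : (\int[alpha]_a (h a)%:E = 1)%E. Proof. by case: hd. Qed.

(* [ln h = ell + 1 - 1 / h], with [ell] nonnegative *)
Let ell a : \bar R := if h a == 0 then +oo%E else (ln (h a) + (h a)^-1 - 1)%:E.

Let ell0 a : (0 <= ell a)%E.
Proof.
rewrite /ell; case: ifPn => // ha; rewrite lee_fin.
have := @ln_ge1BV R (h a); rewrite lt_def ha h0 => /(_ isT); lra.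
Qed.

Let mV : measurable_fun setT (fun a => (h a)^-1).
Proof. exact: ge0_measurable_inv. Qed.

Let mell : measurable_fun setT ell.
Proof.
apply: measurable_fun_if => //.
- exact: (measurable_fun_eqr mh (measurable_cst _)).
- apply: measurable_funTS; apply/measurable_EFinP; apply: measurable_funB => //.
  by apply: measurable_funD => //; apply: measurableT_comp => //; exact: measurable_ln.
Qed.

Let kap := (\int[P]_a (h a)^-1%:E)%E.

Let V0 a : (0 <= (h a)^-1%:E)%E. Proof. by rewrite lee_fin invr_ge0. Qed.

Let kap01 : (0 <= kap <= 1)%E.
Proof.
rewrite ge0_int//= /kap (ge0_integral_density mh h0 Ph) //; last exact: (measurable_EFin mV).
rewrite -[leRHS](integral_prob_cst alpha); apply: ge0_int_le => //.
- exact: (emeasurable_funM (measurable_EFin mV) (measurable_EFin mh)).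
- by move=> a; rewrite mule_ge0// lee_fin.
move=> a; rewrite -EFinM lee_fin; have [->|ha] := eqVneq (h a) 0.
  by rewrite mulr0.
by rewrite mulVf.
Qed.

Let ell_kap : (\int[P]_a ell a + 1 = H%:E + kap)%E.
Proof.
have mhE := measurable_EFin mh.
have h0E a : (0 <= (h a)%:E)%E by rewrite lee_fin.
have mVE := measurable_EFin mV.
have mEh : measurable_fun setT (fun a => (entf (h a))%:E).
  exact: (measurable_EFin (measurable_entf mh)).
have Eh0 a : (0 <= (entf (h a))%:E)%E by rewrite lee_fin entf_ge0.
rewrite /kap -HE (ge0_integral_density mh h0 Ph)// (ge0_integral_density mh h0 Ph)//.
rewrite -[in LHS](integral_prob_cst alpha 1%E) -!ge0_intD//.
- apply: eq_integral => a _; rewrite /ell /entf; case: eqP => [->|/eqP ha].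
    by rewrite !mule0 adde0 add0e mul0r subr0 add0r.
  by rewrite !(=^~ EFinM, =^~ EFinD) mulVf//; congr EFin; field.
- exact: emeasurable_funM.
- by move=> a; rewrite mule_ge0.
- exact: emeasurable_funM.
- by move=> a; rewrite mule_ge0.
Qed.

(** Integrate [1 + y <= exp y], with [y = c - ln (dP^n / dalpha^n)], over the
    event, so that the log-likelihood enters through its mean under [P]. On the
    complement of the event, where [ln h] might be very negative, the exponential
    moment of [- ln h] under [P] is at most 1, whence the truncation level [M]. *)
Lemma change_of_measure_le n (G : set (seq T)) p s c M :
  measurable [set x : n.-tuple T | G x] ->
  powerm alpha n [set x : n.-tuple T | G x] = p%:E ->
  powerm P n [set x : n.-tuple T | G x] = (1 - s)%:E ->
  0 <= c -> 0 <= M ->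
  (1 - s) * (1 + c) <=
  p * expR c + n%:R * H + s * (n%:R * M) + n%:R * expR (- M).
Proof.
move=> mG pE sE c0 M0.
pose chi (x : seq T) : R := \1_G x.
have chi01 x : (chi x = 0 \/ chi x = 1).
  by rewrite /chi indicE; case: (_ \in _); [right|left].
have chi0 x : 0 <= chi x by rewrite /chi indicE.
have chi1 x : chi x <= 1 by case: (chi01 x) => ->.
have mchi : mseq n chi.
  rewrite (_ : (fun _ => _) = \1_[set x : n.-tuple T | G x]).
    exact: measurable_indic.
  by apply/funext => x; rewrite /chi !indicE; congr (_%:R); apply/idP/idP;
    rewrite !inE.
have mchiE := measurable_EFin mchi.
have chi0E x : (0 <= (chi x)%:E)%E by rewrite lee_fin.
have int_chi (Q : probability T R) z : powerm Q n [set x : n.-tuple T | G x] = z%:E ->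
    (\int[powerm Q n]_x (chi x)%:E = z%:E)%E.
  by move=> <-; rewrite -[in RHS](setIT [set x : n.-tuple T | G x]) -integral_indic.
have mchi' : mseq n (fun x => (1 - chi x)%:E).
  by apply/measurable_EFinP; exact: measurable_funB.
have chi'0 x : (0 <= (1 - chi x)%:E)%E by rewrite lee_fin subr_ge0.
have int_chi' : (\int[powerm P n]_x (1 - chi x)%:E = s%:E)%E.
  have : (\int[powerm P n]_x ((1 - chi x)%:E + (chi x)%:E) = 1)%E.
    by under eq_integral do rewrite -EFinD subrK; exact: integral_prob_cst.
  rewrite ge0_intD// (int_chi _ _ sE) => S1.
  have fs : ((1 - s)%:E : \bar R) \is a fin_num by [].
  by rewrite -[LHS](addeK _ fs) S1 -EFinB; congr EFin; ring.
pose ph (x : seq T) := \prod_(a <- x) h a.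
have ph0 x : 0 <= ph x by apply: prodr_ge0 => a _.
have mph : mseq n ph.
  rewrite (_ : (fun _ => _) = (fun x : n.-tuple T => \prod_(i < n) h (nth point x i))).
    apply: measurable_prod => i _; apply: measurableT_comp => //.
    exact: measurable_nth.
  by apply/funext => x; rewrite /ph (big_nth point) big_mkord size_tuple.
pose SV (x : seq T) := (\sum_(a <- x) (h a)^-1%:E)%E.
pose SE (x : seq T) := (\sum_(a <- x) ell a)%E.
pose A (x : seq T) := (chi x * (expR c * (ph x)^-1))%:E.
have SE_cases x : SE x = +oo%E \/ (0 < ph x /\ exists2 v, SV x = v%:E /\ 0 <= v &
    SE x = (ln (ph x) + v - (size x)%:R)%:E /\
    - ln (ph x) <= (size x)%:R * (M - 1) + expR (- M) * v).
  rewrite /SE /SV /ph; elim: x => [|a x IH].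
    right; rewrite !big_nil ln1; split => //; exists 0 => //.
    by split; [rewrite addr0 subr0|rewrite mul0r mulr0 addr0 oppr0].
  have sum0 : (0 <= \sum_(a <- x) ell a)%E by apply: sume_ge0.
  rewrite !big_cons {1 3}/ell; case: ifPn => [_|ha].
    by left; rewrite addye// gt_eqF// (lt_le_trans _ sum0).
  case: IH => [->|[px [v [-> v0] [-> lv]]]]; first by left; rewrite addey.
  have hap : 0 < h a by rewrite lt_def ha h0.
  right; split; first exact: mulr_gt0.
  exists ((h a)^-1 + v); first by split => //; rewrite addr_ge0// invr_ge0.
  have sS : (size (a :: x))%:R = (size x)%:R + 1 :> R by rewrite natr1.
  rewrite sS lnM ?posrE//; split.
    apply: (congr1 EFin).
    by move: (ln (h a)) (ln _) (size x)%:R (h a)^-1 => X Y Z W; ring.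
  have := expR_ge1Dx (- ln (h a) - M).
  rewrite expRD expRN lnK ?posrE// mulrC => e1.
  by rewrite mulrDr; lra.
have SV0 x : (0 <= SV x)%E by apply: sume_ge0 => a _; exact: V0.
have SE0 x : (0 <= SE x)%E by apply: sume_ge0 => a _; exact: ell0.
have mSum (u : T -> \bar R) : measurable_fun setT u -> mseq n (fun x => \sum_(a <- x) u a)%E.
  move=> mu; rewrite (_ : (fun _ => _) =
    (fun x : n.-tuple T => \sum_(i < n) u (nth point x i))%E).
    apply: emeasurable_sum => i; apply: measurableT_comp => //.
    exact: measurable_nth.
  by apply/funext => x; rewrite (big_nth point) big_mkord size_tuple.
have mSV : mseq n SV by exact: (mSum _ (measurable_EFin mV)).
have mSE : mseq n SE by exact: (mSum _ mell).
have A0 x : (0 <= A x)%E.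
  by rewrite lee_fin mulr_ge0// mulr_ge0 ?expR_ge0// invr_ge0.
have mA : mseq n A.
  apply/measurable_EFinP; apply: measurable_funM => //.
  by apply: measurable_funM => //; exact: (ge0_measurable_inv mph).
have c10 : 0 <= 1 + c by rewrite addr_ge0.
have nM0 : 0 <= n%:R * M by rewrite mulr_ge0.
have e0 : 0 <= expR (- M) by exact: expR_ge0.
have key (x : n.-tuple T) : ((1 + c)%:E * (chi x)%:E + SV x <=
    A x + (SE x + (n%:R%:E + ((n%:R * M)%:E * (1 - chi x)%:E +
      (expR (- M))%:E * SV x))))%E.
  have nE0 : (0 <= n%:R%:E + ((n%:R * M)%:E * (1 - chi x)%:E +
      (expR (- M))%:E * SV x))%E.
    by rewrite adde_ge0 ?adde_ge0 ?mule_ge0// ?lee_fin.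
  case: (SE_cases x) => [->|[px [v [-> v0] [-> lv]]]].
    rewrite (@addye _ (_ + _)%E) ?addey ?leey//.
    by rewrite gt_eqF// (lt_le_trans _ nE0).
  rewrite !(=^~ EFinM, =^~ EFinD) lee_fin.
  have ev0 : 0 <= expR (- M) * v by rewrite mulr_ge0.
  move: lv; rewrite size_tuple => lv.
  case: (chi01 x) => ->.
    have : 0 <= n%:R :> R by []. 
    move: lv; rewrite !mulr0 !subr0 !mul0r mulr1 mulrBr mulr1; lra.
  have := expR_ge1Dx (c - ln (ph x)).
  by rewrite expRD expRN lnK ?posrE// subrr mulr0 mulr1 mul1r; lra.
have kapfin : kap \is a fin_num.
  have /andP[k0 k1] := kap01.
  by rewrite ge0_fin_numE// (le_lt_trans k1)// ltry.
have mT1 : mseq n (fun x => (1 + c)%:E * (chi x)%:E)%E.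
  exact: (emeasurable_funM (measurable_cst _) mchiE).
have mT2 : mseq n (fun x => (n%:R * M)%:E * (1 - chi x)%:E)%E.
  exact: (emeasurable_funM (measurable_cst _) mchi').
have mT3 : mseq n (fun x => (expR (- M))%:E * SV x)%E.
  exact: (emeasurable_funM (measurable_cst _) mSV).
have mT4 : mseq n (fun x => (n%:R * M)%:E * (1 - chi x)%:E +
    (expR (- M))%:E * SV x)%E.
  exact: (emeasurable_funD mT2 mT3).
have mT5 : mseq n (fun x => n%:R%:E + ((n%:R * M)%:E * (1 - chi x)%:E +
    (expR (- M))%:E * SV x))%E.
  exact: (emeasurable_funD (measurable_cst _) mT4).
have mT6 : mseq n (fun x => SE x + (n%:R%:E + ((n%:R * M)%:E * (1 - chi x)%:E +
    (expR (- M))%:E * SV x)))%E.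
  exact: (emeasurable_funD mSE mT5).
have T10 x : (0 <= (1 + c)%:E * (chi x)%:E)%E by rewrite mule_ge0.
have T20 x : (0 <= (n%:R * M)%:E * (1 - chi x)%:E)%E by rewrite mule_ge0.
have T30 x : (0 <= (expR (- M))%:E * SV x)%E by rewrite mule_ge0.
have T50 x : (0 <= n%:R%:E + ((n%:R * M)%:E * (1 - chi x)%:E +
    (expR (- M))%:E * SV x))%E.
  by rewrite adde_ge0 ?lee_fin// adde_ge0.
have := ge0_int_le (powerm P n) (emeasurable_funD mT1 mSV)
  (emeasurable_funD mA mT6)
  (fun x => adde_ge0 (T10 x) (SV0 x)) key.
rewrite (ge0_intD _ mT1 mSV)// ge0_intZl// (int_chi _ _ sE).
rewrite (ge0_intD _ mA mT6)//; last first.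
  by move=> x; exact: adde_ge0.
have n0E : (0 <= n%:R%:E :> \bar R)%E by rewrite lee_fin.
rewrite (ge0_intD _ mSE mT5)// (ge0_intD _ (measurable_cst _) mT4 (fun=> n0E)
  (fun x => adde_ge0 (T20 x) (T30 x))).
rewrite /= (ge0_intD _ mT2 mT3)// (ge0_intZl _ mchi' chi'0)// int_chi' (ge0_intZl _ mSV SV0)//.
rewrite integral_prob_cst.
rewrite (@integral_powerm_sum _ _ _ P n (fun a => (h a)^-1%:E)) //; last first.
  exact: (measurable_EFin mV).
rewrite (@integral_powerm_sum _ _ _ P n ell)//.
have intA : (\int[powerm P n]_x A x <= (p * expR c)%:E)%E.
  rewrite (integral_powerm_density mh h0 Ph mA A0).
  rewrite mulrC EFinM -(int_chi _ _ pE) -ge0_intZl ?lee_fin ?expR_ge0//.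
  apply: ge0_int_le => //.
  - exact: (emeasurable_funM mA (measurable_EFin mph)).
  - exact: (emeasurable_funM (measurable_cst _) mchiE).
  - by move=> x; rewrite mule_ge0// lee_fin; exact: ph0.
  move=> x; rewrite -!EFinM lee_fin -/(ph x).
  have [->|px] := eqVneq (ph x) 0; first by rewrite mulr0 mulr_ge0 ?expR_ge0.
  by rewrite -!mulrA mulVf// mulr1 mulrC.
have ellE : (\int[P]_a ell a = (H + fine kap - 1)%:E)%E.
  have f1 : (1%E : \bar R) \is a fin_num by [].
  by rewrite -[LHS](addeK _ f1) ell_kap -{1}(fineK kapfin).
rewrite ellE -/kap -(fineK kapfin).
move=> I; have := le_trans I (leeD intA (lexx _)).
rewrite -!EFinM -!EFinD lee_fin.
have k1 : fine kap <= 1.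
  by rewrite -lee_fin fineK//; case/andP: kap01.
have : n%:R * expR (- M) * fine kap <= n%:R * expR (- M).
  by rewrite ler_piMr// mulr_ge0.
by move: (expR (- M)) (expR c) (fine kap) => X Y Z /=; lra.
Qed.

End change_of_measure.

(** * The relative entropy as an integral of the density *)

Section rel_entropy_density.
Context {R : realType} d (T : measurableType d).
Variables (alpha nu : probability T R).

Lemma measurable_fun_lne (f : T -> R) : measurable_fun setT f ->
  measurable_fun setT (fun x => lne (f x)%:E).
Proof.
move=> mf; apply: measurable_fun_if => //.
- exact: (measurable_fun_ler mf (measurable_cst _)).
- by apply: measurable_funTS; apply/measurable_EFinP; apply: measurableT_comp.
Qed.

Variable f : T -> R.
Hypothesis fd : is_density alpha f.
Hypothesis nuf : has_density nu alpha f.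

Let mf : measurable_fun setT f. Proof. by case: fd. Qed.
Let f0 x : 0 <= f x. Proof. by case: fd. Qed.

Let nua : nu `<< alpha. Proof. exact: has_density_dominates mf nuf. Qed.

Lemma density_ae_eq : ae_eq nu setT (density nu alpha) (fun x => (f x)%:E).
Proof.
apply: (null_dominates_ae_eq measurableT nua).
apply: integral_ae_eq => //.
- exact: Radon_Nikodym_integrable.
- exact: (measurable_EFin mf).
- by move=> A _ mA; rewrite -Radon_Nikodym_integral//; exact: nuf.
Qed.

Lemma integral_lne_density :
  (\int[nu]_x lne (density nu alpha x) = Ent alpha f)%E.
Proof.
pose L x := lne (f x)%:E.
have mL : measurable_fun setT L by exact: measurable_fun_lne.
have mD : measurable_fun setT (fun x => lne (density nu alpha x)).
  rewrite (_ : (fun _ => _) = (fun x => lne (fine (density nu alpha x))%:E)).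
    apply: measurable_fun_lne; apply: measurableT_comp => //.
    exact: (measurable_int _ (@Radon_Nikodym_integrable _ _ _
      (charge_of_finite_measure nu) alpha nua)).
  by apply/funext => x; rewrite fineK// Radon_Nikodym_fin_num.
transitivity (\int[nu]_x L x)%E.
  apply: ae_eq_integral => //.
  by apply: filterS density_ae_eq => x /(_ I) Dx _; rewrite Dx.
have mLp : measurable_fun setT (L^\+)%E by exact: measurable_funepos.
have mLn : measurable_fun setT (L^\-)%E by exact: measurable_funeneg.
rewrite integralE (ge0_integral_density mf f0 nuf mLp)//.
rewrite (ge0_integral_density mf f0 nuf mLn)//.
set a := (\int[alpha]_x _)%E; set b := (\int[alpha]_x (L^\- x * _))%E.
have mfE := measurable_EFin mf.
have f0E x : (0 <= (f x)%:E)%E by rewrite lee_fin.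
have mpf := emeasurable_funM mLp mfE; have mnf := emeasurable_funM mLn mfE.
have pf0 x : (0 <= (L^\+ x * (f x)%:E))%E by exact: mule_ge0.
have nf0 x : (0 <= (L^\- x * (f x)%:E))%E by exact: mule_ge0.
have mEf : measurable_fun setT (fun x => (entf (f x))%:E).
  exact: (measurable_EFin (measurable_entf mf)).
have Ef0 x : (0 <= (entf (f x))%:E)%E by rewrite lee_fin entf_ge0.
have f1 : (\int[alpha]_x (f x)%:E = 1)%E by case: fd.
have LE x : 0 < f x -> L x = (ln (f x))%:E by move=> fx; rewrite /L lne_EFin.
have pointwise x : ((L^\- x * (f x)%:E) + (entf (f x))%:E + (f x)%:E =
    (L^\+ x * (f x)%:E) + 1)%E.
  have [fx0|fx0] := eqVneq (f x) 0.
    by rewrite fx0 !mule0 adde0 !add0e /entf mul0r subr0 add0r.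
  have fx : 0 < f x by rewrite lt_def fx0 f0.
  rewrite funenegE funeposE LE//= /entf.
  have [l0|/ltW l0] := leP 0 (ln (f x)).
    rewrite max_r ?lee_fin ?oppr_le0// max_l ?lee_fin// mul0e add0e.
    by rewrite !(=^~ EFinM, =^~ EFinD); congr EFin; ring.
  rewrite max_l ?lee_fin ?oppr_ge0// max_r ?lee_fin// mul0e add0e.
  by rewrite !(=^~ EFinM, =^~ EFinD); apply: (congr1 EFin); ring.
have b1 : (b <= 1)%E.
  rewrite -(integral_prob_cst alpha 1%E); apply: ge0_int_le => // x.
  have [fx0|fx0] := eqVneq (f x) 0; first by rewrite fx0 mule0.
  have fx : 0 < f x by rewrite lt_def fx0 f0.
  rewrite funenegE LE//.
  have [l0|/ltW l0] := leP 0 (ln (f x)).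
    by rewrite max_r ?lee_fin ?oppr_le0// mul0r ler01.
  rewrite max_l ?lee_fin ?oppr_ge0//.
  have := ler_wpM2l (ltW fx) (ln_ge1BV fx); rewrite mulrBr divff//; lra.
have b0 : (0 <= b)%E by exact: ge0_int.
have bfin : b \is a fin_num.
  by rewrite ge0_fin_numE// (le_lt_trans b1)// ltry.
have sumE : (b + Ent alpha f + 1 = a + 1)%E.
  have m2 : measurable_fun setT (fun x => (L^\- x * (f x)%:E) + (entf (f x))%:E)%E.
    exact: emeasurable_funD.
  rewrite -{1}f1 /b /Ent -(ge0_intD _ mnf mEf)//.
  rewrite -(ge0_intD _ m2 mfE)//; last by move=> x; exact: adde_ge0.
  under eq_integral do rewrite pointwise.
  by rewrite ge0_intD// integral_prob_cst.
have fin1 : (1%E : \bar R) \is a fin_num by [].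
have aE : a = (b + Ent alpha f)%E.
  by rewrite -[LHS](addeK _ fin1) -sumE addeK.
by rewrite aE (addeC b) addeK.
Qed.

Lemma rel_entropyE : rel_entropy nu alpha = Ent alpha f.
Proof.
rewrite /rel_entropy integral_lne_density; have /asboolT -> /= := nua.
case: ifPn => // En; apply/esym; apply: contraNeq En => Ey.
rewrite ge0_fin_numE ?lt_neqAle ?Ey ?leey//.
by apply: ge0_int => x; rewrite lee_fin entf_ge0.
Qed.

End rel_entropy_density.

Lemma rel_entropy_lty {R : realType} d (T : measurableType d)
    (alpha nu : probability T R) : (rel_entropy nu alpha < +oo)%E ->
  exists2 f, is_density alpha f /\ has_density nu alpha f &
    exists H, rel_entropy nu alpha = H%:E /\ Ent alpha f = H%:E.
Proof.
move=> nuy; have nua : nu `<< alpha.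
  by move: nuy; rewrite /rel_entropy; case: asboolP.
pose g := Radon_Nikodym_SigmaFinite.f nu alpha.
have g0 x : (0 <= g x)%E by exact: Radon_Nikodym_SigmaFinite.f_ge0.
have gfin x : g x \is a fin_num by exact: Radon_Nikodym_SigmaFinite.f_fin_num.
have mg : measurable_fun setT g.
  exact: (measurable_int _ (Radon_Nikodym_SigmaFinite.f_integrable nua)).
pose f x := fine (g x).
have fE x : (f x)%:E = g x by rewrite fineK.
have nuf : has_density nu alpha f.
  move=> A mA; under eq_integral do rewrite fE.
  exact: Radon_Nikodym_SigmaFinite.f_integral.
have fd : is_density alpha f.
  split; first by apply: measurableT_comp.
    by move=> x; exact: fine_ge0.
  exact: has_density_int1 nuf.
exists f => //; have entE := rel_entropyE fd nuf.
exists (fine (Ent alpha f)); rewrite entE.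
have Efin : Ent alpha f \is a fin_num.
  rewrite ge0_fin_numE -?entE// entE.
  by apply: ge0_int => x; rewrite lee_fin entf_ge0// fine_ge0.
by rewrite fineK.
Qed.

(** * Empirical measures on a metric space *)

Section empirical_integral.
Context {R : realType} d (T : measurableType d).

Lemma integral_empirical n (x : n.-tuple T) (u : T -> \bar R) : (0 < n)%N ->
  measurable_fun setT u -> (forall a, 0 <= u a)%E ->
  (\int[(empirical x : probability T R)]_a u a =
   (n%:R^-1)%:E * \sum_(i < n) u (tnth x i))%E.
Proof.
move=> n0 mu u0.
have ni0 : 0 <= n%:R^-1 :> R by rewrite invr_ge0.
pose m : {measure set T -> \bar R} :=
  mscale (NngNum ni0) (msum (fun i => \d_(nth point x i) : {measure set T -> \bar R}) n).
rewrite (eq_measure_integral m) => [|A mA _]; last first.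
  apply: (etrans (empiricalE x A n0)).
  rewrite /m /mscale /= /msum; congr (_ * _)%E.
  by apply: eq_bigr => i _; rewrite (tnth_nth point).
rewrite /m ge0_integral_mscale//= ge0_integral_measure_sum//.
congr (_ * _)%E; apply: eq_bigr => i _.
by rewrite integral_dirac// diracT mul1e (tnth_nth point).
Qed.

End empirical_integral.

Section metric.
Context {R : realType} {E : completeMetricType R}.
Implicit Types (f : E -> R) (mu nu : M1 E R).

Definition lipschitz f := forall x y, `|f x - f y| <= mdist x y.

Lemma continuous_borel_measurable f : continuous f ->
  measurable_fun [set: borel E] (f : borel E -> R).
Proof.
move=> /continuousP cf; apply: (measurability _ (RGenOpens.measurableE R)).
move=> _ [_ [a [b ->] <-]]; rewrite setTI; apply: sub_sigma_algebra.
by apply: cf; exact: interval_open.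
Qed.

Lemma lipschitz_continuous f k : (forall x y, `|f x - f y| <= k * mdist x y) ->
  continuous f.
Proof.
move=> fl x; apply/cvgrPdist_lt => e e0.
have k1 : 0 < `|k| + 1 by rewrite ltr_pwDr.
have d0 : 0 < e / (`|k| + 1) by rewrite divr_gt0.
have Hball := nbhsx_ballx x _ d0.
near=> y; apply: (le_lt_trans (fl x y)).
have : ball x (e / (`|k| + 1)) y by near: y.
rewrite ballEmdist /= ltr_pdivlMr// => xy.
apply: le_lt_trans xy; rewrite mulrC ler_wpM2l ?mdist_ge0//.
by rewrite (le_trans (ler_norm k))// lerDl.
Unshelve. all: by end_near. Qed.

Lemma lipschitz_measurable f : lipschitz f ->
  measurable_fun [set: borel E] (f : borel E -> R).
Proof.
move=> fl; apply: continuous_borel_measurable.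
by apply: (@lipschitz_continuous f 1) => x y; rewrite mul1r.
Qed.

(** These functions are rich enough to separate closed convex sets of measures,
    and their integrals are controlled by both metrics. *)
Definition test f := lipschitz f /\ forall x, 0 <= f x <= 1.

Lemma enlarge_lt (A : set E) r s x : enlarge A r x -> r < s ->
  exists2 y, A y & mdist x y < s.
Proof.
rewrite /enlarge/= => xA rs.
have : (dist_set x A < s%:E)%E by apply: (le_lt_trans xA); rewrite lte_fin.
by move=> /ereal_inf_lt[_ [y Ay <-]]; rewrite lte_fin => xy; exists y.
Qed.

Lemma enlarge_sub (A : set E) r s x y :
  enlarge A r x -> mdist x y <= s -> enlarge A (r + s) y.
Proof.
move=> xA xy; rewrite /enlarge/=; apply/lee_addgt0Pr => e e0.
have re : r < r + e by rewrite ltrDl.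
have [z Az xz] := enlarge_lt xA re.
apply: (@le_trans _ _ (mdist y z)%:E).
  by apply: ereal_inf_lbound; exists z.
rewrite -EFinD lee_fin (le_trans (metric_triangle y x z))//.
by rewrite metric_sym in xy; lra.
Qed.


Lemma sup_norm_le f c : (forall x, `|f x| <= c) -> (sup_norm f <= c%:E)%E.
Proof. by move=> fc; apply: ge_ereal_sup => _ [x _ <-]; rewrite lee_fin. Qed.

Lemma lip_norm_le f k : 0 <= k -> (forall x y, `|f x - f y| <= k * mdist x y) ->
  (lip_norm f <= k%:E)%E.
Proof.
move=> k0 fk; apply: ge_ereal_sup => _ [[x y] _ <-]; rewrite lee_fin /=.
have [->|xy] := eqVneq x y; first by rewrite subrr normr0 mul0r.
by rewrite ler_pdivrMr ?fk// mdist_gt0.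
Qed.

Lemma fm_test_bounds f : (sup_norm f + lip_norm f <= 1)%E ->
  (forall x, `|f x| <= 1) /\ lipschitz f.
Proof.
move=> f1.
have s0 : (0 <= sup_norm f)%E.
  apply: (@le_trans _ _ `|f point|%:E); first by rewrite lee_fin.
  by apply: ereal_sup_ubound; exists point.
have l0 : (0 <= lip_norm f)%E.
  apply: (@le_trans _ _ (`|f point - f point| / mdist (point : E) point)%:E).
    by rewrite lee_fin divr_ge0// mdist_ge0.
  by apply: ereal_sup_ubound; exists (point, point).
split=> [x|x y].
  rewrite -lee_fin; apply: (@le_trans _ _ (sup_norm f)).
    by apply: ereal_sup_ubound; exists x.
  by apply: le_trans f1; rewrite leeDl.
have [->|xy] := eqVneq x y; first by rewrite subrr normr0 mdist_ge0.
have xy0 : 0 < mdist x y by rewrite mdist_gt0.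
rewrite -[leRHS]mul1r -ler_pdivrMr// -lee_fin.
apply: (@le_trans _ _ (lip_norm f)).
  by apply: ereal_sup_ubound; exists (x, y).
by apply: le_trans f1; rewrite leeDr.
Qed.

Lemma fm_close mu nu e f : (fortet_mourier mu nu <= e%:E)%E -> test f ->
  (\int[mu]_x (f x)%:E <= \int[nu]_x (f x)%:E + (2 * e)%:E)%E.
Proof.
move=> de [fl f01].
pose h x := f x / 2.
have mf := lipschitz_measurable fl.
have f0 x : (0 <= (f x)%:E)%E by rewrite lee_fin; case/andP: (f01 x).
have half (m : M1 E R) : (\int[m]_x (h x)%:E = (2^-1)%:E * \int[m]_x (f x)%:E)%E.
  rewrite -ge0_intZl//; last exact: (measurable_EFin mf).
  by apply: eq_integral => x _; rewrite /h -EFinM mulrC.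
have : (\int[mu]_x (h x)%:E - \int[nu]_x (h x)%:E <= e%:E)%E.
  apply: le_trans de; apply: ereal_sup_ubound; exists h => //=.
  apply: (@le_trans _ _ ((2^-1)%:E + (2^-1)%:E)%E); last by rewrite -EFinD lee_fin; lra.
  apply: leeD.
    apply: sup_norm_le => x; have /andP[] := f01 x; rewrite /h => a0 a1.
    by rewrite ger0_norm ?divr_ge0//; lra.
  apply: lip_norm_le => // x y.
  rewrite /h -mulrBl normrM mulrC (ger0_norm (_ : 0 <= 2^-1))// ler_wpM2l//.
have fin (m : M1 E R) : (\int[m]_x (f x)%:E)%E \is a fin_num.
  rewrite ge0_fin_numE ?ge0_int//; apply: (@le_lt_trans _ _ 1%E); last exact: ltry.
  rewrite -[leRHS](integral_prob_cst m); apply: ge0_int_le => //.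
    exact: (measurable_EFin mf).
  by move=> x; rewrite lee_fin; case/andP: (f01 x).
rewrite !half -(fineK (fin mu)) -(fineK (fin nu)) -!EFinM -EFinB -EFinD !lee_fin.
by lra.
Qed.

Lemma count_ge_min (t : R) m : 0 <= t ->
  Num.min t m%:R <= \sum_(i < m) (i%:R <= t)%R%:R :> R.
Proof.
move=> t0; elim: m => [|m IH]; first by rewrite big_ord0 ge_min lexx orbT.
rewrite big_ord_recr /=; have [mt|mt] := leP m%:R t.
  move: IH; rewrite min_r// => IH.
  by rewrite ge_min -natr1 lerD2r IH orbT.
move: IH; rewrite min_l ?(ltW mt)// addr0 => IH.
by rewrite ge_min IH.
Qed.

Lemma count_le (t : R) m : 0 <= t -> \sum_(i < m) (i%:R <= t)%R%:R <= t + 1 :> R.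
Proof.
move=> t0; elim: m => [|m IH]; first by rewrite big_ord0 addr_ge0.
rewrite big_ord_recr /=; have [mt|mt] := leP m%:R t; last by rewrite addr0.
rewrite lerD2r; apply: le_trans mt.
apply: (@le_trans _ _ (\sum_(i < m) 1)); last by rewrite sumr_const card_ord.
by apply: ler_sum => i _; rewrite lern1 leq_b1.
Qed.

(** Slicing [f] at the levels [i / m] turns the Prohorov inequality, about
    sets, into an inequality between integrals. *)
Lemma prohorov_close mu n (y : n.-tuple (borel E)) m f : (0 < n)%N -> (0 < m)%N ->
  (prohorov mu (empirical y) < (m%:R^-1)%:E)%E -> test f ->
  (\int[mu]_x (f x)%:E <=
   \int[(empirical y : M1 E R)]_x (f x)%:E + (3 / m%:R)%:E)%E.
Proof.
move=> n0 m0 /ereal_inf_lt[_ [r [r0 rsup] <-]]; rewrite lte_fin => rm [fl f01].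
have mf := lipschitz_measurable fl.
have f0 x : 0 <= f x by case/andP: (f01 x).
have f0E x : (0 <= (f x)%:E)%E by rewrite lee_fin.
have mR : 0 < m%:R :> R by rewrite ltr0n.
have nR : 0 < n%:R :> R by rewrite ltr0n.
pose A i : set (borel E) := [set x | i%:R <= m%:R * f x].
have mmf : measurable_fun [set: borel E] (fun x : borel E => m%:R * f x).
  exact: measurable_funM.
have mA i : measurable (A i).
  have := mmf measurableT `[i%:R, +oo[%classic (measurable_itv _).
  rewrite setTI (_ : _ @^-1` _ = A i)//.
  by apply/seteqP; split => x; rewrite /A /= in_itv /= andbT.
pose z (j : 'I_n) := m%:R * f (tnth y j) + 1.
have LA (i : nat) : ((empirical y : M1 E R) (enlarge (A i) r) <=
    (n%:R^-1 * \sum_(j < n) (i%:R <= z j)%R%:R)%:E)%E.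
  apply: (@le_trans _ _ (n%:R^-1%:E * \sum_(j < n) \d_(tnth y j) (enlarge (A i) r))%E).
    by rewrite -(empiricalE y _ n0).
  rewrite EFinM -sumEFin lee_wpmul2l ?lee_fin ?invr_ge0//.
  apply: lee_sum => j _; rewrite diracE lee_fin.
  have [/set_mem yA|//] := boolP (tnth y j \in enlarge (A i) r).
  have [x Ax] := enlarge_lt yA rm; rewrite metric_sym => xy.
  suff -> : i%:R <= z j by [].
  have : m%:R * (f x - f (tnth y j)) <= 1.
    apply: (@le_trans _ _ (m%:R * m%:R^-1)); last by rewrite divff// gt_eqF.
    rewrite ler_pM2l//; apply: le_trans (ler_norm _) _.
    exact: (le_trans (fl _ _) (ltW xy)).
  by move: Ax; rewrite /A /z /= mulrBr; lra.
have muA i : (mu (A i) <= (n%:R^-1 * \sum_(j < n) (i%:R <= z j)%R%:R + r)%:E)%E.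
  have : (mu (A i) - (empirical y : M1 E R) (enlarge (A i) r) <= r%:E)%E.
    by apply: le_trans rsup; apply: ereal_sup_ubound; exists (A i).
  have Lfin : (empirical y : M1 E R) (enlarge (A i) r) \is a fin_num.
    rewrite ge0_fin_numE; first exact: (le_lt_trans (LA i) (ltry _)).
    apply: (@le_trans _ _ (n%:R^-1%:E * \sum_(j < n) \d_(tnth y j) (enlarge (A i) r))%E).
      by rewrite mule_ge0 ?lee_fin ?invr_ge0// sume_ge0.
    by rewrite -(empiricalE y _ n0).
  rewrite leeBlDr// => /le_trans; apply.
  by rewrite EFinD addeC; apply: leeD => //; exact: LA.
have mint : (m%:R%:E * \int[mu]_x (f x)%:E <= \sum_(i < m) mu (A i))%E.
  rewrite -ge0_intZl ?lee_fin//; last exact: (measurable_EFin mf).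
  apply: (@le_trans _ _ (\int[mu]_x (\sum_(i < m) (\1_(A i) x)%:E))%E).
    apply: ge0_int_le => //.
    - exact: (emeasurable_funM (measurable_cst _) (measurable_EFin mf)).
    - apply: emeasurable_sum => i; apply/measurable_EFinP.
      exact: measurable_indic.
    - by move=> x; rewrite mule_ge0// lee_fin.
    move=> x; rewrite -EFinM sumEFin lee_fin.
    have := @count_ge_min (m%:R * f x) m (mulr_ge0 (ltW mR) (f0 x)).
    rewrite min_l; last by rewrite ler_piMr//; case/andP: (f01 x).
    move=> /le_trans; apply; apply: ler_sum => i _; rewrite indicE.
    by rewrite -[_ \in _]/(x \in A i) (_ : (x \in A i) = (i%:R <= m%:R * f x))//;
      apply/idP/idP; rewrite inE.
  rewrite ge0_integral_sum//.
  - by apply: lee_sum => i _; rewrite integral_indic// setIT.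
  - by move=> i; apply/measurable_EFinP; exact: measurable_indic.
have {}mint : (m%:R%:E * \int[mu]_x (f x)%:E <=
    (\sum_(i < m) (n%:R^-1 * (\sum_(j < n) (i%:R <= z j)%R%:R) + r))%:E)%E.
  by apply: (le_trans mint); rewrite -sumEFin; apply: lee_sum => i _; exact: muA.
rewrite (integral_empirical y n0 (measurable_EFin mf) f0E) sumEFin -EFinM -EFinD.
have ffin : (\int[mu]_x (f x)%:E)%E \is a fin_num.
  rewrite ge0_fin_numE ?ge0_int//; apply: (@le_lt_trans _ _ 1%E); last exact: ltry.
  rewrite -[leRHS](integral_prob_cst mu); apply: ge0_int_le => //.
    exact: (measurable_EFin mf).
  by move=> x; rewrite lee_fin; case/andP: (f01 x).
move: mint; rewrite -(fineK ffin) -EFinM !lee_fin => mint.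
set S := \sum_(i < n) f (tnth y i).
have bound : \sum_(i < m) (n%:R^-1 * (\sum_(j < n) (i%:R <= z j)%R%:R) + r) <=
    m%:R * (n%:R^-1 * S) + 2 + m%:R * r.
  rewrite big_split/= sumr_const card_ord -(mulr_natl r) lerD2r -mulr_sumr exchange_big/=.
  apply: (@le_trans _ _ (n%:R^-1 * \sum_(j < n) (z j + 1))).
    rewrite ler_pM2l ?invr_gt0//; apply: ler_sum => j _; apply: count_le.
    by rewrite addr_ge0// mulr_ge0// ltW.
  rewrite /z big_split/= big_split/= -mulr_sumr !sumr_const card_ord -/S.
  have : n%:R^-1 * n%:R = 1 :> R by rewrite mulVf// gt_eqF.
  by rewrite !mulrDr; lra.
rewrite -(ler_pM2l mR); apply: (le_trans mint); apply: (le_trans bound).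
have : m%:R * r <= 1.
  by have := ler_wpM2l (ltW mR) (ltW rm); rewrite divff ?gt_eqF.
have : m%:R * (3 / m%:R) = 3 :> R by rewrite mulrC divfK// gt_eqF.
by rewrite mulrDr; lra.
Qed.

(** The threshold [s] is the same for all measures, sample sizes and test
    functions, so that one event imposes all the constraints at once. *)
Lemma metric_close (dbar : M1 E R -> M1 E R -> \bar R) (e : R) :
  dbar = prohorov \/ dbar = fortet_mourier -> 0 < e ->
  exists2 s : R, 0 < s & forall mu n (y : n.-tuple (borel E)) f, (0 < n)%N ->
    (dbar mu (empirical y) < s%:E)%E -> test f ->
    (\int[mu]_x (f x)%:E <=
     \int[(empirical y : M1 E R)]_x (f x)%:E + e%:E)%E.
Proof.
move=> [->|->] e0.
  pose m := (Num.truncn (3 / e)).+1.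
  have m3 : 3 / m%:R <= e.
    rewrite ler_pdivrMr ?ltr0n// mulrC -ler_pdivrMr//.
    by apply: ltW; apply: Num.Theory.truncnS_gt; rewrite num_real.
  exists m%:R^-1; first by rewrite invr_gt0 ltr0n.
  move=> mu n y f n0 d tf; apply: (le_trans (prohorov_close n0 _ d tf)) => //.
  by apply: leeD => //; rewrite lee_fin.
exists (e / 2); first by rewrite divr_gt0.
move=> mu n y f n0 d tf; apply: (le_trans (fm_close (ltW d) tf)).
by apply: leeD => //; rewrite lee_fin; lra.
Qed.

End metric.

Section empirical_metric.
Context {R : realType} {E : completeMetricType R}.
Implicit Types (f : E -> R) (mu nu : M1 E R).

Lemma bounded_integrable (m : M1 E R) f (c : R) :
  measurable_fun [set: borel E] (f : borel E -> R) ->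
  (forall x, `|f x| <= c) -> m.-integrable setT (fun x => (f x)%:E).
Proof.
move=> mf fc; apply: measurable_bounded_integrable => //.
  by rewrite (le_lt_trans (probability_le1 m measurableT))// ltry.
exists c; split; first exact: num_real.
by move=> M cM x _; exact: le_trans (fc x) (ltW cM).
Qed.

Lemma integral_shift (m : M1 E R) f (c : R) :
  measurable_fun [set: borel E] (f : borel E -> R) ->
  (forall x, `|f x| <= c) ->
  (\int[m]_x (f x)%:E = \int[m]_x (f x + c)%:E - c%:E)%E.
Proof.
move=> mf fc; have fi := bounded_integrable m mf fc.
have ci : m.-integrable setT (fun=> c%:E).
  by apply: finite_measure_integrable_cst.
under [in RHS]eq_integral do rewrite EFinD.
by rewrite integralD// (integral_prob_cst m) addeK.
Qed.

Lemma integral_empirical_bounded n (y : n.-tuple (borel E)) f (c : R) :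
  (0 < n)%N -> measurable_fun [set: borel E] (f : borel E -> R) ->
  (forall x, `|f x| <= c) ->
  (\int[(empirical y : M1 E R)]_x (f x)%:E =
   (n%:R^-1 * \sum_(i < n) f (tnth y i))%:E)%E.
Proof.
move=> n0 mf fc; rewrite (integral_shift _ mf fc) integral_empirical//.
- rewrite sumEFin big_split/= sumr_const card_ord -EFinM -EFinB mulrDr.
  by rewrite -(mulr_natl c) mulKf ?addrK// pnatr_eq0 -lt0n.
- by apply/measurable_EFinP; exact: measurable_funD.
- move=> x; rewrite lee_fin; have := fc x; rewrite ler_norml => /andP[]; lra.
Qed.

(** Moving every sample point by at most [r] turns a mass in [A] into a mass in
    the [r]-enlargement of [A], and changes the mean of a 1-Lipschitz function
    by at most [r]. *)
Lemma metric_perturb (dbar : M1 E R -> M1 E R -> \bar R) mu n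
    (x y : n.-tuple (borel E)) (r : R) :
  dbar = prohorov \/ dbar = fortet_mourier -> (0 < n)%N ->
  (forall i, mdist (tnth x i : E) (tnth y i) <= r) ->
  (dbar mu (empirical y) <= dbar mu (empirical x) + r%:E)%E.
Proof.
move=> dbarE n0 xy.
have nR : 0 < n%:R :> R by rewrite ltr0n.
have r0 : 0 <= r by apply: le_trans (xy (Ordinal n0)); exact: mdist_ge0.
rewrite -leeBlDr//; case: dbarE => ->.
  apply: le_ereal_inf_tmp => _ [s [s0 ssup] <-]; rewrite leeBlDr//.
  apply: ereal_inf_lbound; exists (s + r) => //; split; first by rewrite ltr_wpDr.
  apply: ge_ereal_sup => _ [A mA <-].
  apply: (@le_trans _ _ (mu A - (empirical x : M1 E R) (enlarge A s))%E).
    apply: leeB => //.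
    rewrite (empiricalE x _ n0) (empiricalE y _ n0).
    apply: lee_wpmul2l; first by rewrite lee_fin invr_ge0.
    apply: lee_sum => i _; rewrite !diracE lee_fin ler_nat.
    have [/set_mem xA|//] := boolP (tnth x i \in enlarge A s).
    by rewrite mem_set//; exact: enlarge_sub xA (xy i).
  apply: (@le_trans _ _ s%:E); last by rewrite lee_fin lerDl.
  by apply: le_trans ssup; apply: ereal_sup_ubound; exists A.
rewrite leeBlDr//; apply: ge_ereal_sup => _ [f f1 <-].
have [fb fl] := fm_test_bounds f1.
have mf := lipschitz_measurable fl.
apply: (@le_trans _ _ ((\int[mu]_a (f a)%:E -
    \int[(empirical x : M1 E R)]_a (f a)%:E) + r%:E)%E).
  rewrite !(integral_empirical_bounded _ n0 mf fb) -addeA leeD2l//.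
  rewrite -EFinN -EFinN -EFinD lee_fin.
  have : \sum_(i < n) f (tnth x i) <= \sum_(i < n) (f (tnth y i) + r).
    apply: ler_sum => i _; rewrite -lerBlDl; apply: le_trans (ler_norm _) _.
    exact: le_trans (fl _ _) (xy i).
  rewrite big_split/= sumr_const card_ord -(mulr_natl r).
  have ni0 : 0 <= n%:R^-1 :> R by rewrite invr_ge0 ltW.
  move=> /(ler_wpM2l ni0); rewrite [in leRHS]mulrDr mulKf ?gt_eqF//; lra.
by apply: leeD => //; apply: ereal_sup_ubound; exists f.
Qed.

Lemma measurable_ball (a : E) (e : R) : measurable (ball a e : set (borel E)).
Proof.
have ml : measurable_fun [set: borel E] (mdist a : borel E -> R).
  apply: lipschitz_measurable => x y; rewrite ler_norml; apply/andP; split.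
    rewrite lerNl opprB lerBlDr; apply: le_trans (metric_triangle a x y) _.
    by rewrite addrC.
  rewrite lerBlDr; apply: le_trans (metric_triangle a y x) _.
  by rewrite addrC (metric_sym y).
have := ml measurableT `]-oo, e[%classic (measurable_itv _).
rewrite setTI (_ : _ @^-1` _ = ball a e)//.
by rewrite ballEmdist; apply/seteqP; split => x; rewrite /= in_itv.
Qed.

(** On a separable space a closed set of tuples belongs to the product of the
    Borel sigma-algebras: its complement is a countable union of products of
    balls. *)
Lemma measurable_closed_tuple n (G : set (n.-tuple (borel E))) :
  separable E ->
  (forall x, ~ G x -> exists2 r : R, 0 < r &
     forall y, (forall i, mdist (tnth x i : E) (tnth y i) < r) -> ~ G y) ->
  measurable G.
Proof.
move=> [S cS dS] Gc; rewrite -[G]setCK; apply: measurableC.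
have [s sS] : exists s : nat -> E, forall x (e : R), 0 < e -> exists j, ball x e (s j).
  have near_S x (e : R) : 0 < e -> exists2 y, S y & ball x e y.
    move=> e0; have [|y [By Sy]] := dS (ball x e)° _ (open_interior _).
      by exists x; exact: nbhsx_ballx.
    by exists y => //; exact: interior_subset By.
  have /pfcard_geP[S0|[g]] := cS.
    by have [y] := near_S point 1 ltr01; rewrite S0.
  exists g => x e e0; have [y Sy By] := near_S x e e0.
  have [j _ gj] : (g @` [set: nat]) y by exact: (@surj _ _ _ _ g).
  by exists j; rewrite gj.
pose rect (k : n.-tuple nat * nat) : set (n.-tuple (borel E)) :=
  rectangle (fun i => ball (s (tnth k.1 i)) (k.2.+1%:R^-1) : set (borel E)).
pose F k := if `[< rect k `<=` ~` G >] then rect k else set0.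
have -> : ~` G = \bigcup_k F k.
  apply/seteqP; split => [x Gx|x [k _]]; last first.
    by rewrite /F; case: asboolP => // kG /kG.
  have [r r0 Hr] := Gc x Gx.
  pose N := (Num.truncn (2 / r)).
  have Nr : N.+1%:R^-1 <= r / 2 :> R.
    rewrite -[r / 2]invrK lef_pV2 ?posrE ?invr_gt0 ?divr_gt0// invf_div.
    by apply: ltW; apply: Num.Theory.truncnS_gt; rewrite num_real.
  have Ni0 : 0 < N.+1%:R^-1 :> R by rewrite invr_gt0.
  have [j Hj] := choice (fun i : 'I_n => sS (tnth x i) _ Ni0).
  exists ([tuple j i | i < n], N) => //.
  have rG : rect ([tuple j i | i < n], N) `<=` ~` G.
    move=> y Hy; apply: Hr => i.
    have := Hy i; rewrite /= tnth_mktuple ballEmdist /= => sy.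
    have := Hj i; rewrite ballEmdist /= => xs.
    apply: (le_lt_trans (metric_triangle _ (s (j i)) _)).
    apply: (lt_le_trans (ltrD xs sy)).
    apply: (le_trans (lerD Nr Nr)); lra.
  rewrite /F; case: asboolP => // _ i.
  by rewrite /= tnth_mktuple; apply: ball_sym; exact: Hj.
apply: countable_bigcupT_measurable => // k; rewrite /F; case: asboolP => // _.
by apply: measurable_rectangle => i; exact: measurable_ball.
Qed.

Lemma measurable_nbhd_event (dbar : M1 E R -> M1 E R -> \bar R)
    (C : set (M1 E R)) (e : R) n :
  separable E -> dbar = prohorov \/ dbar = fortet_mourier -> (0 < n)%N ->
  measurable [set x : n.-tuple (borel E) | closed_nbhd dbar C e%:E (empirical x)].
Proof.
move=> sepE dbarE n0; apply: measurable_closed_tuple => // x /negP.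
rewrite /closed_nbhd/= -ltNge => ex.
have [r r0 er] : exists2 r : R, 0 < r & (e%:E + r%:E < ereal_inf [set dbar mu (empirical x) | mu in C])%E.
  case: (ereal_inf _) ex => [t| |//].
    rewrite lte_fin => et; exists ((t - e) / 2); first by rewrite divr_gt0// subr_gt0.
    by rewrite -EFinD lte_fin; lra.
  by move=> _; exists 1 => //; rewrite -EFinD ltry.
exists r => // y xy; apply/negP; rewrite -ltNge.
rewrite -lteBrDr// in er.
apply: (lt_le_trans er); rewrite leeBlDr//.
rewrite -leeBlDr//; apply: le_ereal_inf_tmp => _ [mu Cmu <-]; rewrite leeBlDr//.
apply: le_trans (metric_perturb (r := r) mu (x := y) (y := x) dbarE n0 _).
  by apply: ereal_inf_lbound; exists mu.
by move=> i; rewrite metric_sym ltW.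
Qed.

Lemma nbhd_empirical_eq (dbar : M1 E R -> M1 E R -> \bar R)
    (C : set (M1 E R)) e (mu nu : M1 E R) :
  dbar = prohorov \/ dbar = fortet_mourier ->
  mu = nu :> (set (borel E) -> \bar R) ->
  closed_nbhd dbar C e mu -> closed_nbhd dbar C e nu.
Proof.
move=> dbarE munu; rewrite /closed_nbhd/=.
suff -> : (fun m => dbar m mu) = (fun m => dbar m nu) by [].
apply/funext => m; case: dbarE => ->.
  by rewrite /prohorov munu.
by rewrite /fortet_mourier munu.
Qed.

End empirical_metric.

(** * Empirical frequencies of the cells of a partition *)

Section cells.
Context {R : realType} d (T : measurableType d) (P : probability T R).

Lemma integral_count2 (B : set T) n p : measurable B -> P B = p%:E ->
  (\int[powerm P n]_x ((\sum_(a <- x) \1_B a) ^+ 2)%:E =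
   (n%:R * p + n%:R * (n%:R - 1) * p ^+ 2)%:E)%E.
Proof.
move=> mB pE; pose c (s : seq T) : R := \sum_(a <- s) \1_B a.
have c0 s : 0 <= c s by apply: sumr_ge0 => a _; rewrite indicE.
have mI : measurable_fun setT (fun a => (\1_B a : R)%:E).
  by apply/measurable_EFinP; exact: measurable_indic.
have I0 a : (0 <= (\1_B a : R)%:E)%E by rewrite lee_fin indicE.
have mc m : mseq m c.
  rewrite (_ : (fun _ => _) = (fun x : m.-tuple T => \sum_(i < m) \1_B (nth point x i))).
    apply: measurable_sum => i; apply: measurableT_comp => //.
    exact: measurable_nth.
  by apply/funext => x; rewrite /c (big_nth point) big_mkord size_tuple.
have pI : (\int[P]_a (\1_B a)%:E = p%:E)%E by rewrite integral_indic// setIT.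
have c1 m : (\int[powerm P m]_x (c x)%:E = (m%:R * p)%:E)%E.
  under eq_integral do rewrite /c -sumEFin.
  by rewrite (integral_powerm_sum P m mI I0) pI -EFinM.
have c20 s : (0 <= (c s ^+ 2)%:E)%E by rewrite lee_fin sqr_ge0.
have mc2 m : mseq m (fun s => (c s ^+ 2)%:E).
  by apply/measurable_EFinP; exact: (measurable_funX 2 (mc m)).
elim: n => [|n IH].
  by rewrite (integral_powerm0 _ c20) /c big_nil expr0n/= !mul0r addr0.
rewrite (integral_powermS _ (mc2 n.+1) c20).
set q := n%:R * p + n%:R * (n%:R - 1) * p ^+ 2 in IH *.
have q0 : 0 <= q.
  by rewrite -lee_fin -IH; apply: ge0_int => x; rewrite lee_fin sqr_ge0.
transitivity (\int[P]_a ((1 + 2 * (n%:R * p))%:E * (\1_B a)%:E + q%:E))%E.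
  apply: eq_integral => a _.
  transitivity (\int[powerm P n]_x ((\1_B a)%:E * (1%:E + 2%:E * (c x)%:E) +
      (c x ^+ 2)%:E))%E.
    apply: eq_integral => x _; rewrite /c big_cons -/(c x).
    rewrite !(=^~ EFinM, =^~ EFinD); congr EFin.
    have [->|->] : \1_B a = 0 :> R \/ \1_B a = 1 :> R; try by ring.
    by rewrite indicE; case: (a \in B); [right|left].
  have m2c : mseq n (fun x => 2%:E * (c x)%:E)%E.
    exact: (emeasurable_funM (measurable_cst _) (measurable_EFin (mc n))).
  have c2c s : (0 <= 2%:E * (c s)%:E)%E by rewrite mule_ge0// lee_fin.
  have m1c : mseq n (fun x => 1%:E + 2%:E * (c x)%:E)%E.
    exact: (emeasurable_funD (measurable_cst _) m2c).
  have c1c s : (0 <= 1%:E + 2%:E * (c s)%:E)%E by rewrite adde_ge0// lee_fin.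
  have mI1 : mseq n (fun x => (\1_B a)%:E * (1%:E + 2%:E * (c x)%:E))%E.
    exact: (emeasurable_funM (measurable_cst _) m1c).
  rewrite (ge0_intD _ mI1 (mc2 n) (fun x => mule_ge0 (I0 a) (c1c x)) c20).
  have one0 : (0 <= 1%:E :> \bar R)%E by rewrite lee_fin.
  rewrite (ge0_intZl _ m1c c1c)// (ge0_intD _ (measurable_cst _) m2c (fun=> one0) c2c).
  rewrite (ge0_intZl _ (measurable_EFin (mc n))) ?lee_fin//; last first.
    by move=> x; rewrite lee_fin.
  rewrite c1 integral_prob_cst IH; congr (_ + _)%E.
  by rewrite muleC !(=^~ EFinM, =^~ EFinD).
have p0 : 0 <= p by rewrite -lee_fin -pE.
have k0 : 0 <= 1 + 2 * (n%:R * p) by rewrite addr_ge0// !mulr_ge0.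
have mk : measurable_fun setT (fun a => (1 + 2 * (n%:R * p))%:E * (\1_B a : R)%:E)%E.
  exact: (emeasurable_funM (measurable_cst _) mI).
have mk0 a : (0 <= (1 + 2 * (n%:R * p))%:E * (\1_B a : R)%:E)%E by rewrite mule_ge0.
have q0E : (0 <= q%:E)%E by rewrite lee_fin.
rewrite (ge0_intD _ mk (measurable_cst _) mk0 (fun=> q0E)).
rewrite (ge0_intZl _ mI I0)// pI integral_prob_cst -EFinM -EFinD; congr EFin.
by rewrite /q -natr1; ring.
Qed.

Lemma variance_freq (B : set T) n p : (0 < n)%N -> measurable B -> P B = p%:E ->
  (\int[powerm P n]_x ((n%:R^-1 * (\sum_(a <- x) \1_B a) - p) ^+ 2)%:E <=
   (p / n%:R)%:E)%E.
Proof.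
move=> n0 mB pE; pose c (s : seq T) : R := \sum_(a <- s) \1_B a.
have nR : 0 < n%:R :> R by rewrite ltr0n.
have c0 s : 0 <= c s by apply: sumr_ge0 => a _; rewrite indicE.
have p0 : 0 <= p by rewrite -lee_fin -pE.
have mI : measurable_fun setT (fun a => (\1_B a : R)%:E).
  by apply/measurable_EFinP; exact: measurable_indic.
have I0 a : (0 <= (\1_B a : R)%:E)%E by rewrite lee_fin indicE.
have mc : mseq n c.
  rewrite (_ : (fun _ => _) = (fun x : n.-tuple T => \sum_(i < n) \1_B (nth point x i))).
    apply: measurable_sum => i; apply: measurableT_comp => //.
    exact: measurable_nth.
  by apply/funext => x; rewrite /c (big_nth point) big_mkord size_tuple.
have c1 : (\int[powerm P n]_x (c x)%:E = (n%:R * p)%:E)%E.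
  under eq_integral do rewrite /c -sumEFin.
  have pI : (\int[P]_a (\1_B a)%:E = p%:E)%E by rewrite integral_indic// setIT.
  by rewrite (integral_powerm_sum P n mI I0) pI -EFinM.
pose V (s : seq T) := ((n%:R^-1 * c s - p) ^+ 2)%:E.
have V0 s : (0 <= V s)%E by rewrite lee_fin sqr_ge0.
have mV : mseq n V.
  apply/measurable_EFinP; apply: measurable_funX; apply: measurable_funB => //.
  exact: measurable_funM.
have mc2 : mseq n (fun s => (c s ^+ 2)%:E).
  by apply/measurable_EFinP; exact: (measurable_funX 2 mc).
have c20 s : (0 <= (c s ^+ 2)%:E)%E by rewrite lee_fin sqr_ge0.
have k0 : 0 <= 2 * p / n%:R by rewrite divr_ge0// mulr_ge0.
have k20 : (0 <= (n%:R^-2 : R)%:E)%E by rewrite lee_fin invr_ge0 exprn_ge0.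
have mkc : mseq n (fun x => (2 * p / n%:R)%:E * (c x)%:E)%E.
  exact: (emeasurable_funM (measurable_cst _) (measurable_EFin mc)).
have kc0 s : (0 <= (2 * p / n%:R)%:E * (c s)%:E)%E by rewrite mule_ge0// lee_fin.
have mkc2 : mseq n (fun x => (n%:R^-2)%:E * (c x ^+ 2)%:E)%E.
  exact: (emeasurable_funM (measurable_cst _) mc2).
have kc20 s : (0 <= (n%:R^-2)%:E * (c s ^+ 2)%:E)%E by rewrite mule_ge0.
have : (\int[powerm P n]_x (V x + (2 * p / n%:R)%:E * (c x)%:E) =
    \int[powerm P n]_x ((n%:R^-2)%:E * (c x ^+ 2)%:E + (p ^+ 2)%:E))%E.
  apply: eq_integral => x _; rewrite !(=^~ EFinM, =^~ EFinD); congr EFin.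
  by field; rewrite gt_eqF.
have c0E s : (0 <= (c s)%:E)%E by rewrite lee_fin.
have p20 : (0 <= (p ^+ 2)%:E)%E by rewrite lee_fin sqr_ge0.
rewrite (ge0_intD _ mV mkc V0 kc0) (ge0_intZl _ (measurable_EFin mc) c0E) ?lee_fin//.
rewrite (ge0_intD _ mkc2 (measurable_cst _) kc20 (fun=> p20)).
rewrite (ge0_intZl _ mc2 c20)// c1 integral_prob_cst (integral_count2 n mB pE).
rewrite -!EFinM -EFinD.
have -> : 2 * p / n%:R * (n%:R * p) = 2 * p ^+ 2 by field; rewrite gt_eqF.
move=> H; have fin2 : ((2 * p ^+ 2)%:E : \bar R) \is a fin_num by [].
rewrite -/(V _) -[leLHS](addeK _ fin2) H -EFinB lee_fin.
rewrite (_ : _ - _ = p / n%:R - p ^+ 2 / n%:R); last by field; rewrite gt_eqF.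
by rewrite gerBl divr_ge0// sqr_ge0.
Qed.

Variables (M : nat) (l : T -> 'I_M).
Hypothesis ml : forall j, measurable (l @^-1` [set j]).

Definition freq_gap (x : seq T) (j : 'I_M) : R :=
  (size x)%:R^-1 * (\sum_(a <- x) \1_(l @^-1` [set j]) a) -
  fine (P (l @^-1` [set j])).

Let PE j : P (l @^-1` [set j]) = (fine (P (l @^-1` [set j])))%:E.
Proof. by rewrite fineK// fin_num_measure. Qed.

Lemma sum_cells : \sum_j fine (P (l @^-1` [set j])) = 1.
Proof.
apply: EFin_inj; rewrite -sumEFin.
under eq_bigr do rewrite -PE -(setIT (_ @^-1` _)) -integral_indic//.
rewrite -(@ge0_integral_sum _ _ _ P _ measurableT _
  (fun j x => (\1_(l @^-1` [set j]) x)%:E)).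
- rewrite (eq_integral (cst 1%E)); first exact: integral_prob_cst.
  move=> a _; rewrite sumEFin (bigD1 (l a))//= big1 => [|j ja].
    by rewrite addr0 indicE mem_set.
  by rewrite indicE memNset//= => /eqP; rewrite eq_sym (negbTE ja).
- by move=> j; apply/measurable_EFinP; exact: measurable_indic.
- by move=> j x _; rewrite lee_fin indicE.
Qed.

(** The frequency of a cell of probability [a] has variance at most [a / n], and
    these probabilities add up to 1: the factor [M] only comes from passing
    from the sum of squares to the square of the sum. *)
Lemma freq_gap_prob n t : (0 < n)%N -> 0 < t ->
  let S := [set x : n.-tuple T | M%:R * (\sum_j freq_gap x j ^+ 2) <= t] in
  measurable S /\ ((1 - M%:R / (n%:R * t))%:E <= powerm P n S)%E.
Proof.
move=> n0 t0 S; pose Dv (x : seq T) := \sum_j freq_gap x j ^+ 2.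
have nR : 0 < n%:R :> R by rewrite ltr0n.
pose V j (x : seq T) :=
  (n%:R^-1 * (\sum_(a <- x) \1_(l @^-1` [set j]) a) - fine (P (l @^-1` [set j]))) ^+ 2.
have DvE (x : n.-tuple T) : Dv x = \sum_j V j x.
  by apply: eq_bigr => j _; rewrite /freq_gap /V size_tuple.
have mV j : mseq n (V j).
  apply: measurable_funX; apply: measurable_funB => //; apply: measurable_funM => //.
  rewrite (_ : (fun _ => _) = (fun x : n.-tuple T =>
    \sum_(i < n) \1_(l @^-1` [set j]) (nth point x i))).
    apply: measurable_sum => i; apply: measurableT_comp => //.
    exact: measurable_nth.
  by apply/funext => x; rewrite (big_nth point) big_mkord size_tuple.
have mDv : mseq n Dv.
  rewrite (_ : (fun _ => _) = (fun x : n.-tuple T => \sum_j V j x)).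
    by apply: measurable_sum => j; exact: mV.
  by apply/funext => x; exact: DvE.
have V0 j x : 0 <= V j x by exact: sqr_ge0.
have mMD : mseq n (fun x => M%:R * Dv x) by exact: measurable_funM.
have mS : measurable S.
  have := mMD measurableT `]-oo, t]%classic (measurable_itv _); rewrite setTI.
  set S' := (X in measurable X) => mS'; suff SE : S = S' by move: mS'; rewrite -SE.
  by apply/seteqP; split => x; rewrite /S /S' /= in_itv.
split => //.
have intD : (\int[powerm P n]_x (Dv x)%:E <= (n%:R^-1)%:E)%E.
  under eq_integral do rewrite DvE -sumEFin.
  have mVE j : mseq n (fun x => (V j x)%:E) by exact: (measurable_EFin (mV j)).
  have V0E j x : (0 <= (V j x)%:E)%E by rewrite lee_fin.
  rewrite (@ge0_integral_sum _ _ _ _ _ measurableT _ _ mVE (fun j x _ => V0E j x)).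
  apply: (@le_trans _ _ (\sum_j (fine (P (l @^-1` [set j])) / n%:R)%:E)%E).
    by apply: lee_sum => j _; exact: (variance_freq n0 (ml j) (PE j)).
  by rewrite sumEFin -mulr_suml sum_cells mul1r.
have mD0 x : 0 <= Dv x by apply: sumr_ge0 => j _; exact: sqr_ge0.
have markov : (t%:E * powerm P n (~` S) <= (M%:R / n%:R)%:E)%E.
  apply: (@le_trans _ _ (M%:R%:E * \int[powerm P n]_x (Dv x)%:E)%E); last first.
    by rewrite EFinM lee_wpmul2l// lee_fin.
  rewrite -(setIT (~` S)) -integral_indic//; last exact: measurableC.
  have mSC : measurable_fun setT (fun x => (\1_(~` S) x : R)%:E).
    by apply/measurable_EFinP; apply: measurable_indic; exact: measurableC.
  have SC0 x : (0 <= (\1_(~` S) x : R)%:E)%E by rewrite lee_fin indicE.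
  have DE0 x : (0 <= (Dv x)%:E)%E by rewrite lee_fin.
  rewrite -(ge0_intZl _ mSC SC0) ?lee_fin ?(ltW t0)//.
  rewrite -(ge0_intZl _ (measurable_EFin mDv) DE0) ?lee_fin//.
  apply: ge0_int_le.
  - exact: (emeasurable_funM (measurable_cst _) mSC).
  - exact: (emeasurable_funM (measurable_cst _) (measurable_EFin mDv)).
  - by move=> x; rewrite mule_ge0 ?lee_fin ?(ltW t0).
  move=> x; rewrite -!EFinM lee_fin indicE.
  have [/set_mem /= /negP|_] := boolP (x \in ~` S).
    by rewrite -ltNge mulr1 => /ltW.
  by rewrite mulr0 mulr_ge0.
have Sfin : powerm P n S \is a fin_num by exact: fin_num_measure.
move: markov; rewrite probability_setC// -(fineK Sfin) -EFinB -EFinM !lee_fin.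
rewrite invfM mulrA => markov; rewrite lerBlDr -lerBlDl ler_pdivlMr//.
by rewrite mulrC.
Qed.

Lemma sum_freq_gap_le (x : seq T) t : 0 < t ->
  M%:R * (\sum_j freq_gap x j ^+ 2) <= t ^+ 2 -> \sum_j `|freq_gap x j| <= t.
Proof.
move=> t0 Mt; have [M0|M0] := posnP M.
  rewrite big1 ?ltW// => j _; exfalso; have := ltn_ord j.
  by rewrite [X in (_ < X)%N]M0.
have MR : 0 < M%:R :> R by rewrite ltr0n.
have s0 : 0 < t / M%:R by rewrite divr_gt0.
apply: (@le_trans _ _ (\sum_j (freq_gap x j ^+ 2 / (2 * (t / M%:R)) + t / M%:R / 2))).
  apply: ler_sum => j _; set D := freq_gap x j; set s := t / M%:R in s0 *.
  have sE : `|D| ^+ 2 = D ^+ 2 by rewrite real_normK ?num_real.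
  have s20 : 0 < 2 * s by rewrite mulr_gt0.
  rewrite -sE -(ler_pM2r s20) [leRHS]mulrDl divfK ?gt_eqF//.
  have := sqr_ge0 (`|D| - s); lra.
rewrite big_split/= sumr_const card_ord -(mulr_natl (t / M%:R / 2) M).
set S := \sum_j freq_gap x j ^+ 2 in Mt *.
have -> : \sum_j freq_gap x j ^+ 2 / (2 * (t / M%:R)) = (M%:R * S) / (2 * t).
  by rewrite -mulr_suml -/S; field; rewrite !gt_eqF.
have -> : M%:R * (t / M%:R / 2) = t ^+ 2 / (2 * t) by field; rewrite !gt_eqF.
rewrite -mulrDl ler_pdivrMr ?mulr_gt0//; lra.
Qed.

Lemma integral_cells (v : 'I_M -> R) n (x : n.-tuple T) t c : (0 < n)%N ->
  (forall j, 0 <= v j <= c) -> \sum_j `|freq_gap x j| <= t -> 0 <= c ->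
  (\int[P]_a (v (l a))%:E <= (n%:R^-1 * \sum_(i < n) v (l (tnth x i)) + c * t)%:E)%E.
Proof.
move=> n0 vc xt c0.
have nR : 0 < n%:R :> R by rewrite ltr0n.
have vE a : v (l a) = \sum_j v j * \1_(l @^-1` [set j]) a.
  rewrite (bigD1 (l a))//= big1 => [|j ja].
    by rewrite addr0 indicE mem_set// mulr1.
  by rewrite indicE memNset ?mulr0//= => /eqP; rewrite eq_sym (negbTE ja).
under eq_integral do rewrite vE -sumEFin.
have mI j : measurable_fun setT (fun a => (\1_(l @^-1` [set j]) a : R)%:E).
  by apply/measurable_EFinP; exact: measurable_indic.
have I0 j a : (0 <= (\1_(l @^-1` [set j]) a : R)%:E)%E by rewrite lee_fin indicE.
have v0 j : (0 <= (v j)%:E)%E by rewrite lee_fin; case/andP: (vc j).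
rewrite (eq_integral (fun a => \sum_j (v j)%:E * (\1_(l @^-1` [set j]) a)%:E)%E); last first.
  by move=> a _; apply: eq_bigr => j _; rewrite EFinM.
rewrite ge0_integral_sum//; last 2 first.
- by move=> j; exact: (emeasurable_funM (measurable_cst _) (mI j)).
- by move=> j a _; exact: mule_ge0.
rewrite (eq_bigr (fun j => (v j * fine (P (l @^-1` [set j])))%:E)); last first.
  by move=> j _; rewrite (ge0_intZl _ (mI j))// integral_indic// setIT EFinM -PE.
rewrite sumEFin lee_fin.
have -> : n%:R^-1 * \sum_(i < n) v (l (tnth x i)) =
    \sum_j v j * (n%:R^-1 * \sum_(a <- x) \1_(l @^-1` [set j]) a).
  under eq_bigr do rewrite vE.
  rewrite exchange_big/= mulr_sumr; apply: eq_bigr => j _.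
  rewrite -mulr_sumr mulrCA; congr (_ * (_ * _)).
  by rewrite big_tuple.
rewrite -lerBlDl -sumrB; apply: (@le_trans _ _ (\sum_j c * `|freq_gap x j|)); last first.
  by rewrite -mulr_sumr ler_wpM2l.
apply: ler_sum => j _; have /andP[vj0 vjc] := vc j.
rewrite -mulrBr -opprB; apply: le_trans (ler_norm _) _.
rewrite normrM normrN (ger0_norm vj0) /freq_gap size_tuple.
by rewrite ler_wpM2r.
Qed.

End cells.

Section cover.
Context {R : realType} {E : completeMetricType R}.
Variables (N : nat) (c : N.-tuple E) (r : R).

(** The first ball containing [a]; the last index [N] collects the points
    outside all the balls. *)
Definition cell (a : borel E) : 'I_N.+1 :=
  inord (find (fun z : E => (mdist z a < r)%R) c).

Let find_le (a : borel E) : (find (fun z : E => (mdist z a < r)%R) c < N.+1)%N.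
Proof. by rewrite ltnS -[X in (_ <= X)%N](size_tuple c) find_size. Qed.

Let cellE a : cell a = find (fun z : E => (mdist z a < r)%R) c :> nat.
Proof. by rewrite inordK. Qed.

Lemma measurable_cell j : measurable (cell @^-1` [set j]).
Proof.
have mfind (s : seq E) k :
    measurable [set a : borel E | find (fun z : E => (mdist z a < r)%R) s = k].
  elim: s k => [|z s IH] [|k] /=.
  - by rewrite (_ : [set _ | _] = setT)//; apply/seteqP; split.
  - by rewrite (_ : [set _ | _] = set0)//; apply/seteqP; split.
  - rewrite (_ : [set _ | _] = ball z r); first exact: measurable_ball.
    by rewrite ballEmdist; apply/seteqP; split => a /=; case: ifP.
  - rewrite (_ : [set _ | _] = ~` ball z r `&`
      [set a : borel E | find (fun z : E => (mdist z a < r)%R) s = k]).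
      by apply: measurableI => //; apply: measurableC; exact: measurable_ball.
    rewrite ballEmdist; apply/seteqP; split => a /=.
      by case: ifPn => // zr [<-]; split => //; apply/negP.
    by case => /negP/negbTE -> ->.
have := mfind c j; congr measurable; apply/seteqP; split => a /=.
  by move=> H; apply/val_inj; rewrite /= cellE.
by move=> <-; rewrite cellE.
Qed.

Lemma cell_near a : (cell a < N)%N -> mdist (nth point c (cell a)) a < r.
Proof.
rewrite cellE => aN; apply: (@nth_find _ _ (fun z : E => (mdist z a < r)%R)).
by rewrite has_find size_tuple.
Qed.

Lemma cell_out (K : set E) (a : borel E) :
  K `<=` \bigcup_(i in [set: 'I_N]) ball (tnth c i) r -> K a -> (cell a < N)%N.
Proof.
move=> Kc /Kc[i _]; rewrite ballEmdist /= => ia; rewrite cellE.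
rewrite -[X in (_ < X)%N](size_tuple c) -has_find; apply/hasP.
by exists (tnth c i) => //; exact: mem_tnth.
Qed.

End cover.

(** A cover of [K] by small balls gives a finite partition; if the empirical
    frequencies of its cells are close to their probabilities, the empirical
    measure is close to the law, up to the mass outside [K]. *)
Section cover_close.
Context {R : realType} {E : completeMetricType R}.
Variables (P : M1 E R) (K : set (borel E)) (N : nat) (c : N.-tuple E).
Variables (eta kap : R).
Hypothesis eta0 : 0 < eta.
Hypothesis mK : measurable K.
Hypothesis PK : P (~` K) = kap%:E.
Hypothesis cover : K `<=` \bigcup_(i in [set: 'I_N]) ball (tnth c i) (eta / 8).
Local Notation cell := (cell c (eta / 8)).

Let rho := eta + 2 * kap.

Let kap0 : 0 <= kap. Proof. by rewrite -lee_fin -PK. Qed.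

Let intK : (\int[P]_a (\1_(~` K) a)%:E = kap%:E)%E.
Proof. by rewrite integral_indic ?setIT//; exact: measurableC. Qed.

Let mIK : measurable_fun setT (fun a => (\1_(~` K) a : R)%:E).
Proof. by apply/measurable_EFinP; apply: measurable_indic; exact: measurableC. Qed.

Let IK0 a : (0 <= (\1_(~` K) a : R)%:E)%E.
Proof. by rewrite lee_fin indicE. Qed.

Let out_cell (a : borel E) : ~~ (cell a < N)%N -> \1_(~` K) a = 1 :> R.
Proof.
move=> aN; rewrite indicE mem_set// => Ka.
by move/negP: aN; apply; exact: (cell_out cover).
Qed.

Let measurable_cell_fun (v : 'I_N.+1 -> R) :
  measurable_fun [set: borel E] (fun a : borel E => v (cell a)).
Proof.
rewrite (_ : (fun _ => _) =
    (fun a => \sum_j v j * \1_(cell @^-1` [set j]) a)).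
  apply: measurable_sum => j; apply: measurable_funM => //.
  by apply: measurable_indic; exact: measurable_cell.
apply/funext => a; rewrite (bigD1 (cell a))//= big1 => [|j ja].
  by rewrite addr0 indicE mem_set// mulr1.
by rewrite indicE memNset ?mulr0//= => /eqP; rewrite eq_sym (negbTE ja).
Qed.

Lemma prohorov_cells n (x : n.-tuple (borel E)) : (0 < n)%N ->
  \sum_j `|freq_gap P cell x j| <= eta / 4 ->
  (prohorov P (empirical x) <= rho%:E)%E.
Proof.
move=> n0 xgap; have rho0 : 0 < rho by rewrite ltr_pwDl// mulr_ge0.
apply: ereal_inf_lbound; exists rho => //; split => //.
apply: ge_ereal_sup => _ [A mA <-].
pose v (j : 'I_N.+1) : R := `[< (j < N)%N /\ exists2 a, A a & cell a = j >]%:R.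
have v01 j : 0 <= v j <= 1 by rewrite /v ler0n lern1 leq_b1.
have mv := measurable_EFin (measurable_cell_fun v).
have v0 a : (0 <= (v (cell a))%:E)%E by rewrite lee_fin; case/andP: (v01 (cell a)).
have PA : (P A <= \int[P]_a (v (cell a))%:E + kap%:E)%E.
  rewrite -intK -(ge0_intD _ mv mIK v0 IK0) -(setIT A) -integral_indic//.
  apply: ge0_int_le.
  - by apply/measurable_EFinP; exact: measurable_indic.
  - exact: (emeasurable_funD mv mIK).
  - by move=> a; rewrite lee_fin indicE.
  move=> a; rewrite -EFinD lee_fin indicE.
  have /andP[va0 _] := v01 (cell a).
  have [/set_mem Aa|_] := boolP (a \in A); last first.
    by rewrite addr_ge0// -lee_fin.
  have [aN|aN] := boolP (cell a < N)%N; last by rewrite (out_cell aN) lerDr.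
  rewrite (_ : v (cell a) = 1) ?lerDl -?lee_fin//.
  by rewrite /v asboolT//; split => //; exists a.
have Lx : ((n%:R^-1 * \sum_(i < n) v (cell (tnth x i)))%:E
    <= (empirical x : M1 E R) (enlarge A rho))%E.
  rewrite (empiricalE x _ n0) EFinM -sumEFin.
  apply: lee_wpmul2l; first by rewrite lee_fin invr_ge0.
  apply: lee_sum => i _; rewrite diracE lee_fin ler_nat.
  rewrite /v; case: asboolP => // -[xN [a Aa xa]].
  rewrite mem_set// /enlarge/=; apply: (@le_trans _ _ (mdist (tnth x i : E) a)%:E).
    by apply: ereal_inf_lbound; exists a.
  rewrite lee_fin; have xr := cell_near xN.
  have ar : mdist (nth point c (cell (tnth x i))) a < eta / 8.
    by rewrite -xa; apply: cell_near; rewrite xa.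
  apply: (le_trans (metric_triangle _ (nth point c (cell (tnth x i))) _)).
  rewrite metric_sym; apply: (le_trans (lerD (ltW xr) (ltW ar))).
  by have := kap0; have := eta0; rewrite /rho; lra.
have Lfin : (empirical x : M1 E R) (enlarge A rho) \is a fin_num.
  have LE := empiricalE x (enlarge A rho) n0; rewrite LE.
  rewrite fin_numM// sum_fin_num; apply/allP => z /mapP[i _ ->].
  by rewrite diracE.
rewrite leeBlDr//; apply: (le_trans PA).
have := integral_cells (measurable_cell c (eta / 8)) n0 v01 xgap ler01.
move=> /(fun H => leeD H (lexx kap%:E)) => /le_trans; apply.
rewrite mul1r EFinD -addeA addeC; apply: leeD => //.
by rewrite -EFinD lee_fin /rho; have := kap0; have := eta0; lra.
Qed.

Lemma fortet_mourier_cells n (x : n.-tuple (borel E)) : (0 < n)%N ->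
  \sum_j `|freq_gap P cell x j| <= eta / 4 ->
  (fortet_mourier P (empirical x) <= rho%:E)%E.
Proof.
move=> n0 xgap; apply: ge_ereal_sup => _ [f f1 <-].
have [fb fl] := fm_test_bounds f1; have mf := lipschitz_measurable fl.
pose h (a : borel E) := f a + 1.
have h02 a : 0 <= h a <= 2.
  by have := fb a; rewrite ler_norml => /andP[]; rewrite /h; lra.
have mh : measurable_fun [set: borel E] h by exact: measurable_funD.
pose v (j : 'I_N.+1) := if (j < N)%N then h (nth point c j) else 0.
have v02 j : 0 <= v j <= 2 by rewrite /v; case: ifP => // _; rewrite lexx ler0n.
have mv := measurable_EFin (measurable_cell_fun v).
have v0 a : (0 <= (v (cell a))%:E)%E by rewrite lee_fin; case/andP: (v02 (cell a)).
have near_v a : (cell a < N)%N -> `|h a - v (cell a)| <= eta / 8.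
  move=> aN; rewrite /v aN /h opprD addrACA subrr addr0.
  apply: (le_trans (fl _ _)); rewrite metric_sym ltW//; exact: cell_near.
have hv a : h a <= v (cell a) + (eta / 8 + 2 * \1_(~` K) a).
  have I0 : 0 <= \1_(~` K) a :> R by rewrite indicE.
  have [aN|aN] := boolP (cell a < N)%N.
    have := near_v a aN; rewrite ler_norml => /andP[_]; lra.
  have /andP[va0 _] := v02 (cell a); rewrite (out_cell aN).
  by have /andP[_ ha2] := h02 a; have := eta0; lra.
have vh a : v (cell a) <= h a + eta / 8.
  have [aN|aN] := boolP (cell a < N)%N.
    have := near_v a aN; rewrite ler_norml => /andP[+ _]; lra.
  have /andP[ha0 _] := h02 a; rewrite /v (negbTE aN).
  by rewrite addr_ge0// divr_ge0// ltW.
rewrite (integral_empirical_bounded _ n0 mf fb) (integral_shift _ mf fb).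
have e80 : (0 <= (eta / 8)%:E :> \bar R)%E by rewrite lee_fin divr_ge0// ltW.
have mIK2 : measurable_fun [set: borel E] (fun a => 2%:E * (\1_(~` K) a : R)%:E)%E.
  exact: (emeasurable_funM (measurable_cst _) mIK).
have IK20 a : (0 <= 2%:E * (\1_(~` K) a : R)%:E)%E by rewrite mule_ge0.
have mrest : measurable_fun [set: borel E]
    (fun a => (eta / 8)%:E + 2%:E * (\1_(~` K) a : R)%:E)%E.
  exact: (emeasurable_funD (measurable_cst _) mIK2).
have rest0 a : (0 <= (eta / 8)%:E + 2%:E * (\1_(~` K) a : R)%:E)%E by rewrite adde_ge0.
have Ph : (\int[P]_a (h a)%:E <=
    \int[P]_a (v (cell a))%:E + (eta / 8 + 2 * kap)%:E)%E.
  rewrite EFinD (EFinM 2 kap) -intK -(ge0_intZl _ mIK IK0) ?lee_fin//.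
  rewrite -[X in (_ <= _ + (X + _))%E](integral_prob_cst P).
  rewrite -(ge0_intD _ (measurable_cst _) mIK2 (fun=> e80) IK20).
  rewrite -(ge0_intD _ mv mrest v0 rest0); apply: ge0_int_le.
  - exact: (measurable_EFin mh).
  - exact: (emeasurable_funD mv mrest).
  - by move=> a; rewrite lee_fin; case/andP: (h02 a).
  by move=> a; rewrite !(=^~ EFinM, =^~ EFinD) lee_fin; exact: hv.
have := integral_cells (measurable_cell c (eta / 8)) n0 v02 xgap (ler0n _ 2).
move=> /(fun H => le_trans Ph (leeD H (lexx _))).
rewrite -EFinD => H.
rewrite leeBlDr// leeBlDr//; apply: (le_trans H); rewrite -!EFinD lee_fin.
have : n%:R^-1 * \sum_(i < n) v (cell (tnth x i)) <=
    n%:R^-1 * \sum_(i < n) f (tnth x i) + 1 + eta / 8.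
  have nR : 0 < n%:R :> R by rewrite ltr0n.
  apply: (@le_trans _ _ (n%:R^-1 * \sum_(i < n) (f (tnth x i) + (1 + eta / 8)))).
    rewrite ler_pM2l ?invr_gt0//; apply: ler_sum => i _.
    by apply: (le_trans (vh _)); rewrite /h addrA.
  rewrite big_split/= sumr_const card_ord -(mulr_natl (1 + eta / 8) n) mulrDr.
  by rewrite mulKf ?gt_eqF// addrA.
by have := kap0; have := eta0; rewrite /rho; lra.
Qed.

(** Chebyshev's inequality is strong enough, as the bound only has to be small
    when the number of cells is negligible with respect to [n * eta ^+ 2]. *)
Lemma nbhd_event_prob (dbar : M1 E R -> M1 E R -> \bar R) (C : set (M1 E R)) n :
  separable E -> dbar = prohorov \/ dbar = fortet_mourier -> (0 < n)%N -> C P ->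
  ((1 - 16 * N.+1%:R / (n%:R * eta ^+ 2))%:E <=
   powerm P n [set x : n.-tuple (borel E) |
     closed_nbhd dbar C rho%:E (empirical x)])%E.
Proof.
move=> sepE dbarE n0 CP.
have e40 : 0 < eta / 4 by rewrite divr_gt0.
have t0 : 0 < (eta / 4) ^+ 2 by rewrite exprn_gt0.
have [mS PS] := freq_gap_prob P (measurable_cell c (eta / 8)) n0 t0.
have -> : 16 * N.+1%:R / (n%:R * eta ^+ 2) = N.+1%:R / (n%:R * (eta / 4) ^+ 2).
  by field; rewrite !gt_eqF// ltr0n.
apply: (le_trans PS); apply: le_measure.
- by rewrite inE.
- by rewrite inE; exact: measurable_nbhd_event.
move=> x /= Sx; rewrite /closed_nbhd/=.
have xgap := sum_freq_gap_le e40 Sx.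
apply: (@le_trans _ _ (dbar P (empirical x))).
  by apply: ereal_inf_lbound; exists P.
by case: dbarE => ->; [exact: prohorov_cells|exact: fortet_mourier_cells].
Qed.

End cover_close.

(** * Closed convex sets are determined by their test functions *)

Section initial_cvg.

Lemma initial_cvg {S : choiceType} {T : topologicalType} (f : S -> T)
    (F : set_system S) (s : S) : Filter F ->
  f @ F --> f s -> F --> (s : initial_topology f).
Proof.
move=> FF Ff A /=; rewrite nbhsE => -[B [[B' B'o <-] B's] BA].
apply: (filterS BA); apply: (Ff B'); exact: open_nbhs_nbhs.
Qed.

Lemma ptws_cvg {X : Type} {V : topologicalType} (F : set_system (X -> V))
    (g : X -> V) : Filter F ->
  (forall x, h x @[h --> F] --> g x) -> F --> (g : {ptws X -> V}).
Proof.
move=> FF Fg; apply/cvg_sup => x.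
by apply: (@initial_cvg _ _ (fun h : X -> V => h x)).
Qed.

End initial_cvg.

Section test_separation.
Context {R : realType} {E : completeMetricType R}.
Implicit Types (mu nu : M1 E R) (h : E -> R).

Lemma bounded_funP h : bounded_fun h -> exists2 c : R, 0 < c & forall x, `|h x| <= c.
Proof.
move=> [c [_ Hc]]; exists (`|c| + 1); first by rewrite ltr_pwDr.
by move=> x; apply: Hc => //; rewrite ltr_pwDr// ler_norm.
Qed.

Lemma Rint_EFin mu h c : continuous h -> (forall x, `|h x| <= c) ->
  (\int[mu]_x (h x)%:E = (\int[mu]_x h x)%:E)%E.
Proof.
move=> ch hc; rewrite /Rintegral fineK//.
exact: (integrable_fin_num measurableT
  (bounded_integrable mu (continuous_borel_measurable ch) hc)).
Qed.

Lemma ex_mixture mu nu (t : R) : 0 <= t <= 1 ->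
  exists2 rho : M1 E R, (forall A, measurable A ->
      rho A = t%:E * mu A + (1 - t)%:E * nu A)%E &
    forall h c, continuous h -> (forall x, `|h x| <= c) ->
      \int[rho]_x h x = t * \int[mu]_x h x + (1 - t) * \int[nu]_x h x.
Proof.
move=> /andP[t0 t1]; have t10 : 0 <= 1 - t by rewrite subr_ge0.
pose m : {measure set (borel E) -> \bar R} :=
  measure_add (mscale (NngNum t0) mu) (mscale (NngNum t10) nu).
have mE (A : set (borel E)) : (m A = t%:E * mu A + (1 - t)%:E * nu A)%E by exact: measure_addE.
have mT : m setT = 1%E.
  apply: (etrans (mE setT)).
  transitivity (t%:E * 1 + (1 - t)%:E * 1)%E.
    by congr (_ * _ + _ * _)%E; exact: probability_setT.
  by rewrite !mule1 -EFinD addrC subrK.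
pose rho : M1 E R := HB.pack (Measure.sort m) (Measure_isProbability.Build _ _ _ m mT).
exists rho => [A _|h c ch hc]; first exact: mE.
have mh := continuous_borel_measurable ch.
have mhc : measurable_fun [set: borel E] (fun x : borel E => (h x + c)%:E).
  by apply/measurable_EFinP; exact: measurable_funD.
have hc0 (x : borel E) : (0 <= (h x + c)%:E)%E.
  by rewrite lee_fin -lerBlDr sub0r; have := hc x; rewrite ler_norml => /andP[].
have int_rho : (\int[rho]_x (h x + c)%:E =
    t%:E * \int[mu]_x (h x + c)%:E + (1 - t)%:E * \int[nu]_x (h x + c)%:E)%E.
  rewrite (eq_measure_integral m)//.
  by rewrite ge0_integral_measure_add//= !ge0_integral_mscale.
apply: EFin_inj; rewrite EFinD !EFinM -!(Rint_EFin _ ch hc).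
have shift (q : M1 E R) : (\int[q]_x (h x + c)%:E = (\int[q]_x h x + c)%:E)%E.
  by rewrite EFinD -(Rint_EFin _ ch hc) (integral_shift q mh hc) subeK.
rewrite (integral_shift rho mh hc) int_rho !shift !(Rint_EFin _ ch hc).
by rewrite !(=^~ EFinM, =^~ EFinD); congr EFin; ring.
Qed.

End test_separation.

Section narrow_separation.
Context {R : realType} {E : completeMetricType R}.
Implicit Types mu nu : M1 E R.
Local Notation CB := (@cont_bounded R E).

(** The sets of elements of [C] whose integrals agree with those of [nu] up to [e]
    on a finite list of functions form a filter basis, which converges to [nu]. *)
Lemma narrow_closed_approx (C : set (M1 E R)) nu : narrow_closed C ->
  (forall (s : seq CB) (e : R), 0 < e -> exists2 mu, C mu &
    all (fun h => `|narrow_eval nu h - narrow_eval mu h| < e) s) ->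
  C nu.
Proof.
move=> cC appr.
pose D : set (seq CB * R) := [set p | 0 < p.2].
pose B (p : seq CB * R) : set (M1 E R) := [set mu | C mu /\
  all (fun h => `|narrow_eval nu h - narrow_eval mu h| < p.2) p.1].
have FF : ProperFilter (filter_from D B).
  apply: filter_from_proper; last first.
    by move=> [s e] /= e0; have [mu Cmu mus] := appr s e e0; exists mu.
  apply: filter_from_filter; first by exists ([::], 1); rewrite /D /=.
  move=> [s e] [s' e'] /= e0 e'0; exists (s ++ s', Num.min e e').
    by rewrite /D /= lt_min e0.
  move=> mu [Cmu]; rewrite all_cat => /andP[/= ms ms']; split; split => //=.
    by apply: sub_all ms => h; rewrite lt_min => /andP[].
  by apply: sub_all ms' => h; rewrite lt_min => /andP[].
apply: (@closed_cvg _ (initial_topology (@narrow_eval R E)) _ FF id C cC).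
  by exists ([::], 1) => [|mu []]; rewrite /D /=.
apply: (@initial_cvg _ _ (@narrow_eval R E) _ nu).
apply: ptws_cvg => h; apply/cvgrPdist_lt => e e0.
exists ([:: h], e) => //= mu [_ /=]; by rewrite andbT.
Qed.

Lemma ex_combination (s : seq CB) (w : CB -> R) : exists g c,
  [/\ continuous g, forall x, `|g x| <= c &
    forall mu, \int[mu]_x g x = \sum_(h <- s) w h * narrow_eval mu h].
Proof.
elim: s => [|h s [g [c [cg gc gE]]]].
  exists (fun=> 0), 0; split.
  - by move=> x; exact: cst_continuous.
  - by move=> x; rewrite normr0.
  - by move=> mu; rewrite big_nil Rintegral_cst// mul0r.
have [ch /bounded_funP[b b0 hb]] := svalP h.
exists (fun x => w h * sval h x + g x), (`|w h| * b + c); split.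
- by move=> x; apply: cvgD; [apply: cvgM; [exact: cvg_cst|exact: ch]|exact: cg].
- move=> x; apply: (le_trans (ler_normD _ _)); rewrite lerD// normrM.
  by rewrite ler_wpM2l.
- move=> mu; rewrite big_cons -gE.
  have hi := bounded_integrable mu (continuous_borel_measurable ch) hb.
  rewrite RintegralD//; first by rewrite RintegralZl.
  + exact: (integrableZl measurableT (w h) hi).
  + exact: (bounded_integrable mu (continuous_borel_measurable cg) gc).
Qed.

Lemma narrow_eval_bounded (s : seq CB) : exists2 b : R, 0 <= b &
  forall mu nu, \sum_(h <- s) (narrow_eval mu h - narrow_eval nu h) ^+ 2 <= b.
Proof.
elim: s => [|h s [b b0 sb]].
  by exists 0 => // mu nu; rewrite big_nil.
have [ch /bounded_funP[c c0 hc]] := svalP h.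
exists ((c + c) ^+ 2 + b) => [|mu nu]; first by rewrite addr_ge0// sqr_ge0.
rewrite big_cons lerD// -real_normK ?num_real// ler_pXn2r ?nnegrE//; last first.
  by rewrite addr_ge0// ltW.
have ic (m : M1 E R) : `|narrow_eval m h| <= c.
  rewrite -lee_fin EFin_normr_Rintegral//; last first.
    exact: (bounded_integrable m (continuous_borel_measurable ch) hc).
  apply: (le_trans (le_abse_integral m measurableT _)).
    by apply/measurable_EFinP; exact: (continuous_borel_measurable ch).
  rewrite -(integral_prob_cst m c%:E).
  apply: (ge0_int_le m _ (measurable_cst _)) => [||x].
  - by apply/measurable_EFinP/measurableT_comp => //;
      exact: (continuous_borel_measurable ch).
  - by move=> x; exact: abse_ge0.
  - by rewrite lee_fin.
by rewrite (le_trans (ler_normB _ _))// lerD.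
Qed.

Lemma not_all_sum_sqr (T : Type) (s : seq T) (a : T -> R) (e : R) :
  0 < e -> ~~ all (fun h => `|a h| < e) s ->
  e ^+ 2 <= \sum_(h <- s) a h ^+ 2.
Proof.
move=> e0; elim: s => //= h s IH; rewrite negb_and big_cons => /orP[|/IH es].
  rewrite -leNgt => he; rewrite ler_wpDr//.
    by apply: sumr_ge0 => i _; exact: sqr_ge0.
  by rewrite -(real_normK (num_real (a h))) ler_pXn2r ?nnegrE// ltW.
by rewrite ler_wpDl// sqr_ge0.
Qed.

(** A narrowly closed convex set is separated from a point outside by one
    bounded continuous function: finitely many such functions already keep the
    set away from the point, and the finite-dimensional projection argument
    applies to their integrals. *)
Lemma convex_separation (C : set (M1 E R)) nu :
  narrow_closed C -> convex_measures C -> C !=set0 -> ~ C nu ->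
  exists h c e, [/\ continuous h, forall x, `|h x| <= c, 0 < e &
    forall mu, C mu -> \int[nu]_x h x + e <= \int[mu]_x h x].
Proof.
move=> cC vC [mu1 Cmu1] nC.
have [s [e [e0 far]]] : exists (s : seq CB) (e : R), 0 < e /\ forall mu, C mu ->
    ~~ all (fun h => `|narrow_eval nu h - narrow_eval mu h| < e) s.
  apply: contrapT => no; apply: nC; apply: narrow_closed_approx => // s e e0.
  apply: contrapT => nomu; apply: no; exists s, e; split => // mu Cmu.
  by apply/negP => smu; apply: nomu; exists mu.
pose a mu (h : CB) := narrow_eval mu h - narrow_eval nu h.
pose q mu := \sum_(h <- s) a mu h ^+ 2.
have qe mu : C mu -> e ^+ 2 <= q mu.
  move=> /far smu; have := not_all_sum_sqr e0 smu.
  by under eq_bigr do rewrite -sqrrN opprB.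
pose d := inf [set q mu | mu in C].
have hq : has_inf [set q mu | mu in C].
  by split; [exists (q mu1), mu1|exists (e ^+ 2) => _ [mu Cmu <-]; exact: qe].
have dq mu : C mu -> d <= q mu by move=> Cmu; apply: (ge_inf (proj2 hq)); exists mu.
have d0 : 0 < d.
  apply: (@lt_le_trans _ _ (e ^+ 2)); first by rewrite exprn_gt0.
  by apply: lb_le_inf; [case: hq|move=> _ [mu Cmu <-]; exact: qe].
have [b b0 hb] := narrow_eval_bounded s.
(* Moving from a near-minimiser [mu0] of [q] by a fraction [t] towards [mu] cannot
   bring [q] below [d]; this [t] makes the quadratic term at most [d / 2]. *)
pose t := d / (2 * (b + d)).
have bd0 : 0 < b + d by rewrite ltr_wpDl.
have t0 : 0 < t by rewrite divr_gt0// mulr_gt0.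
have tb : t * b <= d / 2.
  rewrite /t mulrAC ler_pdivrMr ?mulr_gt0//.
  by have : 0 < d * d; [rewrite mulr_gt0|lra].
have t1 : t <= 1.
  by rewrite ler_pdivrMr ?mulr_gt0// mul1r; lra.
have [_ [mu0 Cmu0 <-] q0] : exists2 z, [set q mu | mu in C] z & z < d + t * d / 2.
  by apply: inf_adherent => //; rewrite divr_gt0// mulr_gt0.
have [g [c [cg gc gE]]] := ex_combination s (a mu0).
exists g, c, (d / 2); split => //; first by rewrite divr_gt0.
move=> mu Cmu; rewrite addrC -lerBrDr !gE -sumrB.
under eq_bigr do rewrite -mulrBr -/(a mu _).
have t01 : 0 <= t <= 1 by rewrite t1 ltW.
have [rho rhoE rhoI] := ex_mixture mu mu0 t01.
have := dq rho (vC _ _ _ _ Cmu Cmu0 t01 rhoE).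
set p := \sum_(h <- s) a mu0 h * a mu h.
have -> : q rho = q mu0 + (t *+ 2) * (p - q mu0)
    + t ^+ 2 * \sum_(h <- s) (narrow_eval mu h - narrow_eval mu0 h) ^+ 2.
  rewrite /q /p -sumrB !mulr_sumr -!big_split /=; apply: eq_bigr => h _.
  rewrite /a; have [ch /bounded_funP[b' _ hb']] := svalP h.
  rewrite {1}/narrow_eval (rhoI _ _ ch hb') -!/(narrow_eval _ h).
  by ring.
have := hb mu mu0; set r := \sum_(h <- s) _ => rb; rewrite mulr2n => dle.
have tr : t * r <= d / 2 by apply: le_trans tb; rewrite ler_wpM2l// ltW.
have : t * (2 * (q mu0 - p)) <= t * (d / 2 + t * r) by lra.
by rewrite ler_pM2l//; have := dq mu0 Cmu0; lra.
Qed.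

End narrow_separation.

Section lipschitz_approximation.
Context {R : realType} {E : completeMetricType R}.
Implicit Types (mu nu : M1 E R) (h : E -> R).

(** The sup-convolution of [h]: the least [k]-Lipschitz function above [h],
    decreasing to [h] pointwise as [k] grows when [h] is continuous and
    bounded. *)
Definition lip_hull h (k : R) (x : E) : R :=
  sup [set h y - k * mdist x y | y in setT].

Section bounded.
Variables (h : E -> R) (c k : R).
Hypotheses (hc : forall x, `|h x| <= c) (k0 : 0 <= k).

Lemma lip_hull_term x y : h y - k * mdist x y <= lip_hull h k x.
Proof.
apply: ub_le_sup; last by exists y.
exists c => _ [z _ <-].
have := hc z; rewrite ler_norml => /andP[_ hz].
by rewrite lerBlDr (le_trans hz)// lerDl mulr_ge0// mdist_ge0.
Qed.

Lemma lip_hull_le x b : (forall y, h y - k * mdist x y <= b) -> lip_hull h k x <= b.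
Proof.
by move=> hb; apply: ge_sup => [|_ [y _ <-]//]; exists (h x - k * mdist x x), x.
Qed.

Lemma lip_hull_ge x : h x <= lip_hull h k x.
Proof. by rewrite -[leLHS]subr0 -(mulr0 k) -(mdistxx x) lip_hull_term. Qed.

Lemma lip_hull_bound x : `|lip_hull h k x| <= c.
Proof.
have hx := hc x; move: (hx); rewrite !ler_norml => /andP[h1 h2].
rewrite (le_trans h1 (lip_hull_ge x)) /=; apply: lip_hull_le => y.
have := hc y; rewrite ler_norml => /andP[_ hy].
by rewrite lerBlDr (le_trans hy)// lerDl mulr_ge0// mdist_ge0.
Qed.

Lemma lip_hull_lip x y : `|lip_hull h k x - lip_hull h k y| <= k * mdist x y.
Proof.
suff H u v : lip_hull h k u <= lip_hull h k v + k * mdist u v.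
  by have := H x y; have := H y x; rewrite (metric_sym y) ler_norml; lra.
apply: lip_hull_le => z; rewrite -lerBlDr; apply: le_trans (lip_hull_term v z).
have := ler_wpM2l k0 (metric_triangle v u z).
by rewrite (metric_sym v u) mulrDr; lra.
Qed.

End bounded.

Lemma lip_hull_cvg h (c : R) x : continuous h -> (forall x, `|h x| <= c) ->
  lip_hull h n%:R x @[n --> \oo] --> h x.
Proof.
move=> ch hc; apply/cvgrPdist_le => e e0.
have [r /= r0 hr] : nbhs_ball x [set y | `|h x - h y| < e].
  by rewrite nbhs_ballE; have /cvgrPdist_lt := ch x; exact.
near=> n.
rewrite distrC ger0_norm ?subr_ge0 ?(lip_hull_ge hc)//.
rewrite lerBlDr; apply: lip_hull_le => y.
have [xy|xy] := ltP (mdist x y) r.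
  have : `|h x - h y| < e by apply: hr; rewrite ballEmdist.
  rewrite ltr_norml => /andP[hxy _].
  have : 0 <= n%:R * mdist x y by rewrite mulr_ge0// mdist_ge0.
  lra.
have nr : (c + c) / r <= n%:R by near: n; exact: nbhs_infty_ger.
have : c + c <= n%:R * mdist x y.
  rewrite ler_pdivrMr// in nr; apply: (le_trans nr).
  by rewrite ler_wpM2l.
have := hc x; have := hc y; rewrite !ler_norml => /andP[_ hy] /andP[hx _].
lra.
Unshelve. all: by end_near. Qed.

(** The function that separates [nu] from [C] can be replaced by one of its
    Lipschitz hulls [g k]: these lie above it, which preserves the inequality on
    [C], and their integrals against [nu] converge to its integral. An affine
    change of scale then gives a test function. *)
Lemma closed_test (C : set (M1 E R)) nu :
  narrow_closed C -> convex_measures C -> C !=set0 ->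
  (forall f c, test f -> (forall mu, C mu -> c%:E <= \int[mu]_x (f x)%:E)%E ->
    (c%:E <= \int[nu]_x (f x)%:E)%E) ->
  C nu.
Proof.
move=> cC vC C0 testC; apply: contrapT => nC.
have [h [c [e [ch hc e0 sep]]]] := convex_separation cC vC C0 nC.
have mh := continuous_borel_measurable ch.
have c0 : 0 <= c := le_trans (normr_ge0 _) (hc point).
pose g k := lip_hull h k%:R.
have gc k x : `|g k x| <= c by apply: lip_hull_bound.
have gl k x y : `|g k x - g k y| <= k%:R * mdist x y by apply: (lip_hull_lip hc).
have cg k : continuous (g k) := lipschitz_continuous (gl k).
have mg k := continuous_borel_measurable (cg k).
have g_cvg : (\int[nu]_x (g k x)%:E)%E @[k --> \oo] --> (\int[nu]_x (h x)%:E)%E.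
  have [] // := @dominated_convergence _ _ _ nu setT measurableT
    (fun k x => (g k x)%:E) (EFin \o h) (cst c%:E).
  - by move=> k; exact/measurable_EFinP.
  - exact/measurable_EFinP.
  - apply: aeW => x _; apply: cvg_EFin; first exact: nearW.
    exact: (lip_hull_cvg ch hc).
  - exact: finite_measure_integrable_cst.
  - by apply: aeW => x k _; rewrite lee_fin.
have [k gk] : exists k, \int[nu]_x g k x < \int[nu]_x h x + e.
  rewrite (Rint_EFin _ ch hc) in g_cvg.
  have he : \int[nu]_x h x < \int[nu]_x h x + e by rewrite ltrDl.
  have [k _ /(_ k (leqnn k)) gk] := cvgr_lt _ (fine_cvg g_cvg) _ he.
  by exists k.
(* [g k] is [k]-Lipschitz with values in an interval of length [c + c] *)
pose l := k%:R + (c + c) + 1.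
have l0 : 0 < l by rewrite ltr_pwDr// !addr_ge0.
pose f x := l^-1 * (g k x + c).
have ft : test f.
  split=> [x y|x]; rewrite /f.
    rewrite -mulrBr normrM gtr0_norm ?invr_gt0// opprD addrACA subrr addr0.
    rewrite mulrC ler_pdivrMr//; apply: (le_trans (gl k x y)); rewrite mulrC.
    by rewrite ler_wpM2l ?mdist_ge0// /l -addrA lerDl !addr_ge0.
  have := gc k x; rewrite ler_norml => /andP[g1 g2]; apply/andP; split.
    by rewrite mulr_ge0 ?invr_ge0 ?(ltW l0)// -lerBlDr sub0r.
  rewrite mulrC ler_pdivrMr// mul1r /l.
  have := ler0n R k; lra.
have fE mu : (\int[mu]_x (f x)%:E = (l^-1 * (\int[mu]_x g k x + c))%:E)%E.
  have fi := bounded_integrable mu (mg k) (gc k).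
  transitivity ((\int[mu]_x f x)%:E).
    apply: (@Rint_EFin _ _ _ _ 1); last first.
      by move=> x; have := ft.2 x => /andP[f0 f1]; rewrite ger0_norm.
    by move=> x; apply: cvgM; [exact: cvg_cst|apply: cvgD; [exact: cg|exact: cvg_cst]].
  congr EFin; rewrite /f.
  have ci : mu.-integrable setT (EFin \o cst c) by exact: finite_measure_integrable_cst.
  rewrite RintegralZl//; last first.
    apply: (@bounded_integrable _ _ mu (fun x => g k x + c) (c + c)) => [|x].
      by apply: measurable_funD => //; exact: mg.
    by rewrite (le_trans (ler_normD _ _))// lerD// ger0_norm.
  congr (_ * _); rewrite RintegralD// Rintegral_cst//.
  by rewrite (_ : fine _ = 1) ?mulr1// -[RHS]/(fine 1%E); congr fine; exact: probability_setT.
have := testC f (l^-1 * (\int[nu]_x h x + e + c)) ft; rewrite fE lee_fin.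
rewrite ler_pM2l ?invr_gt0// lerD2r leNgt.
rewrite gk => absurd; suff: false by []; apply: absurd => mu Cmu; rewrite fE lee_fin ler_pM2l ?invr_gt0// lerD2r.
apply: (le_trans (sep mu Cmu)); apply: le_Rintegral => //.
- exact: bounded_integrable mh hc.
- exact: bounded_integrable (mg k) (gc k).
- by move=> x _; exact: (lip_hull_ge hc).
Qed.

End lipschitz_approximation.

(** * Entropy of the densities that almost satisfy the constraints *)

Section half_spaces.
Context {R : realType} {E : completeMetricType R}.
Variables (alpha : M1 E R) (C : set (M1 E R)).
Implicit Types f : E -> R.

(** All the linear constraints that hold on [C], with a common slack; the slack
    is geometric to match the rate in [entropy_gap]. *)
Definition almost_in j : set (borel E -> R) := [set g | is_density alpha g /\
  forall f c, test f -> (forall mu, C mu -> c%:E <= \int[mu]_x (f x)%:E)%E ->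
    ((c - (2 ^+ j)^-1)%:E <= \int[alpha]_x ((f x)%:E * (g x)%:E))%E].

Let test_measurable f : test f -> measurable_fun [set: borel E] (fun x => (f x)%:E).
Proof. by move=> [fl _]; apply: measurable_EFin; exact: lipschitz_measurable. Qed.

Let test_ge0 f x : test f -> (0 <= (f x)%:E)%E.
Proof. by move=> [_ /(_ x) /andP[]]; rewrite lee_fin. Qed.

Let integral_test_le f (g g' : borel E -> R) : test f ->
  is_density alpha g -> is_density alpha g' ->
  (\int[alpha]_x ((f x)%:E * (g x)%:E) <=
   \int[alpha]_x ((f x)%:E * (g' x)%:E) + \int[alpha]_x `|g x - g' x|%:E)%E.
Proof.
move=> tf [mg g0 _] [mg' g'0 _].
have mf := test_measurable tf.
have mfg := emeasurable_funM mf (measurable_EFin mg).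
have mfg' := emeasurable_funM mf (measurable_EFin mg').
have md : measurable_fun [set: borel E] (fun x => `|g x - g' x|%:E).
  by apply/measurable_EFinP; apply: measurableT_comp => //; exact: measurable_funB.
have p0 x : (0 <= (f x)%:E * (g x)%:E)%E.
  by rewrite mule_ge0 ?(test_ge0 x tf)// lee_fin.
have p0' x : (0 <= (f x)%:E * (g' x)%:E)%E.
  by rewrite mule_ge0 ?(test_ge0 x tf)// lee_fin.
have d0 x : (0 <= `|g x - g' x|%:E)%E by rewrite lee_fin.
rewrite -(ge0_intD _ mfg' md p0' d0).
apply: ge0_int_le => // [|x]; first exact: emeasurable_funD.
rewrite !(=^~ EFinM, =^~ EFinD) lee_fin -lerBlDl -mulrBr.
have [_ /(_ x) /andP[f0 f1]] := tf.
apply: (le_trans (ler_norm _)); rewrite normrM ger0_norm//.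
by rewrite ler_piMl.
Qed.

Lemma almost_in_mid j (g g' : borel E -> R) : almost_in j g -> almost_in j g' -> almost_in j (mid g g').
Proof.
move=> [gd Hg] [g'd Hg']; split; first exact: is_density_mid.
move=> f c tf fc; have := Hg f c tf fc; have := Hg' f c tf fc.
have [mg g0 _] := gd; have [mg' g'0 _] := g'd.
have mf := test_measurable tf.
have mfg := emeasurable_funM mf (measurable_EFin mg).
have mfg' := emeasurable_funM mf (measurable_EFin mg').
have p0 x : (0 <= (f x)%:E * (g x)%:E)%E.
  by rewrite mule_ge0 ?(test_ge0 x tf)// lee_fin.
have p0' x : (0 <= (f x)%:E * (g' x)%:E)%E.
  by rewrite mule_ge0 ?(test_ge0 x tf)// lee_fin.
have -> : (\int[alpha]_x ((f x)%:E * (mid g g' x)%:E) = 2^-1%:E *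
    (\int[alpha]_x ((f x)%:E * (g x)%:E) + \int[alpha]_x ((f x)%:E * (g' x)%:E)))%E.
  rewrite -(ge0_intD _ mfg mfg' p0 p0') -ge0_intZl//.
  - apply: eq_integral => x _; rewrite /mid !(=^~ EFinM, =^~ EFinD).
    by congr EFin; rewrite -mulrDr mulrA mulrC.
  - exact: emeasurable_funD.
  - by move=> x; rewrite adde_ge0.
move=> H' H; have := leeD H H'.
by rewrite -EFinD lee_pdivlMl// -EFinM mulr_natl mulr2n.
Qed.

(** An [L^1] limit of densities that satisfy the constraints better and better
    satisfies them exactly, so it belongs to [C] by [closed_test] and has
    entropy at least [H]. *)
Lemma almost_in_entropy (H e : R) : 0 < e ->
  narrow_closed C -> convex_measures C -> C !=set0 ->
  (H%:E <= rel_entropy_set C alpha)%E ->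
  exists j, forall g : borel E -> R, almost_in j g -> ((H - e)%:E <= Ent alpha g)%E.
Proof.
move=> e0 cC vC C0 HC; apply: entropy_gap => //.
- by move=> j f [].
- by move=> j f g; exact: almost_in_mid.
- by move=> i j ij g [gd Hg]; split => // f c tf fc; apply: le_trans (Hg f c tf fc);
    rewrite lee_fin lerB// lef_pV2 ?posrE ?exprn_gt0// ler_weXn2l// ler1n.
- move=> F g b FF gd Fg; have [nu nuE] := ex_probability_of_density gd.
  rewrite -(rel_entropyE gd nuE); apply: (le_trans HC).
  apply: ereal_inf_lbound; exists nu => //.
  apply: closed_test => // f c tf fc.
  have [mg g0 _] := gd.
  rewrite (ge0_integral_density mg g0 nuE (test_measurable tf) (fun x => test_ge0 x tf)).
  apply/lee_addgt0Pr => r r0.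
  have b1 : 0 < `|b| + 1 by rewrite ltr_pwDr.
  have rb : 0 < r / (`|b| + 1) by rewrite divr_gt0.
  have [j _ /(_ j (leqnn j)) jr] := near_infty_natSinv_expn_lt (PosNum rb).
  rewrite /= mul1r ltr_pdivlMr// mulrC in jr.
  have [Fd Fj] := FF j.
  have h1 := Fj f c tf fc.
  have h2 := le_trans (integral_test_le tf Fd gd) (leeD2l _ (Fg j)).
  have := le_trans h1 h2; rewrite EFinB leeBlDr// -addeA -EFinD => /le_trans; apply.
  apply: leeD2l; rewrite lee_fin; apply: le_trans (ltW jr).
  by rewrite mulrDl mul1r lerD2r ler_wpM2r ?invr_ge0 ?exprn_ge0// ler_norm.
Qed.

End half_spaces.

(** * The conditioned sample almost satisfies the constraints *)

Section conditioned_sample.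
Context {R : realType} {E : completeMetricType R}.
Variables (dbar : M1 E R -> M1 E R -> \bar R) (C : set (M1 E R)) (e : R).
Hypothesis dbarE : dbar = prohorov \/ dbar = fortet_mourier.
Local Notation event n := [set x : n.-tuple (borel E) |
  closed_nbhd dbar C e%:E (empirical x)].

(** Quantifying over all tuples with underlying list [s] expresses the event on
    lists, where rotations do not change the type. *)
Definition nbhd_seq : set (seq (borel E)) := [set s | forall n (x : n.-tuple (borel E)),
  tval x = s -> closed_nbhd dbar C e%:E (empirical x)].

Lemma nbhd_seqE n (x : n.-tuple (borel E)) :
  nbhd_seq x <-> closed_nbhd dbar C e%:E (empirical x).
Proof.
split=> [|Cx m y yx]; first exact.
have mn : m = n by rewrite -(size_tuple y) yx size_tuple.
by subst m; rewrite (val_inj yx).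
Qed.

Lemma nbhd_seq_event n : [set x : n.-tuple (borel E) | nbhd_seq x] = event n.
Proof. by apply/seteqP; split => x /nbhd_seqE. Qed.

Lemma empirical_perm n (x y : n.-tuple (borel E)) : (0 < n)%N -> perm_eq x y ->
  (empirical x : M1 E R) = (empirical y : M1 E R) :> (set (borel E) -> \bar R).
Proof.
move=> n0 xy; apply/funext => A.
rewrite (empiricalE x A n0) (empiricalE y A n0); congr (_ * _)%E.
rewrite -(big_tuple _ _ x xpredT (fun a => \d_a A)).
by rewrite -(big_tuple _ _ y xpredT (fun a => \d_a A)); apply: perm_big.
Qed.

Lemma nbhd_seq_rot n j s : size s = n.+1 -> nbhd_seq (rot j s) <-> nbhd_seq s.
Proof.
move=> sn; have ssn : size s == n.+1 by rewrite sn.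
pose x : n.+1.-tuple (borel E) := Tuple ssn.
rewrite -[s]/(tval x) -[rot j _]/(tval [tuple of rot j x]) !nbhd_seqE.
by split; apply: nbhd_empirical_eq => //; apply: empirical_perm => //=;
  rewrite ?perm_rot// perm_sym perm_rot.
Qed.

Variables (alpha : M1 E R) (n : nat) (p : R).
Hypothesis mev : measurable (event n.+1).
Hypothesis pE : powerm alpha n.+1 (event n.+1) = p%:E.
Hypothesis p0 : 0 < p.

Let mG : measurable [set x : n.+1.-tuple (borel E) | nbhd_seq x].
Proof. by rewrite nbhd_seq_event. Qed.

Let pG : powerm alpha n.+1 [set x : n.+1.-tuple (borel E) | nbhd_seq x] = p%:E.
Proof. by rewrite nbhd_seq_event. Qed.

Let g := cond_density alpha n nbhd_seq p.

(** The constraints are linear in the law of one coordinate, which is the mean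
    of the conditioned empirical measure by exchangeability. *)
Lemma cond_density_almost_in j (s : R) : e < s ->
  (forall mu m (y : m.-tuple (borel E)) f, (0 < m)%N ->
    (dbar mu (empirical y) < s%:E)%E -> test f ->
    (\int[mu]_x (f x)%:E <=
     \int[(empirical y : M1 E R)]_x (f x)%:E + ((2 ^+ j)^-1)%:E)%E) ->
  almost_in alpha C j g.
Proof.
move=> es close.
have gd : is_density alpha g := is_density_cond mG pG p0.
have [mg g0 _] := gd.
split=> // f c tf fc.
have mf : measurable_fun [set: borel E] (fun x => (f x)%:E).
  by apply: measurable_EFin; apply: lipschitz_measurable; case: tf.
have f0 x : (0 <= (f x)%:E)%E by rewrite lee_fin; case: tf => _ /(_ x) /andP[].
have [c0|c0] := lerP (c - (2 ^+ j)^-1) 0.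
  apply: (@le_trans _ _ 0%E); first by rewrite lee_fin.
  by apply: ge0_int => x; rewrite mule_ge0// lee_fin.
pose P := powerm alpha n.+1.
pose G := [set x : n.+1.-tuple (borel E) | nbhd_seq x].
have chiE (x : n.+1.-tuple (borel E)) : \1_nbhd_seq (tval x) = \1_G x :> R.
  by rewrite !indicE; congr ((_ : bool)%:R); apply/idP/idP; rewrite !inE.
have mchi : measurable_fun setT (fun x : n.+1.-tuple (borel E) => (\1_nbhd_seq (tval x) : R)%:E).
  under eq_fun do rewrite chiE.
  by apply/measurable_EFinP; exact: measurable_indic.
have chi0 (x : n.+1.-tuple (borel E)) : (0 <= (\1_nbhd_seq (tval x) : R)%:E)%E.
  by rewrite lee_fin indicE.
have chi_int : (\int[P]_x (\1_nbhd_seq (tval x) : R)%:E = p%:E)%E.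
  by under eq_integral do rewrite chiE; rewrite integral_indic// setIT.
have munth (i : 'I_n.+1) : measurable_fun setT
    (fun x : n.+1.-tuple (borel E) => (f (nth point x i))%:E).
  by apply: (measurableT_comp mf); exact: measurable_nth.
have sumE : (\int[P]_x (\sum_(i < n.+1) ((\1_nbhd_seq (tval x) : R)%:E *
    (f (nth point x i))%:E)) =
    \sum_(i < n.+1) (p%:E * \int[alpha]_a ((f a)%:E * (g a)%:E)))%E.
  rewrite ge0_integral_sum//.
  - apply: eq_bigr => i _.
    by rewrite (integral_cond_density_nth alpha mG (@nbhd_seq_rot n) p0 (ltn_ord i) mf f0).
  - by move=> i; apply: emeasurable_funM => //; exact: munth.
  - by move=> i x _; rewrite mule_ge0.
have low : (p%:E * (n.+1%:R * (c - (2 ^+ j)^-1))%:E <=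
    \sum_(i < n.+1) (p%:E * \int[alpha]_a ((f a)%:E * (g a)%:E)))%E.
  rewrite -sumE -chi_int -ge0_intZr//; last first.
    by rewrite lee_fin mulr_ge0// ltW.
  apply: ge0_int_le.
  - exact: (emeasurable_funM mchi (measurable_cst _)).
  - apply: emeasurable_sum => i; apply: emeasurable_funM => //; exact: munth.
  - by move=> x; rewrite mule_ge0// lee_fin mulr_ge0// ltW.
  move=> x; have [Gx|Gx] := boolP (x \in G); last first.
    rewrite !chiE indicE (negbTE Gx) mul0e.
    by rewrite big1// => i _; rewrite mul0e.
  rewrite !chiE indicE Gx mul1e.
  under eq_bigr do rewrite mul1e.
  have /nbhd_seqE Cx : nbhd_seq x by move: Gx; rewrite inE.
  have : (ereal_inf [set dbar mu (empirical x) | mu in C] < s%:E)%E.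
    by apply: (le_lt_trans Cx); rewrite lte_fin.
  move=> /ereal_inf_lt[_ [mu Cmu <-]] mux.
  have := le_trans (fc mu Cmu) (close mu _ x f (ltn0Sn n) mux tf).
  rewrite integral_empirical// sumEFin.
  rewrite (_ : \sum_(i < n.+1) f (tnth x i) =
    \sum_(i < n.+1) f (nth point x i)); last first.
    by apply: eq_bigr => i _; rewrite (tnth_nth point).
  rewrite sumEFin -EFinM -EFinD !lee_fin -lerBlDr => cS.
  by rewrite mulrC -ler_pdivlMr// mulrC.
have I0 : (0 <= \int[alpha]_a ((f a)%:E * (g a)%:E))%E.
  by apply: ge0_int => x; rewrite mule_ge0// lee_fin.
move: low I0; case: (\int[alpha]_a _)%E => [r| |]; first last.
- by move=> _; rewrite leNgt ltNy0.
- by move=> _ _; exact: leey.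
under eq_bigr do rewrite -EFinM.
rewrite sumEFin sumr_const card_ord -EFinM !lee_fin -[X in _ <= X]mulr_natl mulrCA.
by rewrite ler_pM2l ?ltr0n// ler_pM2l.
Qed.

End conditioned_sample.

(** * The law of a block of the conditioned sample *)

Section prefix_law.
Context {R : realType} d (T : measurableType d).
Variables (alpha P : probability T R) (n : nat) (G : set (seq T)) (p : R).
Hypothesis mG : measurable [set x : n.+1.-tuple T | G x].
Hypothesis symG : forall j s, size s = n.+1 -> G (rot j s) <-> G s.
Hypothesis pE : powerm alpha n.+1 [set x : n.+1.-tuple T | G x] = p%:E.
Hypothesis p0 : 0 < p.
Variables (h : T -> R) (H l : R) (k : nat).
Hypotheses (hd : is_density alpha h) (Ph : has_density P alpha h).
Hypothesis hH : (Ent alpha h <= H%:E)%E.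
Hypothesis l01 : 0 < l <= 2^-1.
Hypothesis kn : (0 < k <= n.+1)%N.
Hypothesis pH : - ln p <= n.+1%:R * (H + l ^+ 2).
Let g := cond_density alpha n G p.
Hypothesis gH : ((H - l ^+ 2)%:E <= Ent alpha g)%E.
Hypothesis gmH : ((H - l ^+ 2)%:E <= Ent alpha (mid g h))%E.

Let gd : is_density alpha g := is_density_cond mG pE p0.

(** The relative entropy [- ln p] of the conditioned law of the whole sample is
    at least [n.+1] times that of its first marginal: this is
    [conditioned_block_le] with no block at all. *)
Lemma cond_entropy_le : (Ent alpha g <= (H + l ^+ 2)%:E)%E.
Proof.
have [q qg] := ex_probability_of_density gd.
have key e : (e%:E <= Ent alpha g)%E -> e <= H + l ^+ 2.
  move=> eg; have nE : n.+1 = (0 * 0 + n.+1)%N by [].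
  have l0 : 0 <= (0 : R) <= 2^-1 by rewrite lexx invr_ge0 ler0n.
  have f0 (s : seq T) : 0 <= (0 : R) <= 1 by rewrite lexx ler01.
  have int0 : (\int[powerm alpha n.+1]_x ((\1_G (tval x))%:E * 0%:E) = (p * 0)%:E)%E.
    by rewrite mulr0; under eq_integral do rewrite mule0; exact: integral0.
  have q0 : (\int[powerm q 0]_x 0%:E = 0%:E :> \bar R)%E by exact: integral0.
  have m0 : mseq 0 (fun _ : seq T => 0 : R) by exact: measurable_cst.
  have := conditioned_block_le mG symG pE p0 nE l0 m0 f0 qg eg int0 q0.
  rewrite !mul0r sub0r subr_ge0 => /le_trans/(_ pH).
  by rewrite ler_pM2l ?ltr0n.
move: key; case: (Ent alpha g) => [r| |] key.
- by rewrite lee_fin key.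
- by have := key (H + l ^+ 2 + 1) (leey _); rewrite gerDl ler10.
- exact: leNye.
Qed.

Lemma cond_L1_le : (\int[alpha]_x `|g x - h x|%:E <= (5 * l)%:E)%E.
Proof.
have /andP[l0 _] := l01.
have := L1_le_entropy gd hd l0 cond_entropy_le hH gmH.
rewrite (_ : _ + 2 * l = 5 * l)//; field.
by rewrite gt_eqF.
Qed.

(** The excess of [- ln p] over [n.+1 * Ent g], of order [n * l ^+ 2], is shared
    between [n.+1 / k] exchangeable blocks, so that each block has a law close to
    [q^k]; and [q] is close to [P] in [L^1]. *)
Lemma cond_test_le (f : seq T -> R) Qf Pf : mseq k f ->
  (forall s, 0 <= f s <= 1) ->
  (\int[powerm alpha n.+1]_x ((\1_G (tval x))%:E * (f (take k x))%:E) = (p * Qf)%:E)%E ->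
  (\int[powerm P k]_x (f x)%:E = Pf%:E)%E ->
  Qf <= Pf + (2 + 9 * k%:R) * l.
Proof.
move=> mf f01 Qe Pe; have /andP[l0 l2] := l01; have /andP[k0 kn1] := kn.
have [q qg] := ex_probability_of_density gd.
have nE : n.+1 = (n.+1 %/ k * k + n.+1 %% k)%N by rewrite -divn_eq.
have l02 : 0 <= l <= 2^-1 by rewrite ltW.
have F01 s : (0 <= (f s)%:E <= 1)%E by rewrite !lee_fin.
have [mg g0 _] := gd; have [mh h0 _] := hd.
have qP := integral_powerm_le gd hd qg Ph cond_L1_le (measurable_EFin mf) F01.
have [qf qfE] : exists qf, (\int[powerm q k]_x (f x)%:E = qf%:E)%E.
  exists (fine (\int[powerm q k]_x (f x)%:E)%E); rewrite fineK//.
  rewrite ge0_fin_numE; last by apply: ge0_int => x; case/andP: (F01 x).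
  by apply: (le_lt_trans qP); rewrite Pe ltry.
have := conditioned_block_le mG symG pE p0 nE l02 mf f01 qg gH Qe qfE.
move: qP; rewrite qfE Pe -EFinD lee_fin => qP.
set m := (n.+1 %/ k)%N => block.
have m0 : (0 < m)%N by rewrite divn_gt0.
have nmk : n.+1%:R <= 2 * m%:R * k%:R :> R.
  rewrite -!natrM ler_nat [leqLHS]nE -/m.
  have := ltn_pmod n.+1 k0; have : (k <= m * k)%N by rewrite leq_pmull.
  by rewrite -mulnA mul2n -addnn; lia.
have m0R : 0 < m%:R :> R by rewrite ltr0n.
have : m%:R * l * (Qf - qf) <= m%:R * l * (2 * l + 4 * k%:R * l).
  apply: (le_trans block).
  have : n.+1%:R * (2 * l ^+ 2) <= 2 * m%:R * k%:R * (2 * l ^+ 2).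
    by rewrite ler_wpM2r// mulr_ge0// sqr_ge0.
  have := pH; lra.
rewrite ler_pM2l; last by rewrite mulr_gt0.
move: qP; lra.
Qed.

End prefix_law.

Section prefix_event.
Context {R : realType} d (T : measurableType d).
Variables (alpha P : probability T R) (n : nat) (G : set (seq T)) (p : R).
Hypothesis mG : measurable [set x : n.+1.-tuple T | G x].
Hypothesis symG : forall j s, size s = n.+1 -> G (rot j s) <-> G s.
Hypothesis pE : powerm alpha n.+1 [set x : n.+1.-tuple T | G x] = p%:E.
Hypothesis p0 : 0 < p.
Variables (h : T -> R) (H l : R) (k : nat).
Hypotheses (hd : is_density alpha h) (Ph : has_density P alpha h).
Hypothesis hH : (Ent alpha h <= H%:E)%E.
Hypothesis l01 : 0 < l <= 2^-1.
Hypothesis kn : (0 < k <= n.+1)%N.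
Hypothesis pH : - ln p <= n.+1%:R * (H + l ^+ 2).
Let g := cond_density alpha n G p.
Hypothesis gH : ((H - l ^+ 2)%:E <= Ent alpha g)%E.
Hypothesis gmH : ((H - l ^+ 2)%:E <= Ent alpha (mid g h))%E.

Let event (D : set (k.-tuple T)) := [set x : n.+1.-tuple T | D (Defs.prefix k x) /\ G x].

Let mevent D : measurable D -> measurable (event D).
Proof.
move=> mD; rewrite (_ : event D = (Defs.prefix k @^-1` D) `&` [set x : n.+1.-tuple T | G x])//.
apply: measurableI => //; rewrite -[X in measurable X]setTI.
exact: (@measurable_gather _ _ _ _ id).
Qed.

Let cond_event_le D v w : measurable D ->
  powerm alpha n.+1 (event D) = v%:E -> powerm P k D = w%:E ->
  v / p <= w + (2 + 9 * k%:R) * l.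
Proof.
move=> mD vE wE.
pose f (s : seq T) : R := \1_D [tuple nth point s i | i < k].
have fE (x : k.-tuple T) : f x = \1_D x.
  rewrite /f (_ : [tuple nth point x i | i < k] = x)//.
  by apply: eq_from_tnth => i; rewrite tnth_mktuple (tnth_nth point).
have mf : mseq k f by under eq_fun do rewrite fE; exact: measurable_indic.
have f01 s : 0 <= f s <= 1 by rewrite /f indicE; case: (_ \in _); rewrite !lexx ?ler01.
apply: (cond_test_le mG symG pE p0 hd Ph hH l01 kn pH gH gmH mf f01).
- rewrite mulrC divfK ?gt_eqF// -vE -[X in _ = _ X]setIT.
  rewrite -integral_indic//; last exact: mevent.
  apply: eq_integral => x _; rewrite -EFinM !indicE; congr EFin.
  rewrite /f indicE (_ : [tuple nth point (take k x) i | i < k] = Defs.prefix k x); last first.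
    by apply: eq_from_tnth => i; rewrite !tnth_mktuple nth_take.
  rewrite -natrM mulnb; congr (_%:R); congr nat_of_bool.
  apply/andP/idP; rewrite !inE => -[] //.
- by under eq_integral do rewrite fE; rewrite integral_indic// setIT.
Qed.

Lemma cond_law_close (A : set (probability T R)) (D : set (k.-tuple T)) :
  measurable D -> (forall x : n.+1.-tuple T, A (empirical x) <-> G x) ->
  (`|cond_law alpha A n.+1 D - powerm P k D| <= ((2 + 9 * k%:R) * l)%:E)%E.
Proof.
move=> mD AG; rewrite /cond_law.
have -> : [set x : n.+1.-tuple T | D (Defs.prefix k x) /\ A (empirical x)] = event D.
  by apply/seteqP; split => x [Dx /AG].
have -> : [set x : n.+1.-tuple T | A (empirical x)] = [set x : n.+1.-tuple T | G x].
  by apply/seteqP; split => x /AG.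
have fin m (Q : probability (m.-tuple T) R) S : measurable S -> exists r : R, Q S = r%:E.
  by move=> mS; exists (fine (Q S)); rewrite fineK// fin_num_measure.
have [v vE] := fin _ (powerm alpha n.+1) _ (mevent mD).
have [v' vE'] := fin _ (powerm alpha n.+1) _ (mevent (measurableC mD)).
have [w wE] := fin _ (powerm P k) _ mD.
have vv : v + v' = p.
  apply: EFin_inj; rewrite EFinD -vE -vE' -pE -measureU//;
    [|exact: mevent|exact: (mevent (measurableC mD))|].
    congr (powerm _ _ _); apply/seteqP; split => x /=; first by move=> [[]|[]].
    by move=> Gx; have [Dx|Dx] := pselect (D (Defs.prefix k x)); [left|right].
  by apply/seteqP; split => // x [[Dx _] [nDx _]].
have wE' : powerm P k (~` D) = (1 - w)%:E.
  by rewrite probability_setC// wE -EFinB.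
have up := cond_event_le mD vE wE.
have lo := cond_event_le (measurableC mD) vE' wE'.
rewrite vE pE wE inver gt_eqF// -EFinM -EFinB lee_fin ler_norml.
have pp : v' / p = 1 - v / p by rewrite -vv; field; rewrite vv gt_eqF.
by apply/andP; split; move: up lo; rewrite pp; lra.
Qed.

End prefix_event.

(** * Growth conditions *)

Section asymptotics.
Context {R : realType}.

Lemma covering_numberP {E : completeMetricType R} (K : set E) (e : R) :
  compact K -> 0 < e -> exists N (c : N.-tuple E),
    K `<=` \bigcup_(i in [set: 'I_N]) ball (tnth c i) e /\
    covering_number K e = N%:R.
Proof.
move=> cK e0.
pose S : set nat := [set n : nat | exists x : n.-tuple E,
    K `<=` \bigcup_(i in [set: 'I_n]) ball (tnth x i) e].
have [n Sn] : exists n, S n.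
  move: (cK); rewrite compact_cover => /(_ _ K (fun x => (ball x e)°)).
  case=> [x _|x Kx|D DK Dcov].
  - exact: open_interior.
  - by exists x => //; exact: nbhsx_ballx.
  - exists (size (finmap.enum_fset D)), (in_tuple (finmap.enum_fset D)) => x /Dcov[y /= yD /interior_subset xy].
    have yi : (index y (finmap.enum_fset D) < size (finmap.enum_fset D))%N by rewrite index_mem.
    by exists (Ordinal yi) => //; rewrite (tnth_nth y) /= nth_index.
have exS : exists n, `[< S n >] by exists n; exact/asboolP.
case: (ex_minnP exS) => N /asboolP[c cN] Nmin.
exists N, c; split => //; apply/eqP; rewrite eq_le; apply/andP; split.
  apply: ge_inf; last by exists N => //; exists c.
  by exists 0 => _ [m _ <-].
apply: lb_le_inf; first by exists N%:R, N => //; exists c.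
by move=> _ [m Sm <-]; rewrite ler_nat Nmin//; exact/asboolP.
Qed.

(** As [ln (eta n)] goes to [-oo], the growth condition bounds both [n eta^2]
    from below and [N] by a vanishing fraction of it. *)
Lemma growth_ratio (eta N : nat -> R) (s : R) : (forall n, 0 < eta n) ->
  (forall n, 0 <= N n) -> eta n @[n --> \oo] --> 0 ->
  (n%:R * eta n ^+ 2 + 8 * ln (eta n) * N n) @[n --> \oo] --> +oo ->
  0 < s -> \forall n \near \oo, 16 * (N n + 1) / (n%:R * eta n ^+ 2) <= s.
Proof.
move=> eta_gt0 N0 eta0 growth s0.
have s4 : 0 < 4 / s by rewrite divr_gt0.
have A0 : 0 < 32 / s by rewrite divr_gt0.
near=> n.
have en := eta_gt0 n.
have lneta : ln (eta n) <= - (4 / s).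
  rewrite -[leRHS]expRK ler_ln ?posrE ?expR_gt0//.
  near: n; apply: (cvgr_le _ eta0); exact: expR_gt0.
have big : 32 / s <= n%:R * eta n ^+ 2 + 8 * ln (eta n) * N n.
  by near: n; have /cvgryPge := growth; apply.
have Nn := N0 n.
have lN : 8 * ln (eta n) * N n <= - (32 / s) * N n.
  by rewrite ler_wpM2r//; lra.
have sN0 : 0 <= 32 / s * N n by rewrite mulr_ge0// ltW.
have q0 : 0 < n%:R * eta n ^+ 2 by lra.
rewrite ler_pdivrMr//.
have : s * (32 / s * (N n + 1)) <= s * (2 * (n%:R * eta n ^+ 2)).
  by rewrite ler_pM2l//; lra.
have -> : s * (32 / s * (N n + 1)) = 32 * (N n + 1) by field; rewrite gt_eqF.
lra.
Unshelve. all: by end_near. Qed.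

(** [a n ^+ n <= a n <= 1]. *)
Lemma expe_cvg1 (a : nat -> R) : (forall n, 0 <= a n <= 1) ->
  a n ^+ n @[n --> \oo] --> (1 : R) -> a n @[n --> \oo] --> (1 : R).
Proof.
move=> a01 an1; apply: (squeeze_cvgr _ an1 (cvg_cst (1 : R))).
near=> n; have /andP[a0 a1] := a01 n; rewrite a1 andbT.
have : (0 < n)%N by near: n; exact: nbhs_infty_gt.
by move=> n0; rewrite -{2}(prednK n0) exprS ler_piMr// exprn_ile1.
Unshelve. all: by end_near. Qed.

Lemma ex_small_expR (d : R) : 0 < d -> exists2 M : R, 0 <= M & expR (- M) <= d.
Proof.
move=> d0; exists (`|ln d|) => //.
rewrite -[leRHS](lnK d0) ler_expR lerNl -normrN; exact: ler_norm.
Qed.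

End asymptotics.

(** In [change_of_measure_le] take [c = n (H + delta)]: the left-hand side exceeds
    the terms in [n] of the right-hand side by about [n * delta], a deficit that
    only the term [p * expR c] can fill. *)
Lemma event_prob_lower {R : realType} d (T : measurableType d)
    (alpha P : probability T R) (h : T -> R) (H delta : R) :
  is_density alpha h -> has_density P alpha h -> Ent alpha h = H%:E -> 0 < delta ->
  exists2 s0 : R, 0 < s0 & forall n (G : set (seq T)) p, 1 <= n%:R * delta ->
    measurable [set x : n.-tuple T | G x] ->
    powerm alpha n [set x : n.-tuple T | G x] = p%:E ->
    ((1 - s0)%:E <= powerm P n [set x : n.-tuple T | G x])%E ->
    expR (- (n%:R * (H + delta))) <= p.
Proof.
move=> hd Ph HE d0.
have H0 : 0 <= H.
  by rewrite -lee_fin -HE; apply: ge0_int => x; rewrite lee_fin entf_ge0//; case: hd.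
have d4 : 0 < delta / 4 by rewrite divr_gt0.
have [M M0 eM] := ex_small_expR d4.
have L0 : 0 < H + delta + M by rewrite ltr_wpDr// ltr_wpDl.
exists (Num.min 2^-1 (delta / 4 / (H + delta + M))).
  by rewrite lt_min invr_gt0 ltr0n divr_gt0.
move=> n G p nd mG pE PG.
have [s sE] : exists s, powerm P n [set x : n.-tuple T | G x] = (1 - s)%:E.
  exists (1 - fine (powerm P n [set x : n.-tuple T | G x])).
  by rewrite opprB addrC subrK fineK// fin_num_measure.
have s0 : 0 <= s.
  have := probability_le1 (powerm P n) mG; rewrite sE lee_fin; lra.
move: PG; rewrite sE lee_fin lerD2l lerN2 le_min => /andP[s2].
rewrite ler_pdivlMr// => sL.
have c0 : 0 <= n%:R * (H + delta) by rewrite mulr_ge0// addr_ge0// ltW.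
have := change_of_measure_le hd Ph HE mG pE sE c0 M0.
set ec := expR (n%:R * (H + delta)) => key.
rewrite expRN -div1r ler_pdivrMr ?expR_gt0// -/ec.
have nsL : n%:R * (s * (H + delta + M)) <= n%:R * (delta / 4) by rewrite ler_wpM2l.
have nM : n%:R * expR (- M) <= n%:R * (delta / 4) by rewrite ler_wpM2l.
move: key nsL nM; move: (expR (- M)) => eM'; move: (p * ec) => pe; move: (n%:R : R) nd => N.
clear -s2; lra.
Qed.

(** * Convergence of the conditioned laws *)

Theorem theorem4p8 (R : realType) (E : completeMetricType R)
  (separableE : separable E)
  (alpha : M1 E R) (C : set (M1 E R))
  (closedC : narrow_closed C) (convexC : convex_measures C)
  (finC : (rel_entropy_set C alpha < +oo)%E)
  (alphas : M1 E R) (projC : is_I_projection alpha C alphas)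
  (K : nat -> set E) (compactK : forall n, compact (K n))
  (eta : nat -> R) (eta_gt0 : forall n, 0 < eta n)
  (eta0 : eta n @[n --> \oo] --> 0)
  (growth : (n%:R * eta n ^+ 2
             + 8 * ln (eta n) * covering_number (K n) (eta n / 8))
            @[n --> \oo] --> +oo)
  (dbar : M1 E R -> M1 E R -> \bar R)
  (dbarE : dbar = prohorov \/ dbar = fortet_mourier)
  (eps : nat -> \bar R)
  (epsE : forall n, eps n = ((eta n)%:E + 2%:E * alphas (~` K n))%E)
  (Cn : nat -> set (M1 E R))
  (CnE : forall n, Cn n = closed_nbhd dbar C (eps n))
  (alt :
    ((alphas (K n) ^+ n)%E @[n --> \oo] --> 1%E)
    \/
    ((exists g : E -> R, [/\ continuous g, bounded_fun g &
        {ae alpha, forall x, lne (density alphas alpha x) = (g x)%:E}])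
     /\ alphas (K n) @[n --> \oo] --> 1%E))
  (k : nat) (k_ge1 : (1 <= k)%N) :
  tv_dist (@cond_law _ _ R alpha (Cn n) n k) (powerm alphas k)
    @[n --> \oo] --> 0%E.
Proof.
have [Cs sC] := projC.
have [h [hd hP] [H [sH HE]]] : exists2 h, is_density alpha h /\ has_density alphas alpha h &
    exists H, rel_entropy alphas alpha = H%:E /\ Ent alpha h = H%:E.
  by apply: rel_entropy_lty; rewrite sC.
have [mh h0 _] := hd.
have HC : (H%:E <= rel_entropy_set C alpha)%E by rewrite -sC sH.
have mK n : measurable (K n : set (borel E)).
  rewrite -[K n]setCK; apply: measurableC; apply: sub_sigma_algebra.
  apply: closed_openC; apply: compact_closed => //; exact: metric_hausdorff.
pose kap n := fine (alphas (~` K n)).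
have kapE n : alphas (~` K n) = (kap n)%:E.
  by rewrite /kap fineK// fin_num_measure//; exact: measurableC.
have alphasK n : alphas (K n) = (1 - kap n)%:E.
  by rewrite -[K n]setCK probability_setC; [rewrite kapE|exact: measurableC].
have kap0 n : 0 <= kap n by rewrite -lee_fin -kapE.
have kap1 n : 0 <= 1 - kap n <= 1.
  by rewrite -!lee_fin -alphasK measure_ge0 probability_le1.
have kap_cvg : kap n @[n --> \oo] --> 0.
  suff cvg1 : (1 - kap n) @[n --> \oo] --> (1 : R).
    rewrite -[X in _ --> X](subrr (1 : R)).
    under eq_fun do rewrite -[kap _](subKr 1).
    by apply: cvgB => //; exact: cvg_cst.
  case: alt => [|[_]].
    under eq_fun do rewrite alphasK -EFin_expe.
    by move=> /fine_cvg; exact: expe_cvg1.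
  by under eq_fun do rewrite alphasK; move=> /fine_cvg.
have CnE' n : Cn n = closed_nbhd dbar C (eta n + 2 * kap n)%:E.
  by rewrite CnE epsE kapE -EFinM -EFinD.
have h_in j : almost_in alpha C j h.
  split => // f c tf fc; have := fc _ Cs.
  have [fl f01] := tf.
  rewrite (ge0_integral_density mh h0 hP); first last.
  - by move=> x; rewrite lee_fin; case/andP: (f01 x).
  - by apply: measurable_EFin; exact: lipschitz_measurable.
  by apply: le_trans; rewrite lee_fin gerBl invr_ge0 exprn_ge0.
suff main (e : R) : 0 < e -> \forall n \near \oo,
    (tv_dist (@cond_law _ _ R alpha (Cn n) n k) (powerm alphas k) <= e%:E)%E.
  have tv0 n : (0 <= tv_dist (@cond_law _ _ R alpha (Cn n) n k) (powerm alphas k))%E.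
    pose Q := @cond_law _ _ R alpha (Cn n) n k.
    apply: (@le_trans _ _ `|Q set0 - powerm alphas k set0|%E); first exact: abse_ge0.
    by apply: ereal_sup_ubound; exists set0.
  apply/fine_cvgP; split.
    near=> n; rewrite ge0_fin_numE//; apply: (@le_lt_trans _ _ 1%:E).
      by near: n; exact: main.
    by rewrite ltry.
  apply/cvgrPdist_le => e e0; near=> n.
  rewrite sub0r normrN ger0_norm ?fine_ge0//= -lee_fin.
  have tve : (tv_dist (@cond_law _ _ R alpha (Cn n) n k) (powerm alphas k) <= e%:E)%E.
    by near: n; exact: main.
  by rewrite fineK// ge0_fin_numE// (le_lt_trans tve)// ltry.
move=> e0.
pose l := Num.min 2^-1 (e / (2 + 9 * k%:R)).
have k9 : 0 < 2 + 9 * k%:R :> R by rewrite ltr_pwDl// mulr_ge0.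
have l01 : 0 < l <= 2^-1.
  by rewrite /l lt_min ge_min lexx invr_gt0 ltr0n divr_gt0.
have le : (2 + 9 * k%:R) * l <= e.
  by rewrite mulrC -ler_pdivlMr// /l ge_min lexx orbT.
have l20 : 0 < l ^+ 2 by case/andP: l01 => l0 _; rewrite exprn_gt0.
have [j jent] := almost_in_entropy l20 closedC convexC (ex_intro _ _ Cs) HC.
have j0 : 0 < (2 ^+ j)^-1 :> R by rewrite invr_gt0 exprn_gt0.
have [s s_gt0 close] := metric_close dbarE j0.
have [s0 s0_gt0 lower] := event_prob_lower hd hP HE l20.
have N0 n : 0 <= covering_number (K n) (eta n / 8).
  have e8 : 0 < eta n / 8 by rewrite divr_gt0.
  by have [N [c [_ ->]]] := covering_numberP (compactK n) e8.
suff step n : eta n + 2 * kap n < s ->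
    16 * (covering_number (K n) (eta n / 8) + 1) / (n%:R * eta n ^+ 2) <= s0 ->
    (k <= n)%N -> 1 <= n%:R * l ^+ 2 ->
    (tv_dist (@cond_law _ _ R alpha (Cn n) n k) (powerm alphas k) <= e%:E)%E.
  near=> n; apply: step; near: n.
  - apply: (cvgr_lt (0 : R)) => //.
    rewrite -[X in _ --> X](addr0 0) -{2}(mulr0 2).
    by apply: cvgD => //; apply: cvgM => //; exact: cvg_cst.
  - exact: (growth_ratio eta_gt0 N0 eta0 growth s0_gt0).
  - exact: nbhs_infty_ge.
  - near=> n; rewrite -ler_pdivrMr//; near: n; exact: nbhs_infty_ger.
case: n => [|n] epss ratio kn nl; first by have := leq_trans k_ge1 kn.
have e8 : 0 < eta n.+1 / 8 by rewrite divr_gt0.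
have [N [c [cover NE]]] := covering_numberP (compactK n.+1) e8.
have likely := nbhd_event_prob (eta_gt0 n.+1) (mK n.+1) (kapE n.+1) cover separableE dbarE (ltn0Sn n) Cs.
have mev := @measurable_nbhd_event _ _ dbar C (eta n.+1 + 2 * kap n.+1) n.+1 separableE dbarE (ltn0Sn n).
pose G := nbhd_seq dbar C (eta n.+1 + 2 * kap n.+1).
have GE := @nbhd_seq_event _ _ dbar C (eta n.+1 + 2 * kap n.+1) n.+1.
pose p := fine (powerm alpha n.+1 [set x : n.+1.-tuple (borel E) | G x]).
have mG : measurable [set x : n.+1.-tuple (borel E) | G x] by rewrite GE.
have pE : powerm alpha n.+1 [set x : n.+1.-tuple (borel E) | G x] = p%:E.
  by rewrite /p fineK// fin_num_measure.
have PG : ((1 - s0)%:E <= powerm alphas n.+1 [set x : n.+1.-tuple (borel E) | G x])%E.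
  rewrite GE; apply: le_trans likely; rewrite lee_fin lerD2l lerN2.
  by apply: le_trans ratio; rewrite NE natr1.
have pl := lower n.+1 G p nl mG pE PG.
have p0 : 0 < p := lt_le_trans (expR_gt0 _) pl.
have pH : - ln p <= n.+1%:R * (H + l ^+ 2).
  by rewrite lerNl -[leLHS]expRK ler_ln ?posrE ?expR_gt0.
have g_in : almost_in alpha C j (cond_density alpha n G p).
  apply: (cond_density_almost_in dbarE _ _ p0 epss) => //.
  by rewrite -GE.
rewrite CnE'; apply: ub_ereal_sup => _ [D mD <-].
apply: (le_trans (cond_law_close mG _ pE p0 hd hP _ l01 _ pH _ _ mD _)).
- by move=> i t; exact: nbhd_seq_rot.
- by rewrite HE.
- by rewrite k_ge1.
- exact: jent.
- by apply: jent; exact: almost_in_mid.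
- by move=> x; rewrite -nbhd_seqE.
- by rewrite lee_fin.
Unshelve. all: by end_near. Qed.
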